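(* For each $n = 1, 2, \ldots$, the spin factor $V_{2n+1}$ has precisely three $JC$-operator space structures, two of which are completely isometric (to each other).
   Context: $V_{2n+1}$ denotes the (complex, $(2n+2)$-dimensional) spin factor generated by the identity and a spin system of $2n+1$ elements. Concretely, let $\sigma_1 = \begin{pmatrix}1&0\\0&-1\end{pmatrix}$, $\sigma_2 = \begin{pmatrix}0&1\\1&0\end{pmatrix}$, $\sigma_3 = \begin{pmatrix}0&i\\-i&0\end{pmatrix}$, let $x^k$ denote the $k$-fold tensor product $x\otimes\cdots\otimes x$ for $x\in M_2(\mathbb{C})$ (with $x^0$ omitted from tensor products), and let $1_2$ be the identity of $M_2(\mathbb C)$. For $1\le k\le n$ put $s_{2k-1} = \sigma_3^{k-1}\otimes\sigma_1\otimes 1_2^{n-k}$ and $s_{2k} = \sigma_3^{k-1}\otimes\sigma_2\otimes 1_2^{n-k}$ in $M_{2^n}(\mathbb{C})$, $V_{2n} = \mathrm{span}\{1, s_1,\ldots,s_{2n}\}$, $s_{2n+1} = \sigma_3^n\otimes\sigma_1\in M_{2^{n+1}}(\mathbb C)$, and $V_{2n+1} = \mathrm{span}\{V_{2n}\otimes 1_2, s_{2n+1}\}\subset M_{2^{n+1}}(\mathbb{C})$. A $JC^*$-subtriple of $\mathcal{B}(H)$ is a norm closed subspace closed under $\{a,b,c\} = \tfrac12(ab^*c + cb^*a)$; a $JC^*$-triple is a complex Banach space linearly isometric to such a subtriple for some $H$. A $JC$-operator space structure on a $JC^*$-triple $E$ is an operator space structure (i.e. system of matrix norms) determined by a linear isometry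 from $E$ onto a $JC^*$-subtriple of some $\mathcal{B}(H)$. Two such structures $E_1,E_2$ on $E$ are equal if and only if the identity map $E_1\to E_2$ is a complete isometry; they are completely isometric if there is some linear complete isometry of $E_1$ onto $E_2$. *)

(* Defs.v *)
From HB Require Import structures.
From mathcomp Require Import all_boot all_order all_algebra.
From mathcomp Require Import all_classical all_reals all_analysis.
From mathcomp Require Import complex mxtens.

Set Implicit Arguments.
Unset Strict Implicit.
Unset Printing Implicit Defensive.

Import Order.TTheory GRing.Theory Num.Theory.
Import numFieldNormedType.Exports.

Local Open Scope classical_set_scope.
Local Open Scope ring_scope.
Local Open Scope complex_scope.

(* The complex numbers are R[i], for a realType R. Norms in the library take
   their values in R[i]; the norms defined below are converted to R by
   complex.Re. *)

Record hilbert (R : realType) := Hilbert {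
  hilbert_space :> completeNormedModType R[i];
  inner : {dot hilbert_space for Num.conj};
  innerE : forall x : hilbert_space, `|x| ^+ 2 = inner x x }.

Section Operators.
Variables (R : realType) (H : hilbert R).

Definition bounded_op (T : H -> H) : Prop := linear T /\ continuous T.

Definition is_adjoint (T T' : H -> H) : Prop :=
  forall x y, inner H (T x) y = inner H x (T' y).

Definition opnorm (T : H -> H) : R :=
  sup [set complex.Re `|T x| | x in [set x : H | `|x| <= 1]].

(* {a, b, c} with b' standing for the adjoint of b *)
Definition triple (a b' c : H -> H) : H -> H :=
  2^-1 *: ((a \o b' \o c) + (c \o b' \o a)).

Definition norm_closed (S : set (H -> H)) : Prop :=
  forall T, bounded_op T ->
    (forall e : R, 0 < e -> exists2 T0, S T0 & opnorm (T - T0) < e) -> S T.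

(* Every bounded operator has exactly one adjoint, which is bounded; so the
   existential in the last clause only names b^*. *)
Definition JC_subtriple (S : set (H -> H)) : Prop :=
  [/\ S `<=` bounded_op,
      S 0 /\ (forall (z : R[i]) T1 T2, S T1 -> S T2 -> S (z *: T1 + T2)),
      norm_closed S &
      forall a b c, S a -> S b -> S c ->
        exists b', [/\ bounded_op b', is_adjoint b b' & S (triple a b' c)]].

End Operators.

(* The Hilbert direct sum norm of a finite family of vectors. *)
Definition l2norm (R : realType) (V : normedZmodType R[i]) m
    (x : 'I_m -> V) : R :=
  Num.sqrt (\sum_i complex.Re `|x i| ^+ 2).

(* The norm of M_m(B(H)) = B(H^m). *)
Definition amp_opnorm (R : realType) (H : hilbert R) m
    (T : 'I_m -> 'I_m -> H -> H) : R :=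
  sup [set l2norm (fun i => \sum_j T i j (x j))
      | x in [set x : 'I_m -> H | l2norm x <= 1]].

(* The operator norm of M_k(C) = B(C^k). *)
Definition mx_opnorm (R : realType) k (A : 'M[R[i]]_k) : R :=
  sup [set l2norm (fun i => (A *m x) i 0)
      | x in [set x : 'cV[R[i]]_k | l2norm (fun i => x i 0) <= 1]].

Section OperatorSpaceStructures.
Variables (R : realType) (E : lmodType R[i]).

Definition matrix_norms := forall m, 'M[E]_m -> R.

(* nrm is the given norm of E. *)
Definition JC_structure (nrm : E -> R) (N : matrix_norms) : Prop :=
  exists (H : hilbert R) (phi : {linear E -> (H -> H)}),
    [/\ JC_subtriple (range phi),
        (forall x, opnorm (phi x) = nrm x) &
        forall m (A : 'M[E]_m), N m A = amp_opnorm (fun i j => phi (A i j))].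

Definition complete_isometry (N1 N2 : matrix_norms) (f : E -> E) : Prop :=
  forall m (A : 'M[E]_m), N2 m (map_mx f A) = N1 m A.

Definition same_structure (N1 N2 : matrix_norms) : Prop :=
  complete_isometry N1 N2 idfun.

Definition completely_isometric (N1 N2 : matrix_norms) : Prop :=
  exists f : {linear E -> E},
    set_surj setT setT f /\ complete_isometry N1 N2 f.

End OperatorSpaceStructures.

Section SpinFactor.
Variable R : realType.
Local Notation C := R[i].

Definition sigma1 : 'M[C]_2 :=
  \matrix_(i, j) (if i == j then (-1) ^+ i else 0).
Definition sigma2 : 'M[C]_2 :=
  \matrix_(i, j) (if i == j then 0 else 1).
Definition sigma3 : 'M[C]_2 :=
  \matrix_(i, j) (if i == j then 0 else (-1) ^+ i * 'i%C).

Variable n : nat.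

Lemma spin_dim (k : 'I_n) : (2 ^ k * 2 * 2 ^ (n - k.+1) = 2 ^ n)%N.
Proof. by rewrite -expnSr -expnD subnKC. Qed.

(* sigma3^k (x) x (x) 1_2^(n-k-1), with k counted from 0: for x = sigma1 this
   is s_(2k+1), and for x = sigma2 it is s_(2k+2). *)
Definition spin (x : 'M[C]_2) (k : 'I_n) : 'M[C]_(2 ^ n) :=
  castmx (spin_dim k, spin_dim k)
    (sigma3 ^t k *t x *t (1%:M : 'M[C]_2) ^t (n - k.+1)).

Definition V_even : {vspace 'M[C]_(2 ^ n)} :=
  <<1%:M :: [seq spin sigma1 k | k <- enum 'I_n]
         ++ [seq spin sigma2 k | k <- enum 'I_n]>>%VS.

Definition tens1 (A : 'M[C]_(2 ^ n)) : 'M[C]_(2 ^ n * 2) :=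
  A *t (1%:M : 'M[C]_2).

Lemma tens1_is_linear : linear tens1.
Proof. by move=> z A B; apply/matrixP => i j; rewrite !mxE mulrDl mulrA. Qed.

HB.instance Definition _ :=
  GRing.isLinear.Build C 'M[C]_(2 ^ n) 'M[C]_(2 ^ n * 2) _ tens1
    tens1_is_linear.

Definition spin_last : 'M[C]_(2 ^ n * 2) := sigma3 ^t n *t sigma1.

Definition V_odd : {vspace 'M[C]_(2 ^ n * 2)} :=
  (linfun tens1 @: V_even + <[spin_last]>)%VS.

End SpinFactor.

(* The operator norm of M_(2^(n+1))(C), restricted to V_(2n+1). *)
Definition V_odd_norm (R : realType) n (v : subvs_of (V_odd R n)) : R :=
  mx_opnorm (vsval v).

(* Main.v *)
(* Write s_0, ..., s_(2n) for the anticommuting symmetries that generate the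
   spin factor together with 1, and let phi be an isometry of it onto a
   JC*-subtriple. For x = 1, s_j and the unitary mixtures (3 x + 4 y) / 5 of two
   of these (or of one of them and i times another), put U = phi x. The elements
   U - U U^* U and b - U U^* b U^* U of the triple vanish to first order in the norm
   when they perturb U; read back in M_(2^(n+1)), where x is unitary, such a
   perturbation has numerical range zero and is zero. Hence phi x is a partial
   isometry whose range projection Q does not depend on x, and S_j = phi(s_j)
   phi(1)^* are anticommuting symmetries of the range of Q; the matrix norms of
   phi are those of the span of Q and the S_j.
   The product z = i^n S_0 ... S_(2n) is a central symmetry. On each of its
   eigenspaces the S_j generate matrix units given by formulas in the S_j that
   depend only on n and on the eigenvalue, so the matrix norms depend only on
   which eigenspaces are nonzero: at most three structures arise. They come from
   the two eigenspaces of z in the concrete spin factor, and from their sum.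
   Replacing s_j by - s_j exchanges the two eigenspaces, so these two structures
   are completely isometric. They are distinguished by the element
   sum_p conj(G_p P) (x) G_p, with G_0 = 1, G_(j+1) = s_j and P an eigenprojection
   of z. A complete isometry f of one of them onto the third would, as the third
   dominates both, make both of them the same after composition with f. *)

Require Import Defs.
From HB Require Import structures.
From mathcomp Require Import all_boot all_order all_algebra.
From mathcomp Require Import all_classical all_reals all_analysis.
From mathcomp Require Import complex mxtens spectral.
From mathcomp Require Import ring lra zify.

Set Implicit Arguments.
Unset Strict Implicit.
Unset Printing Implicit Defensive.

Import Order.TTheory GRing.Theory Num.Theory.
Import numFieldNormedType.Exports.

Local Open Scope classical_set_scope.
Local Open Scope ring_scope.
Local Open Scope complex_scope.

(** * The Hilbert space C^N *)

Section FiniteHilbert.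
Variable R : realType.
Local Notation C := R[i].

(** An isometry transports norms only, neither products nor adjoints. A relation in the triple must
    therefore become a norm estimate before it can be read in the matrices: U + s a Z has squared
    norm at most 1 + O(s^2), for small real s and a = 1 or i. Norms are handled through the
    constants k with |T x|^2 <= k |x|^2; equality of two norms becomes equivalence of two such
    conditions, and no supremum is computed. The formulas for the matrix units come from an
    induction on n: S_0 and S_1 generate a copy of M_2, and the i S_0 S_1 S_(j+2) form a system with
    two generators fewer that commutes with this copy and has the same z. Each eigenspace of z by
    itself must give back the norm of the spin factor. For a single element, a unitary conjugates
    its vector part v into - v; such a unitary is found among the real combinations of three
    generators, which is where n >= 1 enters. It depends on the element, hence says nothing about
    matrices of elements. *)

Definition coldot N (x y : 'cV[C]_N) : C := \sum_i x i 0 * Num.conj (y i 0).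

Lemma coldot_bilinear N :
  bilinear_for (GRing.mul : GRing.Scale.law C C)
               (Num.conj \; *%R : GRing.Scale.law C C) (@coldot N).
Proof.
split=> [u a x y|u a x y] /=; rewrite /coldot mulr_sumr -big_split /=;
  apply: eq_bigr => i _; rewrite !mxE; first by rewrite mulrDl mulrA.
by rewrite rmorphD rmorphM mulrDr mulrCA.
Qed.
HB.instance Definition _ N :=
  bilinear_isBilinear.Build C _ _ _ _ _ (@coldot N) (coldot_bilinear N).

Lemma coldot_hermitian N (x y : 'cV[C]_N) :
  coldot x y = (-1) ^+ false * Num.conj (coldot y x).
Proof.
rewrite mul1r /coldot rmorph_sum; apply: eq_bigr => i _.
by rewrite rmorphM /= conjCK mulrC.
Qed.
HB.instance Definition _ N :=
  isHermitianSesquilinear.Build C _ false Num.conj (@coldot N)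
    (@coldot_hermitian N).

Lemma coldot_gt0 N (x : 'cV[C]_N) : x != 0 -> 0 < coldot x x.
Proof.
move=> /cV0Pn [i xi]; rewrite /coldot (bigD1 i) //= ltr_pwDl //.
  by rewrite -normCK exprn_gt0 ?normr_gt0.
by rewrite sumr_ge0 // => j _; rewrite -normCK exprn_ge0.
Qed.
HB.instance Definition _ N :=
  isDotProduct.Build C _ (@coldot N) (@coldot_gt0 N).

Lemma normC_Re (z : C) : `|z| = (complex.Re `|z|)%:C.
Proof. by rewrite RRe_real ?normr_real. Qed.

Lemma coldotxx N (x : 'cV[C]_N) :
  coldot x x = (l2norm (fun i => x i 0) ^+ 2)%:C.
Proof.
rewrite /l2norm sqr_sqrtr; last by rewrite sumr_ge0 // => i _; rewrite sqr_ge0.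
rewrite rmorph_sum; apply: eq_bigr => i _.
by rewrite -normCK normC_Re rmorphXn.
Qed.

Lemma l2norm_ge0 (V : normedZmodType C) m (x : 'I_m -> V) : 0 <= l2norm x.
Proof. exact: sqrtr_ge0. Qed.

Lemma sqrtC_coldot N (x : 'cV[C]_N) :
  sqrtC (coldot x x) = (l2norm (fun i => x i 0))%:C.
Proof.
by rewrite coldotxx rmorphXn /= sqrCK // ler0c l2norm_ge0.
Qed.

(** A separate name for the column vectors, so that the norm attached to it is the Euclidean one. *)
Definition cspace N := 'cV[C]_N.
HB.instance Definition _ N := GRing.Lmodule.on (cspace N).

Definition cnorm N (x : cspace N) : C := (l2norm (fun i => x i 0))%:C.

Lemma cnormD N (x y : cspace N) : cnorm (x + y) <= cnorm x + cnorm y.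
Proof.
by rewrite /cnorm -!sqrtC_coldot; exact: (triangle_lerif (@coldot N) x y).1.
Qed.

Lemma cnormZ N (a : C) (x : cspace N) : cnorm (a *: x) = `|a| * cnorm x.
Proof.
rewrite /cnorm -!sqrtC_coldot [coldot _ _](dnormZ (@coldot N)).
by rewrite sqrtCM ?nnegrE ?exprn_ge0 ?dnorm_ge0 // sqrCK.
Qed.

Lemma cnorm_eq0 N (x : cspace N) : cnorm x = 0 -> x = 0.
Proof.
by rewrite /cnorm -sqrtC_coldot => /eqP; rewrite sqrtC_eq0 (dnorm_eq0 (@coldot N)) => /eqP.
Qed.

HB.instance Definition _ N := Lmodule_isNormed.Build C (cspace N)
  (@cnormD N) (@cnormZ N) (@cnorm_eq0 N).

Lemma cspace_normE N (x : cspace N) : `|x| = (l2norm (fun i => x i 0))%:C.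
Proof. by []. Qed.

Lemma normc_ge_Im (x : C) : `|complex.Im x|%:C <= `|x|.
Proof.
have := normc_ge_Re (x * 'i); rewrite normrM ReiNIm normrN.
by rewrite [`|'i|]normc_def /= expr0n expr1n add0r sqrtr1 mulr1.
Qed.

Lemma cspace_entry N (x : cspace N) i : `|x i 0| <= `|x|.
Proof.
rewrite cspace_normE normC_Re lecR -[complex.Re _]ger0_norm; last first.
  by rewrite -ler0c -normC_Re.
rewrite -sqrtr_sqr /l2norm ler_sqrt ?sumr_ge0// ?sqr_ge0//.
  by rewrite (bigD1 i) //= lerDl sumr_ge0 // => j _; rewrite sqr_ge0.
by move=> j _; rewrite sqr_ge0.
Qed.

Lemma cspace_norm_le N (x : cspace N) : `|x| <= \sum_i `|x i 0|.
Proof.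
have -> : x = \sum_i x i 0 *: (delta_mx i 0 : cspace N).
  apply/matrixP => i j; rewrite summxE (bigD1 i) //= !mxE !eqxx (ord1 j) eqxx mulr1.
  by rewrite big1 ?addr0 // => k ki; rewrite !mxE eq_sym (negPf ki) mulr0.
apply: (le_trans (ler_norm_sum _ _ _)); apply: ler_sum => i _.
rewrite normrZ cspace_normE.
have -> : l2norm (fun j => (delta_mx i 0 : cspace N) j 0) = 1.
  rewrite /l2norm (eq_bigr (fun j => (j == i)%:R)); last first.
    move=> j _; rewrite mxE andbT.
    by case: (j == i); rewrite ?normr1 ?normr0 ?expr1n ?expr0n.
  rewrite (bigD1 i) //= eqxx big1 ?addr0 ?sqrtr1 //.
  by move=> j /negPf ->.
rewrite mulr1 summxE (bigD1 i) //= !mxE !eqxx mulr1 big1 ?addr0 //.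
by move=> k ki; rewrite !mxE eq_sym (negPf ki) mulr0.
Qed.

Lemma cspaceB N (x y : cspace N) i : (x - y) i 0 = x i 0 - y i 0.
Proof. by rewrite -[x - y]/((x : 'cV[C]_N) - y) !mxE. Qed.

Lemma cspace_complete N (F : set_system (cspace N)) :
  ProperFilter F -> cauchy F -> cvg F.
Proof.
move=> FF /cauchyP FC; apply/cvg_ex.
have cRe i : cvg ((fun x : cspace N => complex.Re (x i 0)) @ F).
  apply: cauchy_cvg; apply: cauchy_exP => e e0.
  have := FC e%:C; rewrite ltcR => /(_ e0) [x Fx]; exists (complex.Re (x i 0)).
  suff : F [set y : cspace N | ball (complex.Re (x i 0)) e (complex.Re (y i 0))].
    by [].
  apply: filterS Fx => y; rewrite -!ball_normE /= => h.
  rewrite -ltcR; apply: le_lt_trans h; apply: le_trans (cspace_entry _ i).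
  by apply: le_trans (normc_ge_Re _); rewrite cspaceB raddfB.
have cIm i : cvg ((fun x : cspace N => complex.Im (x i 0)) @ F).
  apply: cauchy_cvg; apply: cauchy_exP => e e0.
  have := FC e%:C; rewrite ltcR => /(_ e0) [x Fx]; exists (complex.Im (x i 0)).
  suff : F [set y : cspace N | ball (complex.Im (x i 0)) e (complex.Im (y i 0))].
    by [].
  apply: filterS Fx => y; rewrite -!ball_normE /= => h.
  rewrite -ltcR; apply: le_lt_trans h; apply: le_trans (cspace_entry _ i).
  by apply: le_trans (normc_ge_Im _); rewrite cspaceB raddfB.
pose l : cspace N := \col_i (lim ((fun x : cspace N => complex.Re (x i 0)) @ F)
  +i* lim ((fun x : cspace N => complex.Im (x i 0)) @ F)).
exists l; apply/cvgrPdist_lt => /= e e0.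
have [d d0 ->] : exists2 d : R, 0 < d & e = d%:C.
  move: e0; rewrite ltcE => /andP [/eqP Im0 Re0]; exists (complex.Re e) => //.
  by apply/eqP; rewrite eq_complex /= Im0 !eqxx.
(* Each of the N entries contributes less than 2 d', one d' for its real and one for its imaginary
   part; [N.+1] keeps the quotient meaningful for N = 0. *)
pose d' := d / (2 * N.+1%:R).
have d'0 : 0 < d' by rewrite divr_gt0 // mulr_gt0.
have H i : \forall x \near F, `|(l - x) i 0| < (2 * d')%:C.
  have h1 := cRe i; have h2 := cIm i.
  move/cvgrPdist_lt: h1 => /(_ _ d'0) h1; move/cvgrPdist_lt: h2 => /(_ _ d'0) h2.
  near=> x.
  rewrite (complexE ((l - x) i 0)); apply: le_lt_trans (ler_normD _ _) _.
  rewrite normrM [`|'i|]normc_def /= expr0n expr1n add0r sqrtr1 mul1r.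
  rewrite !normc_def /= expr0n /= !addr0 !sqrtr_sqr -rmorphD ltcR mulr_natl mulr2n.
  apply: ltrD; rewrite cspaceB mxE raddfB /=.
    by near: x.
  by near: x.
near=> x.
apply: le_lt_trans (cspace_norm_le _) _.
apply: (@le_lt_trans _ _ (\sum_(i < N) (2 * d')%:C)).
  apply: ler_sum => i _; apply: ltW; move: i; near: x.
  exact: filter_forall.
rewrite sumr_const card_ord -rmorphMn ltcR /d' /= -mulr_natr.
rewrite [X in X < _](_ : _ = d * (N%:R / N.+1%:R)); last first.
  by field; rewrite nat1r pnatr_eq0.
by rewrite gtr_pMr // ltr_pdivrMr // mul1r ltr_nat.
Unshelve. all: by end_near. Qed.

HB.instance Definition _ N := Uniform_isComplete.Build (cspace N) (@cspace_complete N).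

Lemma coldotE N (x : cspace N) : `|x| ^+ 2 = (@coldot N : {dot _ for _}) x x.
Proof. by rewrite cspace_normE -rmorphXn; symmetry; exact: coldotxx. Qed.

Definition Cn N : hilbert R := @Hilbert R (cspace N) (@coldot N) (@coldotE N).

End FiniteHilbert.

(** * Hilbert spaces and amplifications *)

Section LinearFunctions.
Variables (K : pzRingType) (U V : lmodType K) (f : U -> V).
Hypothesis linf : linear f.

Lemma linear_fun0 : f 0 = 0.
Proof. by have := linf (-1) 0 0; rewrite scaler0 addr0 scaleN1r addNr. Qed.
Lemma linear_funZ a x : f (a *: x) = a *: f x.
Proof. by have := linf a x 0; rewrite linear_fun0 !addr0. Qed.
Lemma linear_funD x y : f (x + y) = f x + f y.
Proof. by have := linf 1 x y; rewrite !scale1r. Qed.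
Lemma linear_funN x : f (- x) = - f x.
Proof. by rewrite -scaleN1r linear_funZ scaleN1r. Qed.
Lemma linear_funB x y : f (x - y) = f x - f y.
Proof. by rewrite linear_funD linear_funN. Qed.
Lemma linear_fun_sum I (r : seq I) (P : pred I) (F : I -> U) :
  f (\sum_(i <- r | P i) F i) = \sum_(i <- r | P i) f (F i).
Proof. exact: (big_morph f linear_funD linear_fun0). Qed.
End LinearFunctions.

Section HilbertBasics.
Variables (R : realType) (H : hilbert R).
Local Notation C := R[i].
Implicit Types (x y z : H) (a : C).
Local Notation "<< x , y >>" := (inner H x y).

(** Squared norms are kept as real numbers, so that most estimates become linear inequalities
    between values of [q] and [rip]. *)
Definition q x : R := complex.Re (inner H x x).
Definition rip x y : R := complex.Re (inner H x y).

Lemma ipDl x y z : << x + y, z >> = << x, z >> + << y, z >>.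
Proof. exact: linearDl. Qed.
Lemma ipDr x y z : << x, y + z >> = << x, y >> + << x, z >>.
Proof. exact: linearDr. Qed.
Lemma ipZl a x y : << a *: x, y >> = a * << x, y >>.
Proof. exact: linearZl_LR. Qed.
Lemma ipZr a x y : << x, a *: y >> = Num.conj a * << x, y >>.
Proof. by rewrite (linearZr_LR (inner H)). Qed.
Lemma ipC x y : << x, y >> = Num.conj << y, x >>.
Proof. by rewrite (hermC (inner H)) /= expr0 mul1r. Qed.
Lemma ip0l y : << 0, y >> = 0. Proof. exact: linear0l. Qed.
Lemma ip0r x : << x, 0 >> = 0. Proof. exact: linear0r. Qed.
Lemma ipNl x y : << - x, y >> = - << x, y >>. Proof. exact: linearNl. Qed.
Lemma ipNr x y : << x, - y >> = - << x, y >>. Proof. exact: linearNr. Qed.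
Lemma ipBl x y z : << x - y, z >> = << x, z >> - << y, z >>.
Proof. exact: linearBl. Qed.
Lemma ipBr x y z : << x, y - z >> = << x, y >> - << x, z >>.
Proof. exact: linearBr. Qed.
Lemma ip_suml I r (P : pred I) (f : I -> H) y :
  << \sum_(i <- r | P i) f i, y >> = \sum_(i <- r | P i) << f i, y >>.
Proof. exact: linear_sumlz. Qed.
Lemma ip_sumr I r (P : pred I) (f : I -> H) y :
  << y, \sum_(i <- r | P i) f i >> = \sum_(i <- r | P i) << y, f i >>.
Proof. exact: linear_sumr. Qed.

Lemma ipxx x : << x, x >> = (q x)%:C.
Proof.
by rewrite /q RRe_real // -innerE realX // normr_real.
Qed.

Lemma Re_norm_ge0 (V : normedZmodType C) (v : V) : 0 <= complex.Re `|v|.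
Proof. by rewrite -ler0c RRe_real ?normr_real. Qed.

Lemma Re_normX x : complex.Re `|x| ^+ 2 = q x.
Proof.
by apply: complexI; rewrite rmorphXn /= RRe_real ?normr_real // innerE ipxx.
Qed.

Lemma Re_normE x : complex.Re `|x| = Num.sqrt (q x).
Proof. by rewrite -Re_normX sqrtr_sqr ger0_norm // Re_norm_ge0. Qed.

Lemma q_ge0 x : 0 <= q x.
Proof. by rewrite -Re_normX sqr_ge0. Qed.
Hint Resolve q_ge0 : core.

Lemma q_eq0 x : q x = 0 -> x = 0.
Proof.
by move=> h; apply/eqP; rewrite -(dnorm_eq0 (inner H)) /= ipxx h.
Qed.

Lemma q0 : q 0 = 0. Proof. by rewrite /q ip0l. Qed.

Lemma ripC x y : rip x y = rip y x.
Proof. by rewrite /rip ipC; case: << y, x >>. Qed.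
Lemma ripDl x y z : rip (x + y) z = rip x z + rip y z.
Proof. by rewrite /rip ipDl raddfD. Qed.
Lemma ripDr x y z : rip x (y + z) = rip x y + rip x z.
Proof. by rewrite /rip ipDr raddfD. Qed.
Lemma ripNr x y : rip x (- y) = - rip x y.
Proof. by rewrite /rip ipNr raddfN. Qed.
Lemma Re_mulR (k : R) (a : C) : complex.Re (k%:C * a) = k * complex.Re a.
Proof. by case: a => b c /=; rewrite mul0r subr0. Qed.
Lemma ripZl (k : R) x y : rip (k%:C *: x) y = k * rip x y.
Proof. by rewrite /rip ipZl Re_mulR. Qed.
Lemma ripZr (k : R) x y : rip x (k%:C *: y) = k * rip x y.
Proof. by rewrite ripC ripZl ripC. Qed.
Lemma ripxx x : rip x x = q x. Proof. by []. Qed.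

Lemma qD x y : q (x + y) = q x + q y + 2 * rip x y.
Proof.
by rewrite -!ripxx ripDl !ripDr (ripC y x); ring.
Qed.
Lemma qN x : q (- x) = q x.
Proof. by rewrite /q ipNl ipNr opprK. Qed.
Lemma qB x y : q (x - y) = q x + q y - 2 * rip x y.
Proof. by rewrite qD qN ripNr mulrN. Qed.
Lemma qZ a x : q (a *: x) = (complex.Re a ^+ 2 + complex.Im a ^+ 2) * q x.
Proof.
rewrite /q ipZl ipZr ipxx; case: a => b c /=; ring.
Qed.
Lemma qZr (k : R) x : q (k%:C *: x) = k ^+ 2 * q x.
Proof. by rewrite qZ /= expr0n addr0. Qed.

Lemma rip_le x y : 2 * rip x y <= q x + q y.
Proof. by have := q_ge0 (x - y); rewrite qB subr_ge0. Qed.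

Lemma qD_le x y : q (x + y) <= 2 * (q x + q y).
Proof. by rewrite qD; have := rip_le x y; lra. Qed.

(** Twice the left side is a sum over pairs of 2 Re <x_i, x_j>, and each term is at most q(x_i) +
    q(x_j). *)
Lemma q_sum_le (I : finType) (P : pred I) (x : I -> H) :
  q (\sum_(i | P i) x i) <= #|P|%:R * \sum_(i | P i) q (x i).
Proof.
rewrite -(ler_pM2l (_ : 0 < 2 :> R)) //.
have -> : 2 * q (\sum_(i | P i) x i) =
    \sum_(i | P i) \sum_(j | P j) 2 * rip (x i) (x j).
  rewrite /q ip_suml raddf_sum mulr_sumr; apply: eq_bigr => i _.
  by rewrite ip_sumr raddf_sum mulr_sumr.
have -> : 2 * (#|P|%:R * \sum_(i | P i) q (x i)) =
    \sum_(i | P i) \sum_(j | P j) (q (x i) + q (x j)).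
  under [RHS]eq_bigr do rewrite big_split sumr_const /=.
  rewrite big_split sumr_const sumrMnl /= -(mulr_natl (\sum_(i | P i) q (x i))).
  by ring.
by apply: ler_sum => i _; apply: ler_sum => j _; exact: rip_le.
Qed.

Lemma ip_inj x y : (forall z, << x, z >> = << y, z >>) -> x = y.
Proof.
move=> h; apply/eqP; rewrite -subr_eq0; apply/eqP/q_eq0.
by rewrite /q ipBl h subrr.
Qed.

End HilbertBasics.
#[global] Hint Extern 0 (is_true (0 <= q _)) => exact: q_ge0 : core.

Section Amplification.
Variables (R : realType) (H : hilbert R).
Local Notation C := R[i].

Lemma l2normE m (x : 'I_m -> H) : l2norm x = Num.sqrt (\sum_i q (x i)).
Proof. by congr Num.sqrt; apply: eq_bigr => i _; rewrite Re_normX. Qed.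

(** [k] bounds the square of the norm of [T] on H^m. This condition, free of suprema, is what gets
    compared between representations. *)
Definition amp_bnd m (T : 'I_m -> 'I_m -> H -> H) (k : R) : Prop :=
  forall x : 'I_m -> H,
    \sum_i q (\sum_j T i j (x j)) <= k * \sum_i q (x i).

Definition amp_linear m (T : 'I_m -> 'I_m -> H -> H) : Prop :=
  forall i j, linear (T i j).

Variables (m : nat) (T : 'I_m -> 'I_m -> H -> H).
Hypothesis linT : amp_linear T.

Lemma T_Z i j a x : T i j (a *: x) = a *: T i j x.
Proof. exact: linear_funZ. Qed.
Lemma T_0 i j : T i j 0 = 0.
Proof. exact: linear_fun0. Qed.

Let S := [set l2norm (fun i => \sum_j T i j (x j))
      | x in [set x : 'I_m -> H | l2norm x <= 1]].

Lemma amp_opnorm_le k : 0 <= k -> amp_bnd T k -> amp_opnorm T <= Num.sqrt k.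
Proof.
move=> k0 hk; rewrite /amp_opnorm; apply: ge_sup.
  exists (l2norm (fun i : 'I_m => \sum_j T i j 0)); exists (fun=> 0) => //=.
  by rewrite l2normE big1 ?sqrtr0 // => i _; rewrite q0.
move=> _ [x /= x1 <-]; rewrite l2normE ler_sqrt //.
apply: le_trans (hk x) _; rewrite ler_piMr //.
move: x1; rewrite l2normE -{1}sqrtr1 ler_sqrt //.
Qed.

Lemma le_amp_opnorm k x : 0 <= k -> amp_bnd T k -> l2norm x <= 1 ->
  l2norm (fun i => \sum_j T i j (x j)) <= amp_opnorm T.
Proof.
move=> k0 hk x1; apply: ub_le_sup; last by exists x.
exists (Num.sqrt k) => _ [y /= y1 <-]; rewrite l2normE ler_sqrt //.
apply: le_trans (hk y) _; rewrite ler_piMr //.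
move: y1; rewrite l2normE -{1}sqrtr1 ler_sqrt //.
Qed.

Lemma amp_opnorm_ge0 k : 0 <= k -> amp_bnd T k -> 0 <= amp_opnorm T.
Proof.
move=> k0 hk.
apply: le_trans (@le_amp_opnorm _ (fun=> 0) k0 hk _); first exact: l2norm_ge0.
by rewrite l2normE big1 ?sqrtr0 // => i _; rewrite q0.
Qed.

(** The a priori bound [k0] makes the supremum in [amp_opnorm] a genuine one, since [sup] has a
    default value on unbounded sets. The rest is rescaling to a vector of norm 1. *)
Lemma amp_bnd_opnorm k0 k : 0 <= k0 -> amp_bnd T k0 -> 0 <= k ->
  amp_opnorm T <= Num.sqrt k -> amp_bnd T k.
Proof.
move=> k00 hk0 k1 hT x; set s := \sum_i q (x i).
have s0 : 0 <= s by apply: sumr_ge0.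
have [s_eq0|s_gt0] := eqVneq s 0.
  have x0 i : x i = 0.
    apply: q_eq0; apply/eqP; move/eqP: s_eq0.
    by rewrite psumr_eq0 // => /allP /(_ i); rewrite mem_index_enum => /(_ isT).
  rewrite s_eq0 mulr0 big1 // => i _.
  by rewrite big1 ?q0 // => j _; rewrite x0 T_0.
have sp : 0 < s by rewrite lt_def s_gt0.
pose c := (Num.sqrt s)^-1.
have c2 : c ^+ 2 = s^-1 by rewrite exprVn sqr_sqrtr.
have /(le_amp_opnorm k00 hk0) : l2norm (fun i => c%:C *: x i) <= 1.
  rewrite l2normE (eq_bigr (fun i => c ^+ 2 * q (x i))); last first.
    by move=> i _; rewrite qZr.
  by rewrite -mulr_sumr -/s c2 mulVf // sqrtr1.
move=> /le_trans /(_ hT); rewrite l2normE ler_sqrt //.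
rewrite (eq_bigr (fun i => c ^+ 2 * q (\sum_j T i j (x j)))); last first.
  move=> i _; rewrite -qZr scaler_sumr; congr q.
  by apply: eq_bigr => j _; rewrite T_Z.
by rewrite -mulr_sumr c2 mulrC ler_pdivrMr.
Qed.

End Amplification.

(** The hypothesis is applied to the best constant, the square of the norm of [T]. *)
Lemma amp_opnorm_mono (R : realType) (H H' : hilbert R) m
  (T : 'I_m -> 'I_m -> H -> H) (T' : 'I_m -> 'I_m -> H' -> H') :
  amp_linear T -> (exists2 k, 0 <= k & amp_bnd T k) ->
  (forall k, 0 <= k -> amp_bnd T k -> amp_bnd T' k) ->
  amp_opnorm T' <= amp_opnorm T.
Proof.
move=> lT [k k0 hk] h; have a0 := amp_opnorm_ge0 k0 hk.
have hh : Num.sqrt (amp_opnorm T ^+ 2) = amp_opnorm T.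
  by rewrite sqrtr_sqr ger0_norm.
rewrite -hh; apply: amp_opnorm_le; first exact: sqr_ge0.
by apply: h (sqr_ge0 _) _; apply: (amp_bnd_opnorm lT k0 hk) (sqr_ge0 _) _; rewrite hh.
Qed.

Lemma amp_opnorm_eq (R : realType) (H H' : hilbert R) m
  (T : 'I_m -> 'I_m -> H -> H) (T' : 'I_m -> 'I_m -> H' -> H') :
  amp_linear T -> amp_linear T' -> (exists2 k, 0 <= k & amp_bnd T k) ->
  (forall k, 0 <= k -> amp_bnd T k <-> amp_bnd T' k) ->
  amp_opnorm T = amp_opnorm T'.
Proof.
move=> lT lT' [k k0 hk] h; apply/eqP; rewrite eq_le; apply/andP; split.
  apply: amp_opnorm_mono => //; first by exists k => //; apply/h.
  by move=> k' k'0 /h; apply.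
apply: amp_opnorm_mono => //; first by exists k.
by move=> k' k'0 /h; apply.
Qed.

Section Opnorm.
Variables (R : realType) (H : hilbert R).
Local Notation C := R[i].
Implicit Type T : H -> H.

Definition op_bnd T (k : R) : Prop := forall x, q (T x) <= k * q x.

Lemma op_bnd_amp T k : op_bnd T k <-> amp_bnd (fun _ _ : 'I_1 => T) k.
Proof.
split=> h x; first by rewrite !big_ord1.
by have := h (fun=> x); rewrite !big_ord1.
Qed.

Lemma opnorm_amp T : opnorm T = amp_opnorm (fun _ _ : 'I_1 => T).
Proof.
have l21 (x : 'I_1 -> H) : l2norm x = complex.Re `|x ord0|.
  by rewrite l2normE big_ord1 Re_normE.
have le1 (x : H) : (`|x| <= 1) = (complex.Re `|x| <= 1).
  by rewrite -{1}(RRe_real (normr_real x)) -lecR.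
congr sup; apply/seteqP; split => _ [x /= x1 <-].
  by exists (fun=> x); rewrite /= l21 ?big_ord1 // -le1.
by exists (x ord0); rewrite /= ?l21 ?big_ord1 // le1 -l21.
Qed.

Lemma bounded_op_bnd T : bounded_op T -> exists2 k, 0 <= k & op_bnd T k.
Proof.
move=> [linT contT].
pose f : {linear H -> H} := HB.pack T (GRing.isLinear.Build C H H _ T linT).
have := @continuous_linear_bounded _ _ _ 0 f (contT 0).
move=> /linear_boundedP /pinfty_ex_gt0 [r r0 hr].
exists (complex.Re r ^+ 2); first exact: sqr_ge0.
move=> x; rewrite -!Re_normX -exprMn ler_sqr ?nnegrE ?mulr_ge0 ?Re_norm_ge0 //.
  rewrite -lecR rmorphM /= !RRe_real ?normr_real ?gtr0_real //; exact: hr.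
by move: r0; rewrite ltcE => /andP [_ /ltW].
Qed.

Lemma bnd_bounded_op T k : linear T -> op_bnd T k -> bounded_op T.
Proof.
move=> linT hT; split=> //.
pose f : {linear H -> H} := HB.pack T (GRing.isLinear.Build C H H _ T linT).
apply: (@bounded_linear_continuous _ _ _ f); apply/linear_boundedP.
near=> r => x.
have r0 : 0 <= r by near: r; apply: nbhs_pinfty_ge; rewrite realE lexx.
have rr : (Num.sqrt `|k|)%:C <= r.
  by near: r; apply: nbhs_pinfty_ge; rewrite ger0_real // ler0c sqrtr_ge0.
apply: (@le_trans _ _ ((Num.sqrt `|k|)%:C * `|x|)); last by rewrite ler_wpM2r.
rewrite -(RRe_real (normr_real (T x))) -(RRe_real (normr_real x)) -rmorphM lecR.
rewrite !Re_normE -sqrtrM // ler_sqrt; last by rewrite mulr_ge0.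
by apply: le_trans (hT x) _; rewrite ler_wpM2r // ler_norm.
Unshelve. all: by end_near. Qed.

Lemma opnorm_leP T k : bounded_op T -> 0 <= k ->
  opnorm T <= Num.sqrt k <-> op_bnd T k.
Proof.
move=> bT k0; have [k1 k10 hk1] := bounded_op_bnd bT.
rewrite opnorm_amp; split => [h|h].
  apply/op_bnd_amp; apply: (amp_bnd_opnorm _ k10 _ k0) h.
    by move=> i j; case: bT.
  exact/op_bnd_amp.
by apply: amp_opnorm_le => //; apply/op_bnd_amp.
Qed.

Lemma amp_bnd_ex m (T : 'I_m -> 'I_m -> H -> H) :
  (forall i j, exists2 k, 0 <= k & op_bnd (T i j) k) ->
  exists2 k, 0 <= k & amp_bnd T k.
Proof.
move=> hT.
have [k k0 hk] : exists2 k, 0 <= k & forall i j, op_bnd (T i j) k.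
  have /choice [f hf] : forall ij : 'I_m * 'I_m, exists k, 0 <= k /\ op_bnd (T ij.1 ij.2) k.
    by move=> [i j]; have [k k0 hk] := hT i j; exists k.
  exists (\sum_ij f ij); first by rewrite sumr_ge0 // => ij _; case: (hf ij).
  move=> i j x; apply: le_trans ((hf (i, j)).2 x) _; rewrite ler_wpM2r //.
  rewrite (bigD1 (i, j)) //= lerDl sumr_ge0 // => ij _; by case: (hf ij).
exists (m%:R * m%:R * k); first by rewrite !mulr_ge0.
move=> x.
have -> : m%:R * m%:R * k * \sum_i q (x i) =
    \sum_(i < m) (m%:R * (k * \sum_j q (x j))).
  by rewrite sumr_const card_ord -[RHS]mulr_natl !mulrA.
apply: ler_sum => i _; apply: le_trans (q_sum_le _ _) _.
by rewrite card_ord ler_wpM2l // mulr_sumr; apply: ler_sum => j _; exact: hk.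
Qed.

End Opnorm.

(** * Clifford systems *)

Section CliffordSystems.
Variable R : realType.
Local Notation C := R[i].

(** The symmetries live on the range of a projection [Q]: the image of an isometry may be
    degenerate, and restriction to an eigenspace then only replaces [Q]. There are 2n + 1 of them,
    with indices 0 to 2n; the values of [S] beyond are arbitrary. *)
Record clifford (H : hilbert R) (n : nat) (Q : H -> H) (S : nat -> H -> H) :
    Prop := Clifford {
  cl_linQ : linear Q;
  cl_adjQ : is_adjoint Q Q;
  cl_idQ : forall x, Q (Q x) = Q x;
  cl_lin : forall j, (j <= n.*2)%N -> linear (S j);
  cl_adj : forall j, (j <= n.*2)%N -> is_adjoint (S j) (S j);
  cl_sqr : forall j, (j <= n.*2)%N -> forall x, S j (S j x) = Q x;
  cl_QS : forall j, (j <= n.*2)%N -> forall x, Q (S j x) = S j x;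
  cl_anti : forall j k, (j <= n.*2)%N -> (k <= n.*2)%N -> j != k ->
    forall x, S j (S k x) = - S k (S j x) }.

(** Removes two generators: the resulting family anticommutes within itself and commutes with S_0
    and S_1. *)
Definition cl_step (H : hilbert R) (S : nat -> H -> H) (j : nat) (x : H) : H :=
  'i *: S 0%N (S 1%N (S j.+2 x)).

(* i^n S_0 S_1 ... S_(2n), up to the order of the factors *)
Fixpoint zop (H : hilbert R) n (S : nat -> H -> H) : H -> H :=
  if n is n'.+1 then zop n' (cl_step S) else S 0%N.

Lemma zop_intertwine (H H' : hilbert R) n S S' (T : H -> H') :
  linear T ->
  (forall j, (j <= n.*2)%N -> forall x, T (S j x) = S' j (T x)) ->
  forall x, T (zop n S x) = zop n S' (T x).
Proof.
move=> linT; elim: n S S' => [|n IH] S S' h x /=; first exact: h.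
by apply: IH => j jn y; rewrite /cl_step (linear_funZ linT) !h.
Qed.

Lemma zop_ext (H : hilbert R) n (S S' : nat -> H -> H) :
  (forall j, (j <= n.*2)%N -> forall x, S j x = S' j x) ->
  forall x, zop n S x = zop n S' x.
Proof.
elim: n S S' => [|n IH] S S' h x /=; first exact: h.
by apply: IH => j jn y; rewrite /cl_step !h.
Qed.

Lemma zop_compose (H : hilbert R) n (S : nat -> H -> H) (P : H -> H) :
  linear P -> (forall x, P (P x) = P x) ->
  (forall j, (j <= n.*2)%N -> forall x, P (S j x) = S j (P x)) ->
  forall x, zop n (fun j y => S j (P y)) x = zop n S (P x).
Proof.
move=> linP idP; elim: n S => [|n IH] S h x //=.
rewrite -IH => [|j jn y].
  by apply: zop_ext => j jn y; rewrite /cl_step !h // !idP.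
by rewrite /cl_step (linear_funZ linP) !h.
Qed.

(** The product has 2n + 1 factors, an odd number of signs. *)
Lemma zop_opp (H : hilbert R) n Q (S : nat -> H -> H) : clifford n Q S ->
  forall x, zop n (fun j y => - S j y) x = - zop n S x.
Proof.
move=> cS x.
suff : forall n S, (forall j, (j <= n.*2)%N -> linear (S j)) ->
    forall x : H, zop n (fun j y => - S j y) x = - zop n S x.
  by apply; exact: cl_lin cS.
move=> {}n {cS x}{}S; elim: n S => [|n IH] S linS x //=.
rewrite -IH => [|j jn]; last first.
  move=> a y y'; rewrite /cl_step !linS // scalerDr !scalerA mulrC.
  by rewrite -!scalerA.
apply: zop_ext => j jn y; rewrite /cl_step.
by rewrite (linear_funN (linS 1%N _)) // opprK scalerN.
Qed.

Lemma zop_opp_last (H : hilbert R) n Q (S : nat -> H -> H) : clifford n Q S ->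
  forall x, zop n (fun j y => if j == n.*2 then - S j y else S j y) x
    = - zop n S x.
Proof.
move=> cS x.
suff : forall n S, (forall j, (j <= n.*2)%N -> linear (S j)) ->
    forall x : H, zop n (fun j y => if j == n.*2 then - S j y else S j y) x
    = - zop n S x.
  by apply; exact: cl_lin cS.
move=> {}n {cS x}{}S; elim: n S => [|n IH] S linS x //=.
rewrite -IH => [|j jn]; last first.
  move=> a y y'; rewrite /cl_step !linS // scalerDr !scalerA mulrC.
  by rewrite -!scalerA.
apply: zop_ext => j jn y; rewrite /cl_step /= !eqSS.
case: ifP => // _.
by rewrite (linear_funN (linS 1%N _)) // (linear_funN (linS 0%N _)) // scalerN.
Qed.

Section OneSystem.
Variables (H : hilbert R) (n : nat) (Q : H -> H) (S : nat -> H -> H).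
Hypothesis cS : clifford n Q S.

Lemma cl_SQ j : (j <= n.*2)%N -> forall x, S j (Q x) = S j x.
Proof. by move=> jn x; rewrite -(cl_sqr cS jn x) (cl_sqr cS jn) (cl_QS cS jn). Qed.

Lemma clifford_corner (P : H -> H) :
  linear P -> is_adjoint P P -> (forall x, P (P x) = P x) ->
  (forall x, Q (P x) = P x) ->
  (forall j, (j <= n.*2)%N -> forall x, P (S j x) = S j (P x)) ->
  clifford n P (fun j x => S j (P x)).
Proof.
move=> linP adjP idP QP PS; split=> //.
- by move=> j jn a x y; rewrite linP (cl_lin cS jn).
- by move=> j jn x y; rewrite (cl_adj cS jn) adjP PS.
- by move=> j jn x; rewrite PS // idP (cl_sqr cS jn) QP.
- by move=> j jn x; rewrite PS // idP.
- by move=> j k jn kn jk x; rewrite !PS // !idP (cl_anti cS jn kn jk).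
Qed.

Lemma clifford_opp : clifford n Q (fun j x => - S j x).
Proof.
split; [exact: cl_linQ cS|exact: cl_adjQ cS|exact: cl_idQ cS| | | | | ].
- by move=> j jn a x y; rewrite (cl_lin cS jn) opprD scalerN.
- by move=> j jn x y; rewrite ipNl ipNr (cl_adj cS jn).
- by move=> j jn x; rewrite (linear_funN (cl_lin cS jn)) opprK (cl_sqr cS jn).
- by move=> j jn x; rewrite (linear_funN (cl_linQ cS)) (cl_QS cS jn).
- move=> j k jn kn jk x.
  by rewrite !(linear_funN (cl_lin cS _)) // !opprK (cl_anti cS jn kn jk).
Qed.

End OneSystem.

Section Tau.
Variables (H : hilbert R) (n : nat) (Q : H -> H) (S : nat -> H -> H).
Hypothesis cS : clifford n.+1 Q S.
(** A symmetry: S_0 S_1 is skew-adjoint with square - Q, and the factor i corrects both. *)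
Let tau x := 'i *: S 0%N (S 1%N x).

Lemma tau_lin : linear tau.
Proof.
move=> a x y; rewrite /tau !(cl_lin cS) // scalerDr !scalerA mulrC.
by rewrite -!scalerA.
Qed.

Lemma tau_S j : (j <= n.*2)%N -> forall x, tau (S j.+2 x) = S j.+2 (tau x).
Proof.
move=> jn x; rewrite /tau (linear_funZ (cl_lin cS _)) ?ltnS //.
rewrite (cl_anti cS (_ : (1 <= _)%N) (_ : (j.+2 <= _)%N)) ?ltnS //.
rewrite (linear_funN (cl_lin cS _)) //.
by rewrite (cl_anti cS (_ : (0 <= _)%N) (_ : (j.+2 <= _)%N)) ?ltnS // opprK.
Qed.

Lemma tau_tau x : tau (tau x) = Q x.
Proof.
rewrite /tau !(linear_funZ (cl_lin cS _)) // (cl_anti cS (_ : (1 <= _)%N) (_ : (0 <= _)%N)) //.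
rewrite (linear_funN (cl_lin cS _)) // !(cl_sqr cS) // (cl_idQ cS).
by rewrite scalerA -expr2 sqr_i scaleN1r opprK.
Qed.

Lemma tau_adj : is_adjoint tau tau.
Proof.
move=> x y; rewrite /tau ipZl ipZr !(cl_adj cS) //.
rewrite (cl_anti cS (_ : (1 <= _)%N) (_ : (0 <= _)%N)) // ipNr mulrN -mulNr.
by congr (_ * _); apply/eqP; rewrite eq_complex /= !oppr0 !eqxx.
Qed.

Lemma S0_tau x : S 0%N (tau x) = - tau (S 0%N x).
Proof.
rewrite /tau (linear_funZ (cl_lin cS _)) //.
rewrite [S 1%N (S 0%N _)](cl_anti cS) //.
by rewrite (linear_funN (cl_lin cS _)) // scalerN opprK.
Qed.

Lemma S1_tau x : S 1%N (tau x) = - tau (S 1%N x).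
Proof.
rewrite /tau (linear_funZ (cl_lin cS _)) //.
by rewrite (cl_anti cS (_ : (1 <= _)%N) (_ : (0 <= _)%N)) // scalerN.
Qed.

(** [tau] commutes with every S_(j+2) and squares to [Q], so a product of two new generators is the
    product of the two old ones and inherits their relations. *)
Lemma clifford_step : clifford n Q (cl_step S).
Proof.
have SE j x : cl_step S j x = tau (S j.+2 x) by [].
have SS j k : (j <= n.*2)%N -> (k <= n.*2)%N -> forall x,
    cl_step S j (cl_step S k x) = S j.+2 (S k.+2 x).
  move=> jn kn x; rewrite !SE -tau_S // tau_tau.
  by rewrite (cl_QS cS) ?ltnS.
split; [exact: cl_linQ cS|exact: cl_adjQ cS|exact: cl_idQ cS| | | | | ].
- by move=> j jn a x y; rewrite !SE (cl_lin cS) ?ltnS // tau_lin.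
- by move=> j jn x y; rewrite !SE tau_adj (cl_adj cS) ?ltnS // tau_S.
- by move=> j jn x; rewrite SS // (cl_sqr cS) ?ltnS.
- move=> j jn x; rewrite !SE /tau (linear_funZ (cl_linQ cS)).
  by rewrite (cl_QS cS).
- by move=> j k jn kn jk x; rewrite !SS // (cl_anti cS) ?ltnS.
Qed.

Lemma S0_step j : (j <= n.*2)%N ->
  forall x, S 0%N (cl_step S j x) = cl_step S j (S 0%N x).
Proof.
move=> jn x; rewrite -[cl_step S j x]/(tau _) -[cl_step S j _]/(tau _) S0_tau.
by rewrite (cl_anti cS) ?ltnS // (linear_funN tau_lin) opprK.
Qed.

Lemma S1_step j : (j <= n.*2)%N ->
  forall x, S 1%N (cl_step S j x) = cl_step S j (S 1%N x).
Proof.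
move=> jn x; rewrite -[cl_step S j x]/(tau _) -[cl_step S j _]/(tau _) S1_tau.
by rewrite (cl_anti cS) ?ltnS // (linear_funN tau_lin) opprK.
Qed.

Lemma S_step j : (j <= n.*2)%N -> forall x, S j.+2 x = tau (cl_step S j x).
Proof.
by move=> jn x; rewrite -[cl_step S j x]/(tau _) tau_tau (cl_QS cS) ?ltnS.
Qed.

End Tau.

Section Central.
Variables (H : hilbert R).

Lemma zop_lin n Q (S : nat -> H -> H) : clifford n Q S -> linear (zop n S).
Proof.
elim: n S => [|n IH] S cS /=; first exact: (cl_lin cS).
exact/IH/clifford_step.
Qed.

Lemma zop_adj n Q (S : nat -> H -> H) :
  clifford n Q S -> is_adjoint (zop n S) (zop n S).
Proof.
elim: n S => [|n IH] S cS /=; first exact: (cl_adj cS).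
exact/IH/clifford_step.
Qed.

Lemma zop_sqr n Q (S : nat -> H -> H) : clifford n Q S ->
  forall x, zop n S (zop n S x) = Q x.
Proof.
elim: n S => [|n IH] S cS /=; first exact: (cl_sqr cS).
exact/IH/clifford_step.
Qed.

Lemma Q_zop n Q (S : nat -> H -> H) : clifford n Q S ->
  forall x, Q (zop n S x) = zop n S x.
Proof.
elim: n S => [|n IH] S cS /=; first exact: (cl_QS cS).
exact/IH/clifford_step.
Qed.

Lemma zop_Q n Q (S : nat -> H -> H) : clifford n Q S ->
  forall x, zop n S (Q x) = zop n S x.
Proof.
by move=> cS x; rewrite -(zop_sqr cS) (zop_sqr cS) (Q_zop cS).
Qed.

(** S_0 and S_1 commute with each generator of the reduced system, hence with its product z. Each
    S_(j+2) is i S_0 S_1 times a reduced generator, to which the induction hypothesis applies. *)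
Lemma zop_S n Q (S : nat -> H -> H) : clifford n Q S ->
  forall j, (j <= n.*2)%N -> forall x, zop n S (S j x) = S j (zop n S x).
Proof.
elim: n S => [|n IH] S cS j jn x /=.
  by move: jn; rewrite leqn0 => /eqP ->.
have cS' := clifford_step cS.
have zS0 y : S 0%N (zop n (cl_step S) y) = zop n (cl_step S) (S 0%N y).
  exact: (@zop_intertwine H H n _ _ (S 0%N) (cl_lin cS _) (S0_step cS)).
have zS1 y : S 1%N (zop n (cl_step S) y) = zop n (cl_step S) (S 1%N y).
  exact: (@zop_intertwine H H n _ _ (S 1%N) (cl_lin cS _) (S1_step cS)).
case: j jn => [|[|j]] jn //.
have jn' : (j <= n.*2)%N by [].
rewrite !(S_step cS jn') -(IH _ cS' _ jn').
by rewrite (linear_funZ (zop_lin cS')) -zS0 -zS1.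
Qed.

(* zpart b Q z, for b = false, true, are the projections onto the eigenspaces
   of z for the eigenvalues 1 and -1. *)
Definition zpart (b : bool) (Q z : H -> H) (x : H) : H :=
  2^-1 *: (Q x + (-1) ^+ b *: z x).

Variables (n : nat) (Q : H -> H) (S : nat -> H -> H).
Hypothesis cS : clifford n Q S.
Local Notation z := (zop n S).
Local Notation P b := (zpart b Q z).

Let comb_lin (f g : H -> H) (a b : C) : linear f -> linear g ->
  linear (fun x => a *: (f x + b *: g x)).
Proof.
move=> lf lg c x y; rewrite lf lg !scalerDr !scalerA -!addrA; congr (_ + _).
  by rewrite mulrC.
by rewrite addrCA; congr (_ + (_ + _)); congr (_ *: _); ring.
Qed.

Lemma half_twice (x : H) : 2^-1 *: (x + x) = x.
Proof. by rewrite -{1 2}[x]scale1r -scalerDl scalerA mulVf ?scale1r ?pnatr_eq0. Qed.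

Lemma zpart_lin b : linear (P b).
Proof. exact: comb_lin (cl_linQ cS) (zop_lin cS). Qed.

Lemma signC b : Num.conj ((-1) ^+ b : C) = (-1) ^+ b.
Proof. by rewrite rmorphXn rmorphN rmorph1. Qed.

Lemma zpart_adj b : is_adjoint (P b) (P b).
Proof.
move=> x y; rewrite /zpart ipZl ipZr ipDl ipDr ipZl ipZr signC (cl_adjQ cS).
rewrite (zop_adj cS); congr (_ * _).
by rewrite fmorphV /= rmorph_nat.
Qed.

Lemma z_zpart b x : z (P b x) = (-1) ^+ b *: P b x.
Proof.
rewrite /zpart (linear_funZ (zop_lin cS)) (linear_funD (zop_lin cS)).
rewrite (linear_funZ (zop_lin cS)) (zop_sqr cS) (zop_Q cS) scalerA mulrC -scalerA.
by congr (_ *: _); rewrite scalerDr scalerA -signr_addb addbb scale1r addrC.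
Qed.

Lemma Q_zpart b x : Q (P b x) = P b x.
Proof.
rewrite /zpart (linear_funZ (cl_linQ cS)) (linear_funD (cl_linQ cS)).
by rewrite (linear_funZ (cl_linQ cS)) (Q_zop cS) (cl_idQ cS).
Qed.

Lemma zpart_id b x : P b (P b x) = P b x.
Proof.
rewrite {1}/zpart Q_zpart z_zpart scalerA -signr_addb addbb scale1r.
exact: half_twice.
Qed.

Lemma zpart_mul b x : P (~~ b) (P b x) = 0.
Proof.
rewrite {1}/zpart Q_zpart z_zpart scalerA -signr_addb.
by rewrite addNb addbb expr1 scaleN1r subrr scaler0.
Qed.

Lemma zpart_sum x : P false x + P true x = Q x.
Proof.
rewrite /zpart -scalerDr expr0 expr1 scale1r scaleN1r addrACA subrr addr0.
exact: half_twice.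
Qed.

Lemma zpart_S b j : (j <= n.*2)%N -> forall x, P b (S j x) = S j (P b x).
Proof.
move=> jn x; rewrite /zpart (linear_funZ (cl_lin cS jn)).
rewrite (linear_funD (cl_lin cS jn)) (linear_funZ (cl_lin cS jn)).
by rewrite (zop_S cS) // (cl_QS cS) // (cl_SQ cS).
Qed.

Lemma clifford_zpart b : clifford n (P b) (fun j x => S j (P b x)).
Proof.
apply: (clifford_corner cS (@zpart_lin b) (@zpart_adj b) (zpart_id b)).
  exact: Q_zpart.
exact: zpart_S.
Qed.

Lemma zop_zpart b x : zop n (fun j x => S j (P b x)) x = (-1) ^+ b *: P b x.
Proof.
rewrite zop_compose ?z_zpart //; first exact: zpart_lin.
  exact: zpart_id.
exact: zpart_S.
Qed.

End Central.
End CliffordSystems.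

(** * Matrix units of a Clifford system *)

Section MatrixUnits.
Variable R : realType.
Local Notation C := R[i].

Record matrix_units (H : hilbert R) (Q : H -> H) (I : finType)
    (E : I -> I -> H -> H) : Prop := MatrixUnits {
  mu_lin : forall k l, linear (E k l);
  mu_adj : forall k l, is_adjoint (E k l) (E l k);
  mu_mul : forall k l k' l' x,
    E k l (E k' l' x) = if l == k' then E k l' x else 0;
  mu_one : forall x, \sum_k E k k x = Q x }.

(* The units of the copy of M_2 generated by S_0 and S_1, in which
   S_0 = sigma1 and S_1 = sigma2. *)
Section FirstPair.
Variables (H : hilbert R) (n : nat) (Q : H -> H) (S : nat -> H -> H).
Hypothesis cS : clifford n.+1 Q S.

Definition pair_unit (a b : bool) (x : H) : H :=
  zpart a Q (S 0%N) (if a == b then x else S 1%N x).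

Let p a := zpart a Q (S 0%N).

Let S0S1 x : S 0%N (S 1%N x) = - S 1%N (S 0%N x).
Proof. exact: (cl_anti cS). Qed.

Let plin a : linear (p a).
Proof.
move=> c x y; rewrite /p /zpart (cl_linQ cS) (cl_lin cS) // !scalerDr !scalerA.
rewrite -!addrA; congr (_ + _); first by rewrite mulrC.
by rewrite addrCA; congr (_ + (_ + _)); congr (_ *: _); ring.
Qed.

Let Qp a x : Q (p a x) = p a x.
Proof.
rewrite /p /zpart (linear_funZ (cl_linQ cS)) (linear_funD (cl_linQ cS)).
by rewrite (linear_funZ (cl_linQ cS)) (cl_QS cS) // (cl_idQ cS).
Qed.

Let S0p a x : S 0%N (p a x) = (-1) ^+ a *: p a x.
Proof.
rewrite /p /zpart (linear_funZ (cl_lin cS _)) // (linear_funD (cl_lin cS _)) //.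
rewrite (linear_funZ (cl_lin cS _)) // (cl_sqr cS) // (cl_SQ cS) // scalerA mulrC -scalerA.
by congr (_ *: _); rewrite scalerDr scalerA -signr_addb addbb scale1r addrC.
Qed.

Let pp a b x : p a (p b x) = if a == b then p b x else 0.
Proof.
rewrite {1}/p /zpart Qp S0p scalerA -signr_addb.
case: eqP => [->|/eqP ab]; first by rewrite addbb scale1r half_twice.
have -> : a (+) b = true by move: ab; case: a; case: b.
by rewrite expr1 scaleN1r subrr scaler0.
Qed.

Let S1p a x : S 1%N (p a x) = p (~~ a) (S 1%N x).
Proof.
rewrite /p /zpart (linear_funZ (cl_lin cS _)) // (linear_funD (cl_lin cS _)) //.
rewrite (linear_funZ (cl_lin cS _)) // (cl_SQ cS) // (cl_QS cS) // S0S1.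
by congr (_ *: (_ + _)); rewrite scalerN -scaleNr; congr (_ *: _); case: a; rewrite ?expr1 ?expr0 ?opprK.
Qed.

Let p_adj a : is_adjoint (p a) (p a).
Proof.
move=> x y; rewrite /p /zpart ipZl ipZr ipDl ipDr ipZl ipZr signC (cl_adjQ cS).
rewrite (cl_adj cS) //; congr (_ * _).
by rewrite fmorphV /= rmorph_nat.
Qed.

Let S1S1 x : p^~ (S 1%N (S 1%N x)) =1 p^~ x.
Proof.
move=> a; rewrite (cl_sqr cS) // /p /zpart.
by rewrite (cl_idQ cS) (cl_SQ cS).
Qed.

Lemma pair_unit_lin a b : linear (pair_unit a b).
Proof.
move=> c x y; rewrite /pair_unit; case: ifP => _; first exact: plin.
by rewrite (cl_lin cS) //; exact: plin.
Qed.

Lemma pair_unit_adj a b : is_adjoint (pair_unit a b) (pair_unit b a).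
Proof.
move=> x y; rewrite /pair_unit eq_sym; case: eqP => [->|/eqP ab].
  exact: p_adj.
rewrite p_adj (cl_adj cS) // S1p.
by have -> : ~~ a = b by move: ab; case: a; case: b.
Qed.

Lemma pair_unit_mul a b a' b' x :
  pair_unit a b (pair_unit a' b' x) = if b == a' then pair_unit a b' x else 0.
Proof.
rewrite /pair_unit -/(p a) -/(p a').
case: a; case: b; case: a'; case: b' => /=; rewrite ?S1p ?pp ?S1S1 //=.
Qed.

Lemma pair_unit_one x : pair_unit false false x + pair_unit true true x = Q x.
Proof.
rewrite /pair_unit /= /zpart -scalerDr expr0 expr1 scale1r scaleN1r addrACA subrr addr0.
exact: half_twice.
Qed.

Lemma pair_unit_S0 x :
  S 0%N x = pair_unit false false x - pair_unit true true x.
Proof.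
rewrite /pair_unit /= /zpart -scalerBr expr0 expr1 scale1r scaleN1r opprB.
by rewrite addrC addrA subrK half_twice.
Qed.

Lemma pair_unit_S1 x :
  S 1%N x = pair_unit false true x + pair_unit true false x.
Proof.
rewrite -(cl_QS cS) // -pair_unit_one; rewrite /pair_unit /=.
by [].
Qed.

End FirstPair.

(** [I] and [c] are chosen before [H], [Q] and [S]; this uniformity makes the matrix norms depend on
    [n] and [b] alone. The units for n + 1 are products of the 2 x 2 units of S_0 and S_1 with the
    units of the reduced system. The last clause, on operators commuting with the generators, is
    carried through the induction because these two families of units must commute. *)
Lemma clifford_matrix_units n (b : bool) :
  exists (I : finType) (c : nat -> I -> I -> C),
  forall (H : hilbert R) (Q : H -> H) (S : nat -> H -> H),
  clifford n Q S -> (forall x, zop n S x = (-1) ^+ b *: Q x) ->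
  exists E : I -> I -> H -> H,
  [/\ matrix_units Q E,
      forall j, (j <= n.*2)%N -> forall x,
        S j x = \sum_k \sum_l c j k l *: E k l x &
      forall T : H -> H, linear T ->
        (forall j, (j <= n.*2)%N -> forall x, T (S j x) = S j (T x)) ->
        forall k l x, T (E k l x) = E k l (T x)].
Proof.
elim: n => [|n [I [c IH]]].
  (* For n = 0 the only generator is z itself, which is the scalar (-1)^b on the range of [Q]. *)
  exists unit, (fun _ _ _ => (-1) ^+ b) => H Q S cS zS.
  exists (fun _ _ => Q); split.
  - split=> [_ _|_ _|[] [] [] [] x|x].
    + exact: (cl_linQ cS).
    + exact: (cl_adjQ cS).
    + by rewrite eqxx (cl_idQ cS).
    + by rewrite (bigD1 tt) //= big1 ?addr0 // => -[].
  - move=> j; rewrite leqn0 => /eqP -> x; rewrite -[S 0%N x]/(zop 0 S x) zS.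
    rewrite (bigD1 tt) //= [X in _ = _ + X]big1 ?addr0 => [|[] //].
    by rewrite (bigD1 tt) //= big1 ?addr0 // => -[].
  - move=> T linT TS _ _ x.
    by rewrite -(cl_sqr cS (leqnn 0)) !TS // (cl_sqr cS).
(* The coefficients of S_0 = sigma1 (x) 1, S_1 = sigma2 (x) 1 and S_(j+2) = sigma3 (x) T_j, where
   T_j is the j-th generator of the reduced system and i S_0 S_1 = sigma3 (x) 1. *)
pose c0 (p q : bool * I) : C := (p == q)%:R * (-1) ^+ p.1.
pose c1 (p q : bool * I) : C := ((p.1 != q.1) && (p.2 == q.2))%:R.
pose cs j (p q : bool * I) : C :=
  (p.1 != q.1)%:R * ('i * (-1) ^+ p.1) * c j p.2 q.2.
exists (bool * I)%type, (fun j => match j with 0%N => c0 | 1%N => c1 | j.+2 => cs j end).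
move=> H Q S cS zS.
have cS' := clifford_step cS.
have [E [muE SE commE]] := IH H Q _ cS' zS.
have ES0 k l x : S 0%N (E k l x) = E k l (S 0%N x).
  exact: (commE _ (cl_lin cS _) (S0_step cS)).
have ES1 k l x : S 1%N (E k l x) = E k l (S 1%N x).
  exact: (commE _ (cl_lin cS _) (S1_step cS)).
have EQ k l x : Q (E k l x) = E k l (Q x).
  by rewrite -!(cl_sqr cS (leq0n _)) !ES0.
pose e := pair_unit Q S.
have eE a a' k l x : e a a' (E k l x) = E k l (e a a' x).
  rewrite /e /pair_unit /zpart.
  rewrite (linear_funZ (mu_lin muE _ _)) (linear_funD (mu_lin muE _ _)).
  rewrite (linear_funZ (mu_lin muE _ _)).
  by case: ifP => _; rewrite ?ES1 -EQ -ES0.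
have elin a a' : linear (e a a') := pair_unit_lin cS a a'.
have emul a a' d d' x :
    e a a' (e d d' x) = if a' == d then e a d' x else 0 := pair_unit_mul cS a a' d d' x.
exists (fun p q x => e p.1 q.1 (E p.2 q.2 x)).
have sumE (F : bool * I -> H) :
    \sum_p F p = \sum_k F (false, k) + \sum_k F (true, k).
  rewrite (eq_bigr (fun p => F (p.1, p.2))) => [|[] //].
  rewrite -(pair_bigA _ (fun a k => F (a, k))) /= big_bool addrC.
  by congr (_ + _).
split.
- split.
  + by move=> [a k] [a' k'] z x y /=; rewrite (mu_lin muE) elin.
  + by move=> [a k] [a' k'] x y /=; rewrite (pair_unit_adj cS) (mu_adj muE) eE.
  + move=> [a k] [a' k'] [d l] [d' l'] x /=; rewrite -eE emul xpair_eqE.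
    case: eqP => //= _.
    by rewrite (mu_mul muE); case: ifP => // _; rewrite (linear_fun0 (elin _ _)).
  + move=> x; rewrite sumE /= -!(linear_fun_sum (elin _ _)) (mu_one muE).
    by rewrite /e pair_unit_one (cl_idQ cS).
- have diagE (a a' : bool) x : \sum_k \sum_l (k == l)%:R *: e a a' (E k l x) = e a a' (Q x).
    rewrite -(mu_one muE) (linear_fun_sum (elin _ _)); apply: eq_bigr => k _.
    rewrite (bigD1 k) //= eqxx scale1r big1 ?addr0 // => l lk.
    by rewrite eq_sym (negPf lk) scale0r.
  case=> [|[|j]] jn x.
  + rewrite -(cl_SQ cS) // (pair_unit_S0 Q) -/e sumE -!diagE -sumrN.
    congr (_ + _); apply: eq_bigr => k _; rewrite sumE /c0 /=.
      rewrite [X in _ = _ + X]big1 ?addr0 => [|l _]; last by rewrite ?xpair_eqE /= mul0r scale0r.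
      by apply: eq_bigr => l _; rewrite ?xpair_eqE /= expr0 mulr1.
    rewrite [X in _ = X + _]big1 ?add0r => [|l _]; last by rewrite ?xpair_eqE /= mul0r scale0r.
    by rewrite -sumrN; apply: eq_bigr => l _; rewrite ?xpair_eqE /= expr1 mulrN1 scaleNr.
  + rewrite -(cl_SQ cS) // (pair_unit_S1 cS) -/e sumE -!diagE.
    congr (_ + _); apply: eq_bigr => k _; rewrite sumE /c1 /=.
      by rewrite [X in _ = X + _]big1 ?add0r => [|l _ //]; rewrite ?scale0r.
    by rewrite [X in _ = _ + X]big1 ?addr0 => [|l _ //]; rewrite ?scale0r.
  + have jn' : (j <= n.*2)%N by [].
    rewrite (S_step cS jn') (SE j jn') (pair_unit_S0 Q) -/e.
    rewrite !(pair_unit_S1 cS) -/e !(linear_funD (elin _ _)) !emul /=.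
    rewrite !add0r addr0 sumE.
    have conv (a : bool) (s : C) : s *: e a (~~ a) (\sum_k \sum_l c j k l *: E k l x) =
      \sum_k \sum_l (s * c j k l) *: e a (~~ a) (E k l x).
      rewrite (linear_fun_sum (elin _ _)) scaler_sumr; apply: eq_bigr => k _.
      rewrite (linear_fun_sum (elin _ _)) scaler_sumr; apply: eq_bigr => l _.
      by rewrite (linear_funZ (elin _ _)) scalerA.
    rewrite scalerBr -scaleNr (conv false) (conv true).
    congr (_ + _); apply: eq_bigr => k _; rewrite sumE /cs /=.
      rewrite [X in _ = X + _]big1 ?add0r => [|l _]; last by rewrite !mul0r scale0r.
      by apply: eq_bigr => l _; rewrite expr0 mulr1 mul1r.
    rewrite [X in _ = _ + X]big1 ?addr0 => [|l _]; last by rewrite !mul0r scale0r.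
    by apply: eq_bigr => l _; rewrite expr1 mulrN1 mul1r.
- move=> T linT TS [a k] [a' l] x /=.
  have TE y : T (E k l y) = E k l (T y).
    apply: commE => // j jn z; rewrite /cl_step (linear_funZ linT).
    by rewrite !TS.
  have TQ y : T (Q y) = Q (T y) by rewrite -!(cl_sqr cS (leq0n _)) !TS.
  rewrite -TE /e /pair_unit /zpart (linear_funZ linT) (linear_funD linT).
  rewrite (linear_funZ linT) TQ TS //.
  by case: ifP => _; rewrite ?TS.
Qed.

End MatrixUnits.

(** * Amplifications with scalar coefficients *)

Section ScalarAmplification.
Variables (R : realType) (H : hilbert R).
Local Notation C := R[i].

Definition nsq (a : C) : R := complex.Re a ^+ 2 + complex.Im a ^+ 2.

Lemma nsq_ge0 a : 0 <= nsq a.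
Proof. by rewrite addr_ge0 // sqr_ge0. Qed.

Lemma nsqE a : a * Num.conj a = (nsq a)%:C.
Proof. by rewrite -normCK /nsq add_Re2_Im2. Qed.

(** Replaces finitely many vectors of [H] by vectors of C^N with the same inner products. The Gram
    matrix is unitarily diagonalizable with eigenvalues d_r >= 0, and the square roots of the d_r
    give the coordinates. *)
Lemma gram_factor (J : finType) (eta : J -> H) :
  exists N (B : J -> 'I_N -> C),
    forall a b, inner H (eta a) (eta b) = \sum_r B a r * Num.conj (B b r).
Proof.
pose N := #|J|; pose v (i : 'I_N) := eta (enum_val i).
pose G : 'M[C]_N := \matrix_(i, j) inner H (v i) (v j).
have Ghermi : G \is hermsymmx.
  apply/is_hermitianmxP; rewrite expr0 scale1r; apply/matrixP => i j.
  by rewrite !mxE ipC.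
have Gnormal := hermitian_normalmx Ghermi.
have /orthomx_spectralP GE := Gnormal.
set P := spectralmx G in GE; set d := spectral_diag G in GE.
have Punit : P \is unitarymx by exact: spectral_unitarymx.
have invP : invmx P = (P^T ^ Num.conj)%sesqui by rewrite invmx_unitary.
rewrite invP in GE.
have dE : diag_mx d = P *m G *m (P^T ^ Num.conj)%sesqui.
  have PP : P *m (P^T ^ Num.conj)%sesqui = 1%:M by apply/unitarymxP.
  by rewrite GE !mulmxA PP mul1mx -mulmxA PP mulmx1.
(* An eigenvalue of the Gram matrix is the squared norm of the combination of the vectors given by
   its eigenvector. *)
have d0 r : 0 <= d 0 r.
  have -> : d 0 r = inner H (\sum_i P r i *: v i) (\sum_i P r i *: v i).
    have /matrixP /(_ r r) := dE; rewrite !mxE eqxx mulr1n => ->.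
    rewrite ip_sumr; apply: eq_bigr => j _.
    rewrite ipZr !mxE mulrC; congr (_ * _).
    by rewrite ip_suml; apply: eq_bigr => i _; rewrite ipZl mxE.
  by rewrite ipxx ler0c.
exists N, (fun a r => sqrtC (d 0 r) * Num.conj (P r (enum_rank a))) => a b.
have -> : inner H (eta a) (eta b) = G (enum_rank a) (enum_rank b).
  by rewrite mxE /v !enum_rankK.
rewrite {1}GE mxE; apply: eq_bigr => r _.
rewrite mul_mx_diag !mxE rmorphM /= conjCK.
rewrite (conj_Creal (ger0_real (_ : 0 <= sqrtC (d 0 r)))) ?sqrtC_ge0 //.
rewrite -{1}[d 0 r]sqrtCK expr2; ring.
Qed.

(** In the coordinates of [gram_factor] both sides are sums over r, and the scalar inequality
    applies to each r. *)
Lemma scalar_amp_bnd (J : finType) (X : J -> J -> C) (k : R) :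
  (forall x : J -> C,
     \sum_a nsq (\sum_b X a b * x b) <= k * \sum_b nsq (x b)) ->
  forall eta : J -> H,
     \sum_a q (\sum_b X a b *: eta b) <= k * \sum_b q (eta b).
Proof.
move=> hX eta; have [N [B BE]] := gram_factor eta.
have qE (y : J -> C) :
    q (\sum_b y b *: eta b) = \sum_r nsq (\sum_b y b * B b r).
  apply: complexI; rewrite -ipxx rmorph_sum /= ip_suml.
  under [RHS]eq_bigr do rewrite -nsqE mulr_suml.
  rewrite exchange_big /=; apply: eq_bigr => b _.
  rewrite ip_sumr.
  transitivity (\sum_b' \sum_r y b * B b r * (Num.conj (y b') * Num.conj (B b' r))).
    apply: eq_bigr => b' _; rewrite ipZl ipZr BE mulrA mulr_sumr.
    by apply: eq_bigr => r _; ring.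
  rewrite exchange_big /=; apply: eq_bigr => r _.
  rewrite rmorph_sum mulr_sumr; apply: eq_bigr => b' _.
  by rewrite rmorphM.
have qeta b : q (eta b) = \sum_r nsq (B b r).
  apply: complexI; rewrite -ipxx BE rmorph_sum /=.
  by apply: eq_bigr => r _; rewrite nsqE.
under eq_bigr do rewrite qE.
under [X in _ <= _ * X]eq_bigr do rewrite qeta.
rewrite exchange_big [X in _ <= _ * X]exchange_big mulr_sumr /=.
by apply: ler_sum => r _; exact: hX.
Qed.

End ScalarAmplification.

Section UnitsAmplification.
Variables (R : realType) (H : hilbert R).
Local Notation C := R[i].
Variables (Q : H -> H) (I : finType) (E : I -> I -> H -> H).
Hypotheses (muE : matrix_units Q E) (linQ : linear Q) (adjQ : is_adjoint Q Q).
Hypothesis idQ : forall x, Q (Q x) = Q x.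
Variables (m : nat) (X : 'I_m -> 'I_m -> I -> I -> C).

(** The units E_ki are isometric on the range of E_ii, with orthogonal images for distinct k. *)
Lemma q_units (i : I) (y : I -> H) : (forall k, E i i (y k) = y k) ->
  q (\sum_k E k i (y k)) = \sum_k q (y k).
Proof.
move=> yE; apply: complexI; rewrite -ipxx rmorph_sum /= ip_suml.
apply: eq_bigr => k _; rewrite ip_sumr (bigD1 k) //= big1 ?addr0 => [|l lk].
  by rewrite (mu_adj muE) (mu_mul muE) eqxx yE ipxx.
by rewrite (mu_adj muE) (mu_mul muE) eq_sym (negPf lk) ip0r.
Qed.

Lemma q_proj_le x : q (Q x) <= q x.
Proof.
have -> : q x = q (Q x) + q (x - Q x).
  rewrite -{1}[x](subrK (Q x)) [X in q X = _]addrC [LHS]qD /rip adjQ (linear_funB linQ) idQ subrr.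
  by rewrite ip0r mulr0 addr0.
by rewrite lerDl.
Qed.

Definition units_op (p r : 'I_m) (x : H) : H :=
  \sum_k \sum_l X p r k l *: E k l x.

(** The right side no longer mentions [H]. Since [Q] is not zero, some E_ii is not zero. A vector v
    in its range yields vectors E_li v on which the operators act as the scalar array; conversely
    the components E_il x of a vector x all lie in the range of E_ii, where [scalar_amp_bnd]
    applies. *)
Lemma amp_bnd_units (k : R) : 0 <= k -> (exists w, Q w != 0) ->
  amp_bnd units_op k <->
  forall x : 'I_m * I -> C,
    \sum_a nsq (\sum_b X a.1 b.1 a.2 b.2 * x b) <= k * \sum_b nsq (x b).
Proof.
move=> k0 [w Qw].
have [i Eiw] : exists i, E i i w != 0.
  apply/existsP; apply: contraNT Qw => /existsPn h.
  rewrite -(mu_one muE) big1 // => i _.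
  by have := h i; rewrite negbK => /eqP.
split=> h.
  move=> x.
  pose v := E i i w.
  have vE : E i i v = v by rewrite /v (mu_mul muE) eqxx.
  have qv : 0 < q v.
    rewrite lt_def q_ge0 andbT; apply/eqP => /q_eq0 v0.
    by move: Eiw; rewrite -/v v0 eqxx.
  have Elin a b := mu_lin muE a b.
  have qsum (y : I -> C) : q (\sum_a y a *: E a i v) = (\sum_a nsq (y a)) * q v.
    transitivity (q (\sum_a E a i (y a *: v))).
      by congr q; apply: eq_bigr => a _; rewrite (linear_funZ (Elin _ _)).
    rewrite q_units => [|a]; last by rewrite (linear_funZ (Elin _ _)) vE.
    by rewrite mulr_suml; apply: eq_bigr => a _; rewrite qZ.
  have := h (fun r => \sum_l x (r, l) *: E l i v).
  under [X in _ <= _ * X]eq_bigr do rewrite qsum.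
  rewrite -mulr_suml pair_bigA /=.
  rewrite (eq_bigr (fun b => nsq (x b))) => [|[] //].
  have opE (p : 'I_m) :
    \sum_r units_op p r (\sum_l x (r, l) *: E l i v) =
    \sum_a (\sum_b X p b.1 a b.2 * x b) *: E a i v.
    transitivity (\sum_r \sum_a \sum_l (X p r a l * x (r, l)) *: E a i v).
      apply: eq_bigr => r _; apply: eq_bigr => a _; apply: eq_bigr => l _.
      rewrite (linear_fun_sum (Elin _ _)) (bigD1 l) //= big1 ?addr0 => [|l' l'l].
        by rewrite (linear_funZ (Elin _ _)) (mu_mul muE) eqxx scalerA.
      by rewrite (linear_funZ (Elin _ _)) (mu_mul muE) eq_sym (negPf l'l) scaler0.
    rewrite exchange_big /=; apply: eq_bigr => a _.
    rewrite pair_bigA /= scaler_suml.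
    by apply: eq_bigr => -[].
  under eq_bigr do rewrite opE qsum.
  rewrite -mulr_suml pair_bigA /= mulrA ler_pM2r //.
move=> xi.
pose eta (b : 'I_m * I) := E i b.2 (xi b.1).
have Elin a b := mu_lin muE a b.
have etaE b : E i i (eta b) = eta b by rewrite /eta (mu_mul muE) eqxx.
have QE (x : H) : Q x = \sum_l E l i (E i l x).
  by rewrite -(mu_one muE); apply: eq_bigr => l _; rewrite (mu_mul muE) eqxx.
have lhs (p : 'I_m) : q (\sum_r units_op p r (xi r)) =
    \sum_a q (\sum_b X p b.1 a b.2 *: eta b).
  rewrite -(q_units (i := i)) => [|a]; last first.
    rewrite (linear_fun_sum (Elin _ _)); apply: eq_bigr => b _.
    by rewrite (linear_funZ (Elin _ _)) etaE.
  congr q; rewrite exchange_big /=; apply: eq_bigr => a _.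
  rewrite pair_bigA /= (linear_fun_sum (Elin _ _)); apply: eq_bigr => b _.
  by rewrite (linear_funZ (Elin _ _)) /eta (mu_mul muE) eqxx.
under eq_bigr do rewrite lhs.
rewrite pair_bigA /=.
apply: le_trans (scalar_amp_bnd h eta) _.
rewrite ler_wpM2l //.
rewrite (eq_bigr (fun b => q (eta (b.1, b.2)))) => [|[] //].
rewrite -(pair_bigA _ (fun a b => q (eta (a, b)))) /=.
apply: ler_sum => r _.
apply: le_trans (q_proj_le (xi r)).
by rewrite QE q_units => [//|l]; rewrite (mu_mul muE) eqxx.
Qed.

End UnitsAmplification.

Section CliffordNorm.
Variable R : realType.
Local Notation C := R[i].

(** The index of the coordinates is shifted by one: [al 0] belongs to the identity and [al j.+1] to
    S_j. *)
Definition clop (H : hilbert R) n (Q : H -> H) (S : nat -> H -> H)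
    (al : nat -> C) (x : H) : H :=
  al 0%N *: Q x + \sum_(j < n.*2.+1) al j.+1 *: S j x.

(** Both sides reduce to one scalar inequality, because the array [X] is built from coefficients
    that serve every system with the given value of z. *)
Lemma clifford_amp_bnd (H H' : hilbert R) n (b : bool)
    (Q : H -> H) S (Q' : H' -> H') S' m (al : 'I_m -> 'I_m -> nat -> C) k :
  clifford n Q S -> clifford n Q' S' ->
  (forall x, zop n S x = (-1) ^+ b *: Q x) ->
  (forall x, zop n S' x = (-1) ^+ b *: Q' x) ->
  (exists w, Q w != 0) -> (exists w, Q' w != 0) -> 0 <= k ->
  amp_bnd (fun p r => clop n Q S (al p r)) k <->
  amp_bnd (fun p r => clop n Q' S' (al p r)) k.
Proof.
have [I [c hc]] := clifford_matrix_units R n b.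
pose X (p r : 'I_m) a l := al p r 0%N * (a == l)%:R +
  \sum_(j < n.*2.+1) al p r j.+1 * c j a l.
suff core (K : hilbert R) (P : K -> K) (s : nat -> K -> K) :
    clifford n P s -> (forall x, zop n s x = (-1) ^+ b *: P x) ->
    (exists w, P w != 0) -> 0 <= k ->
    amp_bnd (fun p r => clop n P s (al p r)) k <->
    forall x : 'I_m * I -> C,
    \sum_a nsq (\sum_b X a.1 b.1 a.2 b.2 * x b) <= k * \sum_b nsq (x b).
  move=> cS cS' zS zS' wQ wQ' k0.
  by rewrite (core _ _ _ cS zS wQ k0) (core _ _ _ cS' zS' wQ' k0).
move=> cs zs wP k0; have [E [muE sE _]] := hc _ _ _ cs zs.
rewrite -(amp_bnd_units muE (cl_linQ cs) (cl_adjQ cs) (cl_idQ cs) X k0 wP).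
have opE p r x : clop n P s (al p r) x = units_op E X p r x.
  rewrite /clop /units_op.
  transitivity (\sum_a \sum_l (al p r 0%N * (a == l)%:R) *: E a l x +
     \sum_(j < n.*2.+1) \sum_a \sum_l (al p r j.+1 * c j a l) *: E a l x).
    congr (_ + _).
      rewrite -(mu_one muE) scaler_sumr; apply: eq_bigr => a _.
      rewrite (bigD1 a) //= eqxx mulr1 big1 ?addr0 // => l la.
      by rewrite eq_sym (negPf la) mulr0 scale0r.
    apply: eq_bigr => j _; rewrite sE -1?ltnS // scaler_sumr.
    apply: eq_bigr => a _; rewrite scaler_sumr; apply: eq_bigr => l _.
    by rewrite scalerA.
  rewrite [X in _ + X = _]exchange_big -big_split /=; apply: eq_bigr => a _.
  rewrite [X in _ + X = _]exchange_big -big_split /=; apply: eq_bigr => l _.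
  by rewrite /X scalerDl scaler_suml.
split=> h xi; have := h xi.
  by under eq_bigr do under eq_bigr do rewrite opE.
by under [X in X <= _ -> _]eq_bigr do under eq_bigr do rewrite -opE.
Qed.

(** The operators are block diagonal for the orthogonal splitting of the range of [Q] into the two
    eigenspaces of z. *)
Lemma clifford_amp_bnd_parts (H : hilbert R) n (Q : H -> H) S m
    (al : 'I_m -> 'I_m -> nat -> C) k :
  clifford n Q S -> 0 <= k ->
  amp_bnd (fun p r => clop n Q S (al p r)) k <->
  forall b, let P := zpart b Q (zop n S) in
    amp_bnd (fun p r => clop n P (fun j x => S j (P x)) (al p r)) k.
Proof.
move=> cS k0.
have PT b a x : clop n (zpart b Q (zop n S)) (fun j x => S j (zpart b Q (zop n S) x)) a x =
    clop n Q S a (zpart b Q (zop n S) x).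
  by rewrite /clop (Q_zpart cS).
have TP b a x : zpart b Q (zop n S) (clop n Q S a x) =
    clop n Q S a (zpart b Q (zop n S) x).
  rewrite /clop; have linP := zpart_lin cS b.
  rewrite (linear_funD linP) (linear_fun_sum linP) (linear_funZ linP).
  congr (_ + _); last first.
    apply: eq_bigr => j _; have jn : (j <= n.*2)%N by rewrite -ltnS.
    by rewrite (linear_funZ linP) (zpart_S cS).
  by rewrite (Q_zpart cS) /zpart (zop_Q cS) (cl_idQ cS).
have qsplit x : q (Q x) = q (zpart false Q (zop n S) x) + q (zpart true Q (zop n S) x).
  rewrite -(zpart_sum n Q S) qD /rip (zpart_adj cS) (zpart_mul cS true).
  by rewrite ip0r mulr0 addr0.
have Qop a x : Q (clop n Q S a x) = clop n Q S a x.
  rewrite /clop (linear_funD (cl_linQ cS)) (linear_funZ (cl_linQ cS)) (cl_idQ cS).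
  congr (_ + _); rewrite (linear_fun_sum (cl_linQ cS)); apply: eq_bigr => j _.
  by rewrite (linear_funZ (cl_linQ cS)) (cl_QS cS) // -ltnS.
have qQ x : q (Q x) <= q x.
  exact: (q_proj_le (cl_linQ cS) (cl_adjQ cS) (cl_idQ cS)).
split=> h.
  move=> b P xi; have := h (fun r => P (xi r)).
  under eq_bigr do under eq_bigr do rewrite -PT.
  move=> /le_trans; apply; rewrite ler_wpM2l //; apply: ler_sum => r _.
  apply: (@q_proj_le _ _ P) => //; [exact: zpart_lin cS _|exact: zpart_adj cS _|exact: zpart_id cS _].
move=> xi.
have sumQ p : Q (\sum_r clop n Q S (al p r) (xi r)) = \sum_r clop n Q S (al p r) (xi r).
  by rewrite (linear_fun_sum (cl_linQ cS)); apply: eq_bigr => r _.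
under eq_bigr do rewrite -sumQ qsplit.
rewrite big_split /=.
apply: (@le_trans _ _ (k * \sum_r q (Q (xi r)))); last first.
  by rewrite ler_wpM2l //; apply: ler_sum.
under [X in _ <= _ * X]eq_bigr do rewrite qsplit.
rewrite big_split mulrDr /=; apply: lerD.
  have := h false (fun r => zpart false Q (zop n S) (xi r)).
  move=> /=; under eq_bigr do under eq_bigr do rewrite PT (zpart_id cS) -TP.
  by under eq_bigr do rewrite -(linear_fun_sum (zpart_lin cS _)).
have := h true (fun r => zpart true Q (zop n S) (xi r)).
move=> /=; under eq_bigr do under eq_bigr do rewrite PT (zpart_id cS) -TP.
by under eq_bigr do rewrite -(linear_fun_sum (zpart_lin cS _)).
Qed.

End CliffordNorm.

(** * Isometries of the spin factor *)

Section Adjoints.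
Variables (R : realType) (H : hilbert R).
Implicit Types T U : H -> H.

Lemma is_adjointC T T' : is_adjoint T T' -> is_adjoint T' T.
Proof. by move=> h x y; rewrite ipC -h -ipC. Qed.

Lemma adjoint_unique T T1 T2 : is_adjoint T T1 -> is_adjoint T T2 -> T1 =1 T2.
Proof.
move=> h1 h2 x; apply: ip_inj => z.
by rewrite (is_adjointC h1) (is_adjointC h2).
Qed.

(** 2 |T' x|^2 = 2 Re <T T' x, x> is at most |T T' x|^2 + |x|^2, hence at most |T' x|^2 + |x|^2. *)
Lemma adjoint_contraction T T' :
  is_adjoint T T' -> op_bnd T 1 -> op_bnd T' 1.
Proof.
move=> adjT hT x; rewrite mul1r.
have h1 := rip_le (T (T' x)) x; have h2 := hT (T' x).
have h3 : rip (T (T' x)) x = q (T' x) by rewrite /rip adjT.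
by rewrite h3 in h1; lra.
Qed.

End Adjoints.

Section NumericalRange.
Variables (R : realType) (K : hilbert R).
Local Notation C := R[i].

(* The linear term in s of |(U + s a Z) x|^2 must vanish for a = 1 and a = i, so
   <U x, Z x> = 0 for all x, and U^* Z = 0 by polarization. *)
Lemma unitary_perturbation (U U' Z : K -> K) (k : R) :
  linear Z -> is_adjoint U U' ->
  (forall x, U' (U x) = x) -> (forall x, U (U' x) = x) -> 0 <= k ->
  (forall (s : R) (a : C), `|s| <= 2^-1 -> a = 1 \/ a = 'i ->
     forall x, q (U x + (s%:C * a) *: Z x) <= (1 + k * s ^+ 2) * q x) ->
  forall x, Z x = 0.
Proof.
move=> linZ adjU U'U UU' k0 hZ.
have qU x : q (U x) = q x by rewrite /q adjU U'U.
(* A linear term dominated by a quadratic one on both sides of 0 vanishes: [t] satisfies t <= 1/2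
   and t B < |g|, which contradicts the bound at t or at - t. *)
have quad (g B : R) : 0 <= B ->
    (forall s : R, `|s| <= 2^-1 -> s * g <= B * s ^+ 2) -> g = 0.
  move=> B0 hs; apply/eqP; rewrite -normr_eq0; apply/eqP/le_anti.
  rewrite normr_ge0 andbT leNgt; apply/negP => g0.
  pose t := `|g| / (2 * (`|g| + B)).
  have den : 0 < 2 * (`|g| + B) by rewrite mulr_gt0 // ltr_wpDr.
  have t0 : 0 < t by rewrite divr_gt0.
  have t1 : t <= 2^-1 by rewrite ler_pdivrMr // mulrA mulVf ?pnatr_eq0 // mul1r lerDl.
  have tB : t * B < `|g|.
    rewrite /t mulrAC ltr_pdivrMr // ltr_pM2l //; lra.
  have [gp|gn] := leP 0 g.
    have : t * g <= t * (t * B).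
      rewrite (_ : t * (t * B) = B * t ^+ 2); last by ring.
      by apply: hs; rewrite ger0_norm ?(ltW t0).
    by rewrite ler_pM2l // leNgt; move: tB; rewrite ger0_norm // => ->.
  have : t * (- g) <= t * (t * B).
    rewrite (_ : t * (t * B) = B * (- t) ^+ 2); last by ring.
    by rewrite mulrN -mulNr; apply: hs; rewrite normrN ger0_norm ?(ltW t0).
  by rewrite ler_pM2l // leNgt; move: tB; rewrite ltr0_norm // => ->.
have rip0 (a : C) x : a = 1 \/ a = 'i -> rip (U x) (a *: Z x) = 0.
  move=> ha.
  apply: (@quad _ (k * q x)); first by rewrite mulr_ge0.
  move=> s hs; have := hZ s a hs ha x.
  rewrite -scalerA qD qU ripZr qZr.
  have : 0 <= s ^+ 2 * q (a *: Z x) by rewrite mulr_ge0 ?sqr_ge0.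
  have : 0 <= k * q x * s ^+ 2 := mulr_ge0 (mulr_ge0 k0 (q_ge0 x)) (sqr_ge0 s).
  move=> h1 h2 h3; lra.
have ip0 x : inner K (U x) (Z x) = 0.
  have h1 := rip0 1 x (or_introl erefl).
  have h2 := rip0 'i x (or_intror erefl).
  move: h1 h2; rewrite /rip scale1r ipZr.
  case: (inner K (U x) (Z x)) => u v /= -> h2; apply/eqP.
  rewrite eq_complex /= eqxx /=; move: h2.
  by move=> h2; apply/eqP; lra.
have ip1 x y : inner K (U x) (Z y) = 0.
  have linU : linear U.
    move=> a u v; apply: ip_inj => w.
    by rewrite adjU ipDl ipZl ipDl ipZl !adjU.
  have hp (u v : K) : inner K (U u) (Z v) + inner K (U v) (Z u) = 0.
    have := ip0 (u + v); rewrite (linear_funD linU) (linear_funD linZ) ipDl !ipDr !ip0.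
    by rewrite add0r addr0.
  have h1 := hp x y.
  (* The form is conjugate linear in its second argument, so i x turns the sum of the two terms into
     their difference. *)
  have := hp ('i *: x) y.
  rewrite (linear_funZ linU) (linear_funZ linZ) ipZl ipZr.
  have -> : Num.conj ('i : C) = - 'i by apply/eqP; rewrite eq_complex /= oppr0 !eqxx.
  rewrite mulNr -mulrBr => /eqP; rewrite mulf_eq0 => /orP [|/eqP h2].
    by rewrite eq_complex /= oner_eq0 andbF.
  have : inner K (U x) (Z y) + inner K (U x) (Z y) = 0.
    move: h1 h2; set A := inner _ _ _; set B := inner _ _ _ => h1 h2.
    have -> : A + A = (A + B) + (A - B) by ring.
    by rewrite h1 h2 addr0.
  by move/eqP; rewrite -mulr2n mulrn_eq0 => /eqP.
move=> y; apply: q_eq0; rewrite /q -{1}(UU' (Z y)).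
by rewrite ip1.
Qed.

End NumericalRange.

Section Isometries.
Variables (R : realType) (K H : hilbert R).
Local Notation C := R[i].
Variables (E : lmodType C).
Variables (psi : {linear E -> (K -> K)}) (phi : {linear E -> (H -> H)}).
Hypothesis psi_bounded : forall x, bounded_op (psi x).
Hypothesis JCphi : JC_subtriple (range phi).
Hypothesis iso : forall x, opnorm (phi x) = opnorm (psi x).

Lemma phi_bounded x : bounded_op (phi x).
Proof. by case: JCphi => h _ _ _; apply: h; exists x. Qed.

Let phi_lin x : linear (phi x). Proof. by case: (phi_bounded x). Qed.
Let psi_lin x : linear (psi x). Proof. by case: (psi_bounded x). Qed.

Lemma phiP a x y v : phi (a *: x + y) v = a *: phi x v + phi y v.
Proof. by rewrite linearP. Qed.
Lemma phiB x y v : phi (x - y) v = phi x v - phi y v.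
Proof. by rewrite linearB. Qed.
Lemma psiP a x y v : psi (a *: x + y) v = a *: psi x v + psi y v.
Proof. by rewrite linearP. Qed.

Lemma iso_bnd x k : 0 <= k -> op_bnd (phi x) k <-> op_bnd (psi x) k.
Proof.
move=> k0; rewrite -(opnorm_leP (phi_bounded x) k0).
by rewrite -(opnorm_leP (psi_bounded x) k0) iso.
Qed.

Lemma phi_adjoint x : exists x', bounded_op x' /\ is_adjoint (phi x) x'.
Proof.
case: JCphi => _ _ _ /(_ _ _ _ (imageT phi x) (imageT phi x) (imageT phi x)).
by move=> [b' [h1 h2 _]]; exists b'.
Qed.

Lemma phi_triple x y y' : is_adjoint (phi y) y' ->
  exists w, forall v, phi w v = phi x (y' (phi x v)).
Proof.
move=> adjy.
case: JCphi => _ _ _ /(_ _ _ _ (imageT phi x) (imageT phi y) (imageT phi x)).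
move=> [b' [_ h2 [w _ hw]]]; exists w => v; rewrite hw /triple.
rewrite -[LHS]/(2^-1 *: (phi x (b' (phi x v)) + phi x (b' (phi x v)))) half_twice.
by rewrite (adjoint_unique h2 adjy).
Qed.

Definition unit_el (x : E) : Prop := exists x',
  [/\ is_adjoint (psi x) x', forall v, x' (psi x v) = v &
      forall v, psi x (x' v) = v].

(** The passage between the two sides: the estimate is proved for [phi], transported to [psi] by the
    isometry, and used there, where [psi x] is unitary. Then [psi z] vanishes, and so does [phi z],
    which has the same norm. *)
Lemma phi_perturbation x z (k : R) : unit_el x -> 0 <= k ->
  (forall (s : R) (a : C), `|s| <= 2^-1 -> a = 1 \/ a = 'i ->
     forall v, q (phi x v + (s%:C * a) *: phi z v) <= (1 + k * s ^+ 2) * q v) ->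
  forall v, phi z v = 0.
Proof.
move=> [x' [adjx x'x xx']] k0 h.
have psi0 : forall v, psi z v = 0.
  apply: (unitary_perturbation (psi_lin z) adjx x'x xx' k0) => s a hs ha v.
  rewrite addrC -psiP.
  have k1 : 0 <= 1 + k * s ^+ 2 by rewrite addr_ge0 // mulr_ge0 // sqr_ge0.
  have /(iso_bnd _ k1) : op_bnd (phi ((s%:C * a) *: z + x)) (1 + k * s ^+ 2).
    by move=> w; rewrite phiP addrC; exact: h.
  exact.
have : op_bnd (phi z) 0.
  by apply/iso_bnd => // v; rewrite psi0 q0 mul0r.
move=> h0 v; apply: q_eq0; apply/le_anti; rewrite q_ge0 andbT.
by have := h0 v; rewrite mul0r.
Qed.

Section OneUnitary.
Variable x : E.
Hypothesis ux : unit_el x.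
Variable x' : H -> H.
Hypothesis adjx : is_adjoint (phi x) x'.

Let T := phi x.

Lemma unit_contraction : op_bnd T 1.
Proof.
apply/iso_bnd => // v; case: ux => y [adjy yx _].
by rewrite mul1r /q adjy yx.
Qed.

Lemma unit_adj_contraction : op_bnd x' 1.
Proof. exact: adjoint_contraction adjx unit_contraction. Qed.

Let TC v : q (T v) <= q v.
Proof. by have := unit_contraction v; rewrite mul1r. Qed.
Let xC v : q (x' v) <= q v.
Proof. by have := unit_adj_contraction v; rewrite mul1r. Qed.

Lemma Re_s1i (s : R) (a : C) : a = 1 \/ a = 'i ->
  (nsq (s%:C * a) = s ^+ 2) * (complex.Re (Num.conj (s%:C * a)) <= `|s|).
Proof.
move=> [] ->; rewrite /nsq.
  by rewrite mulr1 /= expr0n addr0 ler_norm.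
rewrite /=; split; first by ring.
by rewrite mulr0 mul0r subr0.
Qed.

(** With D = T v - T T^* T v, the inner product <T v, D> is g = |T v|^2 - |T^* T v|^2. The
    positivity of |v - T^* T v|^2 gives g <= |v|^2 - |T v|^2, so for |s| <= 1/2 the first-order term
    is absorbed by the amount by which T shortens v. *)
Lemma unit_tripotent v : T (x' (T v)) = T v.
Proof.
have [w hw] := phi_triple x adjx.
apply/eqP; rewrite -subr_eq0 -oppr_eq0 opprB; apply/eqP.
have DE y : phi (x - w) y = T y - T (x' (T y)).
  by rewrite phiB hw.
rewrite -DE; move: v; apply: (@phi_perturbation x (x - w) 4 ux _) => //.
move=> s a hs ha v; rewrite DE.
set D := T v - _.
pose g := q (T v) - q (x' (T v)).
have ipD : inner H (T v) D = g%:C.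
  by rewrite /D ipBr ipxx -(is_adjointC adjx) ipxx -rmorphB.
have g0 : 0 <= g by rewrite subr_ge0.
have gle : g <= q v - q (T v).
  have := q_ge0 (v - x' (T v)); rewrite qB.
  have -> : rip v (x' (T v)) = q (T v) by rewrite /rip -adjx.
  by rewrite /g; lra.
(* This is the constant 4 of the perturbation bound: D is a difference of two vectors no longer than
   v. *)
have qD4 : q D <= 4 * q v.
  rewrite /D; apply: le_trans (qD_le _ _) _; rewrite qN.
  have := TC v; have := TC (x' (T v)); have := xC (T v); lra.
have [h1 h2] := Re_s1i s ha.
rewrite qD qZ -/(nsq _) h1 /rip ipZr ipD.
have -> : complex.Re (Num.conj (s%:C * a) * g%:C) =
   complex.Re (Num.conj (s%:C * a)) * g.
  by rewrite mulrC Re_mulR mulrC.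
have h3 : complex.Re (Num.conj (s%:C * a)) * g <= 2^-1 * g.
  by rewrite ler_wpM2r // (le_trans h2).
have h4 : s ^+ 2 * q D <= s ^+ 2 * (4 * q v) by rewrite ler_wpM2l ?sqr_ge0.
have -> : (1 + 4 * s ^+ 2) * q v = q v + s ^+ 2 * (4 * q v) by ring.
lra.
Qed.

(** [phi y] lies in the Peirce 2-space of the tripotent T. With P and Q the source and range
    projections of T, the operator Z = phi z is the part of [phi y] outside that space, so Q Z P =
    0. Hence <T v, Z v> depends on v in its second argument only through eta = v - P v, and |T v|^2
    = |v|^2 - |eta|^2 leaves room for it. *)
Lemma unit_peirce y v : T (x' (phi y (x' (T v)))) = phi y v.
Proof.
have linT : linear T := phi_lin x.
have [y' [_ adjy]] := phi_adjoint y.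
(* Two triple products, w = x y^* x and then x w^* x, bring [phi y] cut down by both projections
   back into the range of [phi]. *)
have [w hw] := phi_triple x adjy.
have adjw : is_adjoint (phi w) (fun v => x' (phi y (x' v))).
  by move=> a b; rewrite hw adjx (is_adjointC adjy) adjx.
have [w2 hw2] := phi_triple x adjw.
apply/eqP; rewrite -subr_eq0 -oppr_eq0 opprB; apply/eqP.
pose z := y - w2.
have ZE u : phi z u = phi y u - T (x' (phi y (x' (T u)))).
  by rewrite phiB hw2.
rewrite -ZE.
have [z' [bz' adjz]] := phi_adjoint z.
have [M M0 hM] := bounded_op_bnd bz'.
have [L L0 hL] := bounded_op_bnd (phi_bounded z).
move: v; apply: (@phi_perturbation x z (L + M) ux _); first by rewrite addr_ge0.
move=> s a hs ha v.
have [h1 h2] := Re_s1i s ha.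
pose P u := x' (T u).
have linx' : linear x'.
  move=> c u t; apply: ip_inj => r.
  by rewrite (is_adjointC adjx) ipDl ipZl ipDl ipZl !(is_adjointC adjx).
have linP : linear P by move=> c u t; rewrite /P linT linx'.
have adjP : is_adjoint P P by move=> u t; rewrite /P (is_adjointC adjx) adjx.
have PP u : P (P u) = P u by rewrite /P unit_tripotent.
have qT u : q (T u) = q (P u).
  by rewrite /q adjP PP adjx.
pose eta := v - P v.
have qeta : q v = q (P v) + q eta.
  rewrite /eta qB /rip.
  have -> : inner H v (P v) = inner H (P v) (P v) by rewrite adjP PP.
  rewrite -/(q (P v)); ring.
have QZP : T (x' (phi z (P v))) = 0.
  have e1 : x' (T (P v)) = P v by exact: PP.
  by rewrite ZE e1 (linear_funB linx') (linear_funB linT) unit_tripotent subrr.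
pose c := s%:C * a.
(* The factor c is moved to the side of Z^* T v, so that the inequality 2 Re <a, b> <= |a|^2 + |b|^2
   puts s^2 there and leaves [q eta] with coefficient 1. *)
have cross : 2 * rip (T v) (c *: phi z v) <= s ^+ 2 * (M * q v) + q eta.
  have zeta : T (x' (phi z v)) = T (x' (phi z eta)).
    have lz := phi_lin z.
    by rewrite /eta (linear_funB lz) (linear_funB linx') (linear_funB linT) QZP subr0.
  have -> : rip (T v) (c *: phi z v) = rip (Num.conj c *: z' (T v)) eta.
    rewrite /rip ipZl ipZr; congr (complex.Re (_ * _)).
    rewrite -{1}unit_tripotent adjx (is_adjointC adjx) -/T zeta -(is_adjointC adjx) -adjx.
    by rewrite -/T unit_tripotent (is_adjointC adjz).
  apply: le_trans (rip_le _ _) _; rewrite lerD2r qZ.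
  have -> : complex.Re (Num.conj c) ^+ 2 + complex.Im (Num.conj c) ^+ 2 = s ^+ 2.
    by rewrite -h1 -/c /nsq; case: (c) => u t /=; rewrite sqrrN.
  rewrite ler_wpM2l ?sqr_ge0 //; apply: le_trans (hM _) _.
  by rewrite ler_wpM2l.
rewrite -/c qD qZ -/(nsq c) h1.
have h3 : s ^+ 2 * q (phi z v) <= s ^+ 2 * (L * q v) by rewrite ler_wpM2l ?sqr_ge0.
have -> : (1 + (L + M) * s ^+ 2) * q v = q v + s ^+ 2 * (L * q v) + s ^+ 2 * (M * q v).
  by ring.
have := qT v; lra.
Qed.

End OneUnitary.

(** By [unit_peirce] each of the two range projections fixes the range of the other element. *)
Lemma unit_range x y x' y' : unit_el x -> unit_el y ->
  is_adjoint (phi x) x' -> is_adjoint (phi y) y' ->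
  forall v, phi x (x' v) = phi y (y' v).
Proof.
have dom a b a' : unit_el a -> is_adjoint (phi a) a' ->
    forall v, phi a (a' (phi b v)) = phi b v.
  move=> ua adja v; rewrite -{1}(unit_peirce ua adja b).
  by rewrite unit_tripotent // unit_peirce.
move=> ux uy adjx adjy v; apply: ip_inj => w.
rewrite -(dom y x y' uy adjy) [LHS]adjy [LHS](is_adjointC adjy) [LHS]adjx.
rewrite [LHS](is_adjointC adjx) (dom x y x' ux adjx).
by rewrite -(is_adjointC adjy) -adjy.
Qed.

Lemma unit_source x y x' : unit_el x -> is_adjoint (phi x) x' ->
  forall v, phi y (x' (phi x v)) = phi y v.
Proof.
move=> ux adjx v; rewrite -[LHS](unit_peirce ux adjx).
by rewrite (unit_tripotent ux adjx) (unit_peirce ux adjx).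
Qed.

(** Two nonzero reals whose squares add up to 1: a mixture of two unitaries with these weights is
    unitary when the cross terms cancel, and the nonzero product of the weights lets the cross terms
    be recovered. *)
Let c35 : C := (3%:R / 5%:R)%:C.
Let c45 : C := (4%:R / 5%:R)%:C.

Lemma conjR (r : R) : Num.conj (r%:C : C) = r%:C.
Proof. by apply/eqP; rewrite eq_complex /= oppr0 !eqxx. Qed.

Lemma c35_45 : c35 * c35 + c45 * c45 = 1.
Proof.
by rewrite /c35 /c45 -!rmorphM -rmorphD; congr (_%:C); field.
Qed.

(** For z the mixture, z z^* is the combination of x x^* and y y^* plus a nonzero multiple of x y^*
    + y x^*. All three range projections agree, so the cross term vanishes. *)
Lemma unit_cross x y x' y' : unit_el x -> unit_el y ->
  unit_el (c35 *: x + c45 *: y) ->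
  is_adjoint (phi x) x' -> is_adjoint (phi y) y' ->
  forall v, phi x (y' v) + phi y (x' v) = 0.
Proof.
move=> ux uy uz adjx adjy v.
pose z := c35 *: x + c45 *: y.
pose z' v := c35 *: x' v + c45 *: y' v.
have zE w : phi z w = c35 *: phi x w + c45 *: phi y w.
  by rewrite /z linearD !linearZ.
have adjz : is_adjoint (phi z) z'.
  move=> a b; rewrite zE /z' ipDl ipDr !ipZl !ipZr /c35 /c45 !conjR.
  by rewrite adjx adjy.
have := unit_range ux uz adjx adjz v.
rewrite zE /z' !(linear_funD (phi_lin _)) !(linear_funZ (phi_lin _)).
rewrite -(unit_range ux uy adjx adjy v) !scalerDr !scalerA.
set A := phi x (x' v); set B := phi x (y' v); set D := phi y (x' v).
rewrite addrACA [X in _ + X]addrC addrACA [c45 * c35]mulrC -scalerDl -scalerDr.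
rewrite c35_45 scale1r -[X in X = _ -> _]addr0 => /addrI /esym /eqP.
rewrite scaler_eq0 => /orP [|/eqP]; last by rewrite addrC.
by rewrite mulf_eq0 /c35 /c45 !(inj_eq (@complexI R) _ 0) => /orP [] /eqP h; exfalso; lra.
Qed.

Section SpinElements.
Variables (n : nat) (e : nat -> E).
Hypothesis e0 : forall v, psi (e 0%N) v = v.
Hypothesis cK : clifford n idfun (fun j => psi (e j.+1)).

(** The counterpart of [unit_cross] on the side of the matrices: there the cross terms are known to
    cancel, which makes the mixture unitary. *)
Lemma unit_mix x y x' y' :
  is_adjoint (psi x) x' -> is_adjoint (psi y) y' ->
  (forall v, x' (psi x v) = v) -> (forall v, psi x (x' v) = v) ->
  (forall v, y' (psi y v) = v) -> (forall v, psi y (y' v) = v) ->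
  (forall v, psi x (y' v) + psi y (x' v) = 0) ->
  (forall v, x' (psi y v) + y' (psi x v) = 0) ->
  unit_el (c35 *: x + c45 *: y).
Proof.
move=> adjx adjy x'x xx' y'y yy' xy yx.
have adj_lin (T T' : K -> K) : is_adjoint T T' -> linear T'.
  move=> adj a u v; apply: ip_inj => w.
  by rewrite (is_adjointC adj) ipDl ipZl ipDl ipZl !(is_adjointC adj).
have zE w : psi (c35 *: x + c45 *: y) w = c35 *: psi x w + c45 *: psi y w.
  by rewrite linearD !linearZ.
have alg (A B D : K) : B + D = 0 ->
    c35 *: (c35 *: A + c45 *: B) + c45 *: (c35 *: D + c45 *: A) = A.
  move=> BD; rewrite !scalerDr !scalerA.
  rewrite addrACA [X in _ + X]addrC addrACA [c45 * c35]mulrC -scalerDl.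
  by rewrite -scalerDr addrC [D + B]addrC BD scaler0 add0r c35_45 scale1r.
exists (fun v => c35 *: x' v + c45 *: y' v); split.
- move=> a b; rewrite zE ipDl ipDr !ipZl !ipZr /c35 /c45 !conjR.
  by rewrite adjx adjy.
- move=> v; rewrite zE !(linear_funD (adj_lin _ _ adjx)) !(linear_funD (adj_lin _ _ adjy)).
  rewrite !(linear_funZ (adj_lin _ _ adjx)) !(linear_funZ (adj_lin _ _ adjy)).
  by rewrite x'x y'y alg.
- move=> v; rewrite zE !(linear_funD (psi_lin _)) !(linear_funZ (psi_lin _)).
  by rewrite xx' yy' alg.
Qed.

Let s j := psi (e j.+1).
Let slin j : linear (s j). Proof. exact: psi_lin. Qed.
Let adjs j : (j <= n.*2)%N -> is_adjoint (s j) (s j). Proof. exact: (cl_adj cK). Qed.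
Let ss j : (j <= n.*2)%N -> forall v, s j (s j v) = v. Proof. exact: (cl_sqr cK). Qed.
Let adj0 : is_adjoint (psi (e 0%N)) idfun.
Proof. by move=> a b; rewrite e0. Qed.
Let adji j : (j <= n.*2)%N -> is_adjoint (psi ('i *: e j.+1)) (fun v => - 'i *: s j v).
Proof.
move=> jn a b; rewrite linearZ ipZr /= [LHS]ipZl (cl_adj cK) //; congr (_ * _).
by rewrite rmorphN; apply/eqP; rewrite eq_complex /= ?oppr0 ?opprK !eqxx.
Qed.
Let psii j v : psi ('i *: e j.+1) v = 'i *: s j v. Proof. by rewrite linearZ. Qed.

Lemma iC2 (v : K) : 'i *: (- 'i *: v) = v.
Proof. by rewrite scalerA mulrN -expr2 sqr_i opprK scale1r. Qed.

Lemma unit_e0 : unit_el (e 0%N).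
Proof. by exists idfun; split => //= v; rewrite e0. Qed.

Lemma unit_e j : (j <= n.*2)%N -> unit_el (e j.+1).
Proof. by move=> jn; exists (s j); split; [exact: adjs|exact: ss|exact: ss]. Qed.

Lemma unit_ie j : (j <= n.*2)%N -> unit_el ('i *: e j.+1).
Proof.
move=> jn; exists (fun v => - 'i *: s j v); split; first exact: adji.
  move=> v; rewrite psii (linear_funZ (slin _)) ss // scalerA mulNr.
  by rewrite -expr2 sqr_i opprK scale1r.
by move=> v; rewrite psii (linear_funZ (slin _)) ss // iC2.
Qed.

(** With u = phi(1), right multiplication by u^* turns phi(A) into the operators of the system, and
    right multiplication by u turns them back. Both factors are contractions, so the amplified
    bounds agree. *)
Lemma iso_clifford : exists (Q : H -> H) (S : nat -> H -> H),
  [/\ clifford n Q S,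
      (exists v : K, v != 0) -> (exists w, Q w != 0) &
      forall m (A : 'I_m -> 'I_m -> E) (al : 'I_m -> 'I_m -> nat -> C),
        (forall p r, A p r = al p r 0%N *: e 0%N +
           \sum_(j < n.*2.+1) al p r j.+1 *: e j.+1) ->
        forall k, 0 <= k ->
        amp_bnd (fun p r => phi (A p r)) k <->
        amp_bnd (fun p r => clop n Q S (al p r)) k].
Proof.
have /choice [f hf] : forall j : nat, exists f : H -> H,
    linear f /\ is_adjoint (phi (e j)) f.
  by move=> j; have [f [[lf _] af]] := phi_adjoint (e j); exists f.
pose u := phi (e 0%N); pose u' := f 0%N.
pose F j := phi (e j.+1); pose F' j := f j.+1.
have linu' : linear u' by case: (hf 0%N).
have adju : is_adjoint u u' by case: (hf 0%N).
have adjF j : is_adjoint (F j) (F' j) by case: (hf j.+1).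
have linF' j : linear (F' j) by case: (hf j.+1).
have FFQ j : (j <= n.*2)%N -> forall v, F j (F' j v) = u (u' v).
  by move=> jn v; exact: (unit_range (unit_e jn) unit_e0 (adjF j) adju).
have Fu j : (j <= n.*2)%N -> forall v, F j (u' v) = u (F' j v).
  move=> jn v.
  (* The identity commutes with s_j, so it is mixed with i s_j, which is skew-adjoint and makes the
     cross terms cancel. The relation obtained says that S_j = F_j u^* is self-adjoint. *)
  have um : unit_el (c35 *: e 0%N + c45 *: ('i *: e j.+1)).
    apply: (unit_mix adj0 (adji jn)) => //=.
    - by move=> w; rewrite psii (linear_funZ (slin _)) ss // scalerA mulNr -expr2 sqr_i opprK scale1r.
    - by move=> w; rewrite psii (linear_funZ (slin _)) ss // iC2.
    - by move=> w; rewrite e0 psii -scalerDl addNr scale0r.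
    - by move=> w; rewrite e0 psii -scalerDl subrr scale0r.
  have adjiF : is_adjoint (phi ('i *: e j.+1)) (fun v => - 'i *: F' j v).
    move=> a b; rewrite linearZ ipZr /= [LHS]ipZl adjF; congr (_ * _).
    by rewrite rmorphN; apply/eqP; rewrite eq_complex /= ?oppr0 ?opprK !eqxx.
  have := unit_cross unit_e0 (unit_ie jn) um adju adjiF v.
  rewrite (linear_funZ (phi_lin _)) linearZ /= scaleNr addrC -scalerBr => /eqP.
  rewrite scaler_eq0 => /orP [/eqP /(congr1 (@complex.Im R)) /= /eqP|].
    by rewrite oner_eq0.
  by rewrite subr_eq0 => /eqP.
have Fsrc j v : F j (u' (u v)) = F j v.
  exact: (unit_source (e j.+1) unit_e0 adju v).
have usrc v : u (u' (u v)) = u v.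
  exact: (unit_source (e 0%N) unit_e0 adju v).
have anti j k : (j <= n.*2)%N -> (k <= n.*2)%N -> j != k -> forall v,
    F j (F' k v) + F k (F' j v) = 0.
  move=> jn kn jk.
  apply: (unit_cross (unit_e jn) (unit_e kn)) => //; last exact: adjF.
    apply: (unit_mix (adjs jn) (adjs kn)) => w; try exact: ss.
      by rewrite /s (cl_anti cK jn kn jk) addNr.
    by rewrite /s (cl_anti cK jn kn jk) addNr.
  exact: adjF.
pose Q v := u (u' v); pose S j v := F j (u' v).
have linu : linear u := phi_lin _.
have linF j : linear (F j) := phi_lin _.
have cS : clifford n Q S.
  split.
  - by move=> a x y; rewrite /Q linu' linu.
  - by move=> x y; rewrite /Q adju (is_adjointC adju).
  - by move=> x; rewrite /Q usrc.
  - by move=> j jn a x y; rewrite /S linu' linF.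
  - by move=> j jn x y; rewrite /S Fu // adju (is_adjointC (adjF j)).
  - by move=> j jn x; rewrite /S [F j (u' x)]Fu // Fsrc FFQ.
  - move=> j jn x; rewrite /Q /S [F j (u' x)]Fu // usrc //.
  - move=> j k jn kn jk x; rewrite /S [F k (u' x)]Fu // [F j (u' x)]Fu // !Fsrc.
    by apply/eqP; rewrite -addr_eq0 anti.
exists Q, S; split => //.
  (* If Q = 0, then u = u u^* u = 0, although phi(1) has the norm of the identity. *)
  move=> [v v0]; apply: contrapT => hQ.
  have uz x : u x = 0.
    rewrite -usrc; apply/eqP; apply: contrapT => /negP h.
    by apply: hQ; exists (u x).
  have : op_bnd (phi (e 0%N)) 0 by move=> x; rewrite -/u uz q0 mul0r.
  move/iso_bnd => /(_ (lexx 0)) /(_ v); rewrite e0 mul0r => h.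
  move/eqP: v0; apply; apply: q_eq0; apply/le_anti.
  by rewrite h q_ge0.
move=> m A al hA k k0.
have phiE p r v : phi (A p r) (u' v) = clop n Q S (al p r) v.
  rewrite hA linearD linearZ linear_sum /= /clop.
  rewrite -[LHS]/(al p r 0%N *: u (u' v) + (\sum_(j < n.*2.+1) phi (al p r j.+1 *: e j.+1)) (u' v)).
  congr (_ + _); rewrite fct_sumE; apply: eq_bigr => j _.
  by rewrite linearZ.
have uC x : q (u x) <= q x.
  by have := unit_contraction unit_e0 x; rewrite mul1r.
have u'C x : q (u' x) <= q x.
  by have := unit_adj_contraction unit_e0 adju x; rewrite mul1r.
split=> h xi.
  have := h (fun r => u' (xi r)).
  under eq_bigr do under eq_bigr do rewrite phiE.
  move=> /le_trans; apply; rewrite ler_wpM2l //.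
  by apply: ler_sum => r _.
have src p r v : phi (A p r) v = clop n Q S (al p r) (u v).
  by rewrite -phiE (unit_source _ unit_e0 adju).
under eq_bigr do under eq_bigr do rewrite src.
apply: le_trans (h _) _; rewrite ler_wpM2l //.
by apply: ler_sum => r _.
Qed.

End SpinElements.

End Isometries.

(** * The concrete spin factor *)

Section TensorMonoid.
Variable R : realType.
Local Notation C := R[i].

(* Square matrices of any size, so that the tensor product is associative
   without a cast. *)
Definition sqmx := {k : nat & 'M[C]_k}.
Definition sq k (A : 'M[C]_k) : sqmx := existT _ k A.
Definition stens (a b : sqmx) : sqmx := sq (projT2 a *t projT2 b).
Definition spow (a : sqmx) k : sqmx := iter k (stens a) (sq (1%:M : 'M[C]_1)).

Lemma sq_cast k l (e : k = l) (A : 'M[C]_k) : sq (castmx (e, e) A) = sq A.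
Proof. by case: l / e; rewrite castmx_id. Qed.

Lemma sq_eq k l (A : 'M[C]_k) (B : 'M[C]_l) (e : k = l) :
  (forall i j, A i j = B (cast_ord e i) (cast_ord e j)) -> sq A = sq B.
Proof.
move=> h; destruct e; congr sq; apply/matrixP => i j.
by rewrite h !cast_ord_id.
Qed.

Lemma sq_inj k (A B : 'M[C]_k) : sq A = sq B -> A = B.
Proof.
exact: (@Eqdep_dec.inj_pair2_eq_dec _ PeanoNat.Nat.eq_dec (fun k => 'M[C]_k)).
Qed.

Lemma stensA a b c : stens a (stens b c) = stens (stens a b) c.
Proof.
case: a b c => [k A] [l B] [m D]; rewrite /stens /=.
apply: (sq_eq (e := mulnA k l m)) => i j.
case: (mxtens_indexP i) => i1 i'; case: (mxtens_indexP i') => i2 i3.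
case: (mxtens_indexP j) => j1 j'; case: (mxtens_indexP j') => j2 j3.
have castE (a : 'I_k) (b : 'I_l) (d : 'I_m) :
    cast_ord (mulnA k l m) (mxtens_index (a, mxtens_index (b, d))) =
    mxtens_index (mxtens_index (a, b), d).
  by apply: val_inj => /=; rewrite mulnDl mulnA addnA.
by rewrite !castE !tensmxE mulrA.
Qed.

Lemma stens1s a : stens (sq (1%:M : 'M[C]_1)) a = a.
Proof. by case: a => k A; rewrite /stens tens_scalar_mx scale1r sq_cast. Qed.

Lemma stenss1 a : stens a (sq (1%:M : 'M[C]_1)) = a.
Proof. by case: a => k A; rewrite /stens tens_mx_scalar scale1r sq_cast. Qed.

Lemma spowD a k l : spow a (k + l) = stens (spow a k) (spow a l).
Proof.
elim: k => [|k IH]; first by rewrite stens1s.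
by rewrite addSn /= IH stensA.
Qed.

Lemma spow1 a : spow a 1 = a. Proof. exact: stenss1. Qed.

Lemma spowE (A : 'M[C]_2) k : sq (A ^t k) = spow (sq A) k.
Proof.
case: k => [//|k]; elim: k => [|k IH]; first by rewrite spow1.
by rewrite ntensmxSS /spow iterS -/(spow _ _) -IH.
Qed.

Lemma sq_scalar k l : k = l -> sq (1%:M : 'M[C]_k) = sq (1%:M : 'M[C]_l).
Proof. by move=> ->. Qed.

Lemma tens11 k l : (1%:M : 'M[C]_k) *t (1%:M : 'M[C]_l) = 1%:M.
Proof.
apply/matrixP => i j; rewrite !mxE -natrM mulnb; congr ((nat_of_bool _)%:R).
by rewrite -xpair_eqE -!surjective_pairing (inj_eq (can_inj (@mxtens_unindexK k l))).
Qed.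

Lemma spow_one k : spow (sq (1%:M : 'M[C]_2)) k = sq (1%:M : 'M[C]_(2 ^ k)).
Proof.
elim: k => [//|k IH]; rewrite /spow iterS -/(spow _ _) IH /stens /= tens11.
by apply: sq_scalar; rewrite expnS.
Qed.

(** Allows a commutation relation to be checked on tensor factorizations whose size equals the given
    one only up to a proof. *)
Lemma sq_comm k l (A B : 'M[C]_k) (X Y : 'M[C]_l) (c : C) :
  sq A = sq X -> sq B = sq Y -> X *m Y = c *: (Y *m X) -> A *m B = c *: (B *m A).
Proof.
move=> hA; have e : k = l := congr1 (@projT1 _ _) hA.
case: l / e X Y hA => X Y /sq_inj -> /sq_inj ->; exact.
Qed.

End TensorMonoid.

Section SpinMatrices.
Variable R : realType.
Local Notation C := R[i].
Local Notation s1 := (sigma1 R).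
Local Notation s2 := (sigma2 R).
Local Notation s3 := (sigma3 R).

Definition hermx k (A : 'M[C]_k) : Prop := forall i j, A i j = Num.conj (A j i).

Lemma pauli_sqr : [/\ s1 *m s1 = 1%:M, s2 *m s2 = 1%:M & s3 *m s3 = 1%:M].
Proof.
split; apply/matrixP; do 2![case=> [[|[|//]] ?]];
  rewrite !mxE big_ord_recl big_ord1 !mxE /= ?expr0 ?expr1;
  by rewrite ?(mulr0, mul0r, addr0, add0r, mul1r, mulr1, mulrNN, mulrN, mulNr) -?expr2 ?sqr_i ?opprK.
Qed.

Lemma pauli_anti : [/\ s1 *m s2 = -1 *: (s2 *m s1), s3 *m s1 = -1 *: (s1 *m s3)
  & s3 *m s2 = -1 *: (s2 *m s3)].
Proof.
split; apply/matrixP; do 2![case=> [[|[|//]] ?]];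
  rewrite !mxE !big_ord_recl !big_ord0 !mxE /= ?expr0 ?expr1;
  by rewrite ?(mulr0, mul0r, addr0, add0r, mul1r, mulr1, mulrNN, mulrN, mulNr, opprK, oppr0).
Qed.

Lemma pauli_herm : [/\ hermx s1, hermx s2 & hermx s3].
Proof.
split; do 2![case=> [[|[|//]] ?]]; rewrite !mxE /= ?expr0 ?expr1;
  apply/eqP; rewrite eq_complex /= ?oppr0 ?opprK ?mulr0 ?mul0r ?eqxx //=;
  apply/eqP; ring.
Qed.

Lemma hermx_tens k l (A : 'M[C]_k) (B : 'M[C]_l) :
  hermx A -> hermx B -> hermx (A *t B).
Proof. by move=> hA hB i j; rewrite !mxE rmorphM /= -hA -hB. Qed.

Lemma hermx1 k : hermx (1%:M : 'M[C]_k).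
Proof. by move=> i j; rewrite !mxE rmorph_nat eq_sym. Qed.

Lemma hermx_pow (A : 'M[C]_2) k : hermx A -> hermx (A ^t k).
Proof.
move=> hA; case: k => [|k]; first exact: hermx1.
by elim: k => [//|k IH]; rewrite ntensmxSS; exact: hermx_tens.
Qed.

Lemma hermx_cast k l (e : k = l) (A : 'M[C]_k) :
  hermx A -> hermx (castmx (e, e) A).
Proof. by case: l / e; rewrite castmx_id. Qed.

Lemma pow_sqr (A : 'M[C]_2) k : A *m A = 1%:M -> A ^t k *m A ^t k = 1%:M.
Proof.
move=> hA; case: k => [|k]; first exact: mulmx1.
elim: k => [//|k IH]; rewrite ntensmxSS tensmx_mul hA IH.
exact: tens11.
Qed.

Section FixedSize.
Variable n : nat.

Lemma spin_herm x (k : 'I_n) : hermx x -> hermx (spin x k).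
Proof.
move=> hx; apply: hermx_cast; apply: hermx_tens; last exact/hermx_pow/hermx1.
by apply: hermx_tens => //; apply: hermx_pow; case: pauli_herm.
Qed.

Lemma sq_spin x (k : 'I_n) : sq (spin x k) =
  stens (stens (spow (sq s3) k) (sq x)) (sq (1%:M : 'M[C]_(2 ^ (n - k.+1)))).
Proof.
by rewrite /spin sq_cast -spow_one -!spowE.
Qed.

End FixedSize.
End SpinMatrices.

Section SpinFamily.
Variable R : realType.
Local Notation C := R[i].
Local Notation s1 := (sigma1 R).
Local Notation s2 := (sigma2 R).
Local Notation s3 := (sigma3 R).

Lemma tensZl k l (c : C) (A : 'M[C]_k) (B : 'M[C]_l) :
  (c *: A) *t B = c *: (A *t B).
Proof. by apply/matrixP => i j; rewrite !mxE mulrA. Qed.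

Lemma tensZr k l (c : C) (A : 'M[C]_k) (B : 'M[C]_l) :
  A *t (c *: B) = c *: (A *t B).
Proof. by apply/matrixP => i j; rewrite !mxE mulrCA. Qed.

Variable n : nat.

Lemma spin_same (x y : 'M[C]_2) (c : C) (k : 'I_n) : x *m y = c *: (y *m x) ->
  spin x k *m spin y k = c *: (spin y k *m spin x k).
Proof.
move=> xy; rewrite /spin.
apply: (sq_comm (sq_cast _ _) (sq_cast _ _)).
by rewrite !tensmx_mul xy tensZr tensZl.
Qed.

Lemma castmx_sqr k l (e : k = l) (A : 'M[C]_k) : A *m A = 1%:M ->
  castmx (e, e) A *m castmx (e, e) A = 1%:M.
Proof. by case: l / e; rewrite !castmx_id. Qed.

Lemma spin_sqr (x : 'M[C]_2) (k : 'I_n) : x *m x = 1%:M -> spin x k *m spin x k = 1%:M.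
Proof.
move=> xx; apply: castmx_sqr; rewrite !tensmx_mul xx !pow_sqr ?mulmx1 //.
  by rewrite !tens11.
by case: (pauli_sqr R).
Qed.

Lemma spin_anti (x y : 'M[C]_2) (k l : 'I_n) : (k < l)%N -> s3 *m x = -1 *: (x *m s3) ->
  spin y l *m spin x k = -1 *: (spin x k *m spin y l).
Proof.
move=> kl hx.
(* The factors are regrouped around position k, where [Y] has sigma3 and [X] has x. Before that
   position both have sigma3, and after it [X] has the identity, so the sign comes from position k
   alone. *)
pose d := (l - k.+1)%N.
pose Y := (s3 ^t k *t s3) *t ((s3 ^t d *t y) *t (1%:M : 'M[C]_(2 ^ (n - l.+1)))).
pose X := (s3 ^t k *t x) *t (1%:M : 'M[C]_(2 ^ d * 2 * 2 ^ (n - l.+1))).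
have dims : (2 ^ (n - k.+1) = 2 ^ d * 2 * 2 ^ (n - l.+1))%N.
  rewrite -expnSr -expnD; congr (2 ^ _)%N; rewrite /d; have := ltn_ord l; lia.
have hX : sq (spin x k) = sq X.
  by rewrite sq_spin (sq_scalar R dims) -spowE.
have hY : sq (spin y l) = sq Y.
  have hl : spow (sq s3) l = stens (sq (s3 ^t k)) (stens (sq s3) (sq (s3 ^t d))).
    rewrite !spowE -[stens (sq s3) _]/(spow (sq s3) d.+1) -spowD; congr spow.
    by rewrite /d; lia.
  rewrite sq_spin hl.
  rewrite -[sq Y]/(stens (stens (sq (s3 ^t k)) (sq s3))
    (stens (stens (sq (s3 ^t d)) (sq y)) (sq (1%:M : 'M[C]_(2 ^ (n - l.+1)))))).
  by rewrite !stensA.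
apply: (sq_comm hY hX).
by rewrite !tensmx_mul hx mulmx1 mul1mx tensZr tensZl.
Qed.

Lemma pow_anti (x : 'M[C]_2) (k : 'I_n) : s3 *m x = -1 *: (x *m s3) ->
  s3 ^t n *m spin x k = -1 *: (spin x k *m s3 ^t n).
Proof.
move=> hx.
pose d := (n - k.+1)%N.
pose Y := (s3 ^t k *t s3) *t (s3 ^t d).
have hY : sq (s3 ^t n) = sq Y.
  rewrite -[sq Y]/(stens (stens (sq (s3 ^t k)) (sq s3)) (sq (s3 ^t d))) !spowE.
  rewrite -stensA -[stens (sq s3) _]/(spow (sq s3) d.+1) -spowD; congr spow.
  by rewrite /d; have := ltn_ord k; lia.
have hX : sq (spin x k) = sq ((s3 ^t k *t x) *t (1%:M : 'M[C]_(2 ^ d))).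
  by rewrite sq_spin -spowE.
apply: (sq_comm hY hX).
by rewrite !tensmx_mul hx mulmx1 mul1mx tensZr tensZl.
Qed.

Lemma tens1_mul (A B : 'M[C]_(2 ^ n)) : tens1 A *m tens1 B = tens1 (A *m B).
Proof. by rewrite /tens1 tensmx_mul mulmx1. Qed.

End SpinFamily.

Section Generators.
Variable R : realType.
Local Notation C := R[i].
Local Notation s1 := (sigma1 R).
Local Notation s2 := (sigma2 R).
Local Notation s3 := (sigma3 R).
Variable m : nat.
Local Notation n := m.+1.
Local Notation dim := (2 ^ n * 2)%N.

(* s_1, ..., s_(2n+1) of the paper, numbered from 0. *)
Definition gen (j : nat) : 'M[C]_dim :=
  if (j < n.*2)%N then tens1 (spin (if odd j then s2 else s1) (inord j./2 : 'I_n))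
  else spin_last R n.

Lemma gen_herm j : hermx (gen j).
Proof.
have [h1 h2 h3] := pauli_herm R.
rewrite /gen; case: ifP => _; last by apply: hermx_tens => //; exact: hermx_pow.
apply: hermx_tens; last exact: hermx1.
by apply: spin_herm; case: (odd j).
Qed.

Lemma gen_sqr j : gen j *m gen j = 1%:M.
Proof.
have [h1 h2 h3] := pauli_sqr R.
rewrite /gen; case: ifP => _.
  rewrite tens1_mul spin_sqr; last by case: (odd j).
  exact: tens11.
by rewrite /spin_last tensmx_mul pow_sqr // h1 tens11.
Qed.

Lemma gen_anti_lt j k : (j < k)%N -> (k <= n.*2)%N ->
  gen k *m gen j = -1 *: (gen j *m gen k).
Proof.
have [a12 a31 a32] := pauli_anti R.
move=> jk kn.
have a3 (b : bool) : s3 *m (if b then s2 else s1) = -1 *: ((if b then s2 else s1) *m s3).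
  by case: b.
rewrite /gen (leq_trans jk kn); case: ifP => kn'.
  rewrite !tens1_mul -[-1 *: tens1 _]linearZ; congr tens1.
  (* Either j and k share a tensor position, and then carry sigma1 and sigma2 respectively, or the
     position of j comes earlier. *)
  have [e|lt] : (j./2 = k./2) \/ (j./2 < k./2)%N by lia.
    rewrite e; have [-> ->] : odd j = false /\ odd k = true by lia.
    by rewrite (spin_same _ a12) scalerA mulrNN mulr1 scale1r.
  by apply: spin_anti => //; rewrite !inordK //; lia.
rewrite /spin_last /tens1 !tensmx_mul mul1mx mulmx1 -tensZl; congr (_ *t _).
exact: pow_anti.
Qed.

Lemma gen_anti j k : (j <= n.*2)%N -> (k <= n.*2)%N -> j != k ->
  gen j *m gen k = - (gen k *m gen j).
Proof.
move=> jn kn; case: ltngtP => // jk _.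
  by rewrite (gen_anti_lt jk) // scaleN1r opprK.
by rewrite (gen_anti_lt jk) // scaleN1r.
Qed.

Lemma V_odd_span : V_odd R n = <<1%:M :: mkseq gen n.*2.+1>>%VS.
Proof.
apply/eqP; rewrite eqEsubv; apply/andP; split.
  rewrite /V_odd subv_add; apply/andP; split.
    rewrite limg_span; apply/span_subvP => A /mapP [B].
    rewrite inE mem_cat => /orP [/eqP -> ->|/orP [] /mapP [k _ ->] ->];
      rewrite lfunE /=; apply: memv_span.
    - by rewrite inE [tens1 _]tens11 eqxx.
    - rewrite inE; apply/orP; right; apply/mapP; exists k.*2.
        by rewrite mem_iota /=; have := ltn_ord k; lia.
      rewrite /gen ltn_double ltn_ord odd_double doubleK.
      by rewrite inord_val.
    - rewrite inE; apply/orP; right; apply/mapP; exists k.*2.+1.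
        by rewrite mem_iota /=; have := ltn_ord k; lia.
      rewrite /gen ltn_Sdouble ltn_ord /= odd_double /= uphalf_double.
      by rewrite inord_val.
  rewrite -memvE; apply: memv_span; rewrite inE; apply/orP; right.
  apply/mapP; exists n.*2; first by rewrite mem_iota /=; lia.
  by rewrite /gen ltnn.
apply/span_subvP => A; rewrite inE => /orP [/eqP ->|/mapP [j]].
  apply: (subvP (addvSl _ _)); rewrite -[1%:M](tens11 R (2 ^ n) 2).
  rewrite -[_ *t _]/(tens1 (1%:M : 'M[C]_(2 ^ n))) -lfunE.
  by apply: memv_img; apply: memv_span; rewrite inE eqxx.
rewrite mem_iota /= => jn ->; rewrite /gen; case: ifP => j2n.
  apply: (subvP (addvSl _ _)); rewrite -lfunE.
  apply: memv_img; apply: memv_span; rewrite inE; apply/orP; right.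
  rewrite mem_cat; apply/orP; case: (odd j); [right|left]; apply: map_f; exact: mem_enum.
by apply: (subvP (addvSr _ _)); exact: memv_line.
Qed.

Lemma V_odd_coords (v : 'M[C]_dim) : v \in V_odd R n ->
  exists al : nat -> C,
    v = al 0%N *: 1%:M + \sum_(j < n.*2.+1) al j.+1 *: gen j.
Proof.
rewrite V_odd_span => hv.
have sz : size (1%:M :: mkseq gen n.*2.+1) == n.*2.+2.
  by rewrite -[size _]/((size (mkseq gen n.*2.+1)).+1) size_mkseq.
pose T := Tuple sz.
have {}hv : v \in <<T>>%VS by [].
exists (fun i => coord T (inord i) v).
rewrite {1}(coord_span hv) big_ord_recl; congr (_ *: _ + _).
  by congr (coord T _ v); apply/val_inj; rewrite /= inordK.
apply: eq_bigr => j _.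
rewrite -[T`_(lift ord0 j)]/((mkseq gen n.*2.+1)`_j) nth_mkseq //; congr (_ *: _).
by congr (coord T _ v); apply/val_inj; rewrite [RHS]inordK // ltnS.
Qed.

Lemma gen_V_odd j : (j <= n.*2)%N -> gen j \in V_odd R n.
Proof.
move=> jn; rewrite V_odd_span; apply: memv_span; rewrite inE; apply/orP; right.
by apply/mapP; exists j => //; rewrite mem_iota.
Qed.

Lemma one_V_odd : (1%:M : 'M[C]_dim) \in V_odd R n.
Proof. by rewrite V_odd_span; apply: memv_span; rewrite inE eqxx. Qed.

(* Anticommutes with the central symmetry, whose two eigenspaces are therefore
   nonzero. *)
Definition flip : 'M[C]_dim := (1%:M : 'M[C]_(2 ^ n)) *t s2.

Lemma flip_gen j : (j <= n.*2)%N ->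
  flip *m gen j = (if j == n.*2 then - gen j else gen j) *m flip.
Proof.
move=> jn; rewrite /flip /gen; case: eqP => [->|/eqP jn'].
  rewrite ltnn /spin_last !tensmx_mul mulNmx tensmx_mul mul1mx mulmx1.
  have [a12 _ _] := pauli_anti R.
  by rewrite a12 tensZr scaleN1r opprK.
rewrite ltn_neqAle jn' jn /tens1 !tensmx_mul.
by rewrite !(mul1mx, mulmx1).
Qed.

Lemma flip_sqr : flip *m flip = 1%:M.
Proof. by have [_ h2 _] := pauli_sqr R; rewrite tensmx_mul h2 mulmx1 tens11. Qed.

End Generators.

(** * Matrices as operators on C^N *)

Section MatrixOperators.
Variable R : realType.
Local Notation C := R[i].
Variable N : nat.
Local Notation K := (Cn R N).

Definition op (A : 'M[C]_N) : K -> K := fun x => A *m (x : 'cV[C]_N).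

Lemma op_lin A : linear (op A).
Proof. by move=> a x y; exact: (linearP (@mulmx C N N 1 A)). Qed.

Lemma op_mul A B x : op A (op B x) = op (A *m B) x.
Proof. by rewrite /op mulmxA. Qed.

Lemma op1 x : op 1%:M x = x.
Proof. by rewrite /op mul1mx. Qed.

Definition adjmx (A : 'M[C]_N) : 'M[C]_N := \matrix_(i, j) Num.conj (A j i).

Lemma op_adj A : is_adjoint (op A) (op (adjmx A)).
Proof.
move=> x y; rewrite -[LHS]/(\sum_i (A *m (x : 'cV[C]_N)) i 0 * Num.conj ((y : 'cV[C]_N) i 0)).
rewrite -[RHS]/(\sum_i (x : 'cV[C]_N) i 0 * Num.conj ((adjmx A *m (y : 'cV[C]_N)) i 0)).
transitivity (\sum_i \sum_j A i j * (x : 'cV[C]_N) j 0 * Num.conj ((y : 'cV[C]_N) i 0)).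
  by apply: eq_bigr => i _; rewrite mxE mulr_suml.
rewrite exchange_big /=; apply: eq_bigr => j _.
rewrite mxE rmorph_sum mulr_sumr; apply: eq_bigr => i _.
by rewrite mxE rmorphM /= conjCK; ring.
Qed.

Lemma hermx_adjmx A : hermx A -> adjmx A = A.
Proof. by move=> hA; apply/matrixP => i j; rewrite mxE -hA. Qed.

Definition basis_vec (j : 'I_N) : K := delta_mx j 0 : 'cV[C]_N.

Lemma basis_sum (x : K) : x = \sum_j (x : 'cV[C]_N) j 0 *: basis_vec j.
Proof.
rewrite -[RHS]/(\sum_j (x : 'cV[C]_N) j 0 *: delta_mx j 0 : 'cV[C]_N).
apply/colP => i; rewrite summxE (bigD1 i) //= !mxE !eqxx mulr1.
by rewrite big1 ?addr0 // => k ki; rewrite !mxE eq_sym (negPf ki) mulr0.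
Qed.

Lemma linear_op (T : K -> K) : linear T ->
  forall x, T x = op (\matrix_(i, j) (T (basis_vec j) : 'cV[C]_N) i 0) x.
Proof.
move=> linT x; rewrite {1}[x]basis_sum (linear_fun_sum linT).
apply/colP => i; rewrite mxE.
rewrite -[LHS]/((\sum_j T ((x : 'cV[C]_N) j 0 *: basis_vec j) : 'cV[C]_N) i 0).
rewrite summxE; apply: eq_bigr => j _.
by rewrite (linear_funZ linT) !mxE mulrC.
Qed.

Lemma qK (x : K) : q x = \sum_i nsq ((x : 'cV[C]_N) i 0).
Proof.
apply: complexI; rewrite -ipxx rmorph_sum.
rewrite -[LHS]/(\sum_i (x : 'cV[C]_N) i 0 * Num.conj ((x : 'cV[C]_N) i 0)).
by apply: eq_bigr => i _; rewrite nsqE.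
Qed.

Lemma linear_Cn_bnd (T : K -> K) : linear T -> exists2 k, 0 <= k & op_bnd T k.
Proof.
move=> linT; exists (N%:R * \sum_j q (T (basis_vec j))).
  by rewrite mulr_ge0 // sumr_ge0.
move=> x; rewrite {1}[x]basis_sum (linear_fun_sum linT).
apply: le_trans (q_sum_le _ _) _; rewrite card_ord -mulrA ler_wpM2l //.
rewrite mulr_suml; apply: ler_sum => j _.
rewrite (linear_funZ linT) qZ -/(nsq _) mulrC ler_wpM2l // qK.
by rewrite (bigD1 j) //= lerDl sumr_ge0 // => i _; exact: nsq_ge0.
Qed.

Lemma mx_opnormE A : mx_opnorm A = opnorm (op A).
Proof.
have le1 (x : K) : (`|x| <= 1) = (l2norm (fun i => (x : 'cV[C]_N) i 0) <= 1).
  by rewrite cspace_normE -lecR.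
congr sup; apply/seteqP; split => _ [x /= x1 <-]; exists x => //=.
- by rewrite le1.
- by rewrite -le1.
Qed.

(** A subspace is the kernel of g = id - projection, and the entries of g(X) are bounded by a
    constant times the largest entry of X. An element of the closure therefore has g = 0. *)
Lemma op_range_closed (W : {vspace 'M[C]_N}) :
  norm_closed [set T : K -> K | exists2 A, A \in W & forall x, T x = op A x].
Proof.
move=> T [linT _] happrox /=.
pose M := \matrix_(i, j) (T (basis_vec j) : 'cV[C]_N) i 0.
exists M; last exact: linear_op.
pose g (X : 'M[C]_N) := X - projv W X.
have gW X : X \in W -> g X = 0 by move=> XW; rewrite /g projv_id // subrr.
have linG : linear g.
  by move=> a X Y; rewrite /g linearP /= scalerBr opprD addrACA.
suff g0 : g M = 0.
  by move/eqP: g0; rewrite /g subr_eq0 => /eqP ->; exact: memv_proj.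
apply/matrixP => i j; rewrite [RHS]mxE; apply/eqP; rewrite -normr_eq0.
apply: contrapT => /negP gn0.
pose c := complex.Re `|g M i j|.
have c0 : 0 < c by rewrite -ltcR /c -normC_Re lt_def gn0 normr_ge0.
pose G := \sum_k \sum_l complex.Re `|g (delta_mx k l) i j|.
have G0 : 0 <= G by rewrite !sumr_ge0 // => k _; rewrite sumr_ge0 // => l _; exact: Re_norm_ge0.
(* Chosen so that eps G < c, also when G = 0. *)
pose eps := c / (G + 1).
have e0 : 0 < eps by rewrite divr_gt0 // ltr_wpDl.
have [T0 [A AW TA] hT0] := happrox eps e0.
have bD : bounded_op (T - T0).
  have linD : linear (T - T0).
    move=> a x y; rewrite -[LHS]/(T (a *: x + y) - T0 (a *: x + y)) !TA linT op_lin.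
    rewrite -[(T - T0) x]/(T x - T0 x) -[(T - T0) y]/(T y - T0 y) !TA scalerBr.
    by rewrite opprD addrACA.
  have [k k0 hk] := linear_Cn_bnd linD.
  exact: bnd_bounded_op linD hk.
have hent k l : complex.Re `|(M - A) k l| <= eps.
  have := le_trans (lexx _) (ltW hT0).
  rewrite -[eps](ger0_norm (ltW e0)) -sqrtr_sqr => /(opnorm_leP bD (sqr_ge0 _)) => /(_ (basis_vec l)).
  have -> : (T - T0) (basis_vec l) = col l (M - A).
    rewrite -[LHS]/(T (basis_vec l) - T0 (basis_vec l)) TA (linear_op linT).
    rewrite -/M /op -mulmxBl; apply/colP => r; rewrite !mxE (bigD1 l) //= !mxE !eqxx mulr1.
    by rewrite big1 ?addr0 // => s sl; rewrite !mxE (negPf sl) mulr0.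
  have -> : q (basis_vec l) = 1.
    rewrite qK (bigD1 l) //= big1 => [|s sl]; rewrite /basis_vec !mxE ?eqxx ?(negPf sl) /nsq /=.
      by rewrite expr1n expr0n !addr0.
    by rewrite expr0n addr0.
  rewrite mulr1 => h.
  rewrite -[X in X <= _]ger0_norm ?Re_norm_ge0 // -sqrtr_sqr ler_sqrt ?sqr_ge0 //.
  have -> : complex.Re `|(M - A) k l| ^+ 2 = nsq ((M - A) k l).
    by apply: complexI; rewrite rmorphXn /= -normC_Re normCK; exact: nsqE.
  apply: le_trans h; rewrite qK (bigD1 k) //= [col l (M - A) k 0]mxE.
  by rewrite lerDl sumr_ge0 // => r _; exact: nsq_ge0.
have : c <= eps * G.
  have -> : c = complex.Re `|g (M - A) i j| by rewrite (linear_funB linG) (gW A) // subr0.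
  have -> : g (M - A) i j = \sum_k \sum_l (M - A) k l * g (delta_mx k l) i j.
    rewrite {1}[M - A]matrix_sum_delta (linear_fun_sum linG) summxE.
    apply: eq_bigr => k _; rewrite (linear_fun_sum linG) summxE.
    by apply: eq_bigr => l _; rewrite (linear_funZ linG) mxE.
  rewrite -lecR -normC_Re mulr_sumr rmorph_sum /=.
  apply: le_trans (ler_norm_sum _ _ _) _; apply: ler_sum => k _.
  rewrite mulr_sumr rmorph_sum /=.
  apply: le_trans (ler_norm_sum _ _ _) _; apply: ler_sum => l _.
  rewrite normrM rmorphM /= normC_Re [X in _ * X]normC_Re ler_wpM2r //.
    by rewrite ler0c Re_norm_ge0.
  by rewrite lecR.
rewrite /eps mulrAC ler_pdivlMr ?ltr_wpDl // => h.
have : c * G < c * (G + 1) by rewrite ltr_pM2l // ltrDl.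
by rewrite ltNge h.
Qed.

End MatrixOperators.

(** * Its representations *)

Section Twist.
Variable R : realType.
Local Notation C := R[i].

(** The effect on coordinates of replacing every s_j by - s_j. *)
Definition twist (al : nat -> C) (j : nat) : C :=
  if j is 0%N then al 0%N else - al j.

Lemma twistK al : twist (twist al) =1 al.
Proof. by case=> [//|j] /=; rewrite opprK. Qed.

(** The real and imaginary parts give two real equations in three real unknowns. *)
Lemma real_orthogonal (a : 'I_3 -> C) : exists w : 'I_3 -> R,
  \sum_i (w i)%:C * a i = 0 /\ \sum_i w i ^+ 2 = 1.
Proof.
pose M : 'M[R]_(3, 2) := \matrix_(i, j) if j == 0 then complex.Re (a i) else complex.Im (a i).
have kerM : kermx M != 0.
  rewrite -mxrank_eq0 mxrank_ker -lt0n subn_gt0.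
  exact: leq_ltn_trans (rank_leq_col M) _.
have /rowV0Pn [v vM v0] := kerM.
have {}vM : v *m M = 0 by apply/sub_kermxP.
pose s := \sum_i v 0 i ^+ 2.
have s0 : 0 < s.
  rewrite lt_def sumr_ge0 ?andbT => [|i _]; last exact: sqr_ge0.
  apply: contra v0; rewrite /s psumr_eq0 => [|i _]; last exact: sqr_ge0.
  move=> /allP h; apply/eqP/rowP => i; rewrite mxE.
  by have := h i; rewrite mem_index_enum sqrf_eq0 => /(_ isT) /eqP.
exists (fun i => v 0 i / Num.sqrt s); split.
  have h0 : \sum_i v 0 i * complex.Re (a i) = 0.
    have /rowP /(_ 0) := vM; rewrite !mxE => h; rewrite -[RHS]h.
    by apply: eq_bigr => i _; rewrite !mxE.
  have h1 : \sum_i v 0 i * complex.Im (a i) = 0.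
    have /rowP /(_ 1) := vM; rewrite !mxE => h; rewrite -[RHS]h.
    by apply: eq_bigr => i _; rewrite !mxE.
  have -> : \sum_i (v 0 i / Num.sqrt s)%:C * a i = (Num.sqrt s)^-1%:C *
     ((\sum_i v 0 i * complex.Re (a i))%:C + 'i%C * (\sum_i v 0 i * complex.Im (a i))%:C).
    rewrite !rmorph_sum mulr_sumr -big_split mulr_sumr /=.
    apply: eq_bigr => i _; rewrite {1}[a i]complexE !rmorphM /=; ring.
  by rewrite h0 h1 mulr0 addr0 mulr0.
under eq_bigr do rewrite expr_div_n.
by rewrite -mulr_suml -/s sqr_sqrtr ?ltW // divff // gt_eqF.
Qed.

Lemma clop_opp (H : hilbert R) n (Q : H -> H) S al x :
  clop n Q (fun j y => - S j y) al x = clop n Q S (twist al) x.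
Proof.
by rewrite /clop; congr (_ + _); apply: eq_bigr => j _; rewrite scalerN scaleNr.
Qed.

Lemma clop_twistE (H : hilbert R) n (Q : H -> H) S al x :
  clop n Q S (twist al) x =
  al 0%N *: Q x - \sum_(j < n.*2.+1) al j.+1 *: S j x.
Proof.
by rewrite /clop -sumrN; congr (_ + _); apply: eq_bigr => j _; rewrite scaleNr.
Qed.

Variables (H : hilbert R) (n : nat) (Q : H -> H) (S : nat -> H -> H).
Hypotheses (cS : clifford n Q S) (n0 : (1 <= n)%N).

(* A real unit vector w orthogonal to the vector part of al gives the unitary
   sum_i w_i S_i, which conjugates the operator with coordinates al into the
   one with coordinates twist al. *)
Lemma clop_twist_bnd al k : 0 <= k ->
  op_bnd (clop n Q S (twist al)) k -> op_bnd (clop n Q S al) k.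
Proof.
move=> k0 hk.
have [w [wa w1]] := real_orthogonal (fun i => al i.+1).
have i3 (i : 'I_3) : (i <= n.*2)%N by have := ltn_ord i; lia.
pose W x := \sum_i (w i)%:C *: S i x.
have linS j : (j <= n.*2)%N -> linear (S j) := fun jn => cl_lin cS jn.
have linW : linear W.
  move=> a x y; rewrite /W scaler_sumr -big_split; apply: eq_bigr => i _ /=.
  by rewrite linS // scalerDr !scalerA mulrC.
have adjW : is_adjoint W W.
  move=> x y; rewrite /W ip_suml ip_sumr; apply: eq_bigr => i _.
  by rewrite ipZl ipZr conjR (cl_adj cS).
have WW x : W (W x) = Q x.
  (* The double sum is added to its transpose: off the diagonal the anticommuting terms cancel, and
     the diagonal adds up to 2 Q x because w has length 1. *)
  pose f i j := ((w i * w j)%:C *: S i (S j x)).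
  have E : W (W x) = \sum_i \sum_j f i j.
    apply: eq_bigr => i _; rewrite (linear_fun_sum (linS i (i3 i))) scaler_sumr.
    by apply: eq_bigr => j _; rewrite (linear_funZ (linS i (i3 i))) scalerA -rmorphM.
  have fsym i j : f i j + f j i = if i == j then (w i ^+ 2)%:C *: (Q x + Q x) else 0.
    rewrite /f; case: eqP => [->|/eqP ij].
      by rewrite -scalerDr (cl_sqr cS) // -expr2.
    rewrite [w j * w i]mulrC -scalerDr (cl_anti cS (i3 i) (i3 j)) ?addNr ?scaler0 //.
  have : W (W x) + W (W x) = Q x + Q x.
    rewrite {1}E E [X in _ + X]exchange_big -big_split /=.
    transitivity (\sum_i (w i ^+ 2)%:C *: (Q x + Q x)).
      apply: eq_bigr => i _; rewrite -big_split /= (bigD1 i) //= fsym eqxx.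
      by rewrite big1 ?addr0 // => j ji; rewrite fsym eq_sym (negPf ji).
    by rewrite -scaler_suml -rmorph_sum w1 scale1r.
  by move=> h; rewrite -[LHS]half_twice h half_twice.
have WQ x : W (Q x) = W x.
  by rewrite /W; apply: eq_bigr => i _; rewrite (cl_SQ cS).
have QW x : Q (W x) = W x.
  rewrite /W (linear_fun_sum (cl_linQ cS)); apply: eq_bigr => i _.
  by rewrite (linear_funZ (cl_linQ cS)) (cl_QS cS).
pose V x := \sum_(j < n.*2.+1) al j.+1 *: S j x.
have j2 (j : 'I_n.*2.+1) : (j <= n.*2)%N by rewrite -ltnS.
have WV x : V (W x) = - W (V x).
  apply/eqP; rewrite -addr_eq0; apply/eqP.
  transitivity (\sum_(i < 3) \sum_(j < n.*2.+1) ((w i)%:C * al j.+1) *: (S i (S j x) + S j (S i x))).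
    have -> : V (W x) = \sum_(i < 3) \sum_(j < n.*2.+1) ((w i)%:C * al j.+1) *: S j (S i x).
      rewrite exchange_big; apply: eq_bigr => j _ /=.
      rewrite (linear_fun_sum (linS _ (j2 j))) scaler_sumr; apply: eq_bigr => i _.
      by rewrite (linear_funZ (linS _ (j2 j))) scalerA mulrC.
    have -> : W (V x) = \sum_(i < 3) \sum_(j < n.*2.+1) ((w i)%:C * al j.+1) *: S i (S j x).
      apply: eq_bigr => i _; rewrite (linear_fun_sum (linS _ (i3 i))) scaler_sumr.
      by apply: eq_bigr => j _; rewrite (linear_funZ (linS _ (i3 i))) scalerA.
    rewrite -big_split; apply: eq_bigr => i _; rewrite -big_split; apply: eq_bigr => j _ /=.
    by rewrite addrC -scalerDr.
  transitivity ((\sum_(i < 3) (w i)%:C * al i.+1) *: (Q x + Q x)); last first.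
    by rewrite wa scale0r.
  rewrite scaler_suml; apply: eq_bigr => i _.
  have hi : (i < n.*2.+1)%N by rewrite ltnS.
  rewrite (bigD1 (Ordinal hi)) //= (cl_sqr cS) // big1 ?addr0 // => j ji.
  have ij : nat_of_ord i != j.
    by apply: contra ji => /eqP e; apply/eqP/val_inj.
  by rewrite (cl_anti cS (i3 i) (j2 j) ij) addNr scaler0.
have key x : clop n Q S al x = W (clop n Q S (twist al) (W x)).
  rewrite clop_twistE (linear_funB linW) (linear_funZ linW) QW WW.
  rewrite -/(V (W x)) WV (linear_funN linW) WW opprK.
  rewrite /clop; congr (_ + _); rewrite (linear_fun_sum (cl_linQ cS)).
  by apply: eq_bigr => j _; rewrite (linear_funZ (cl_linQ cS)) (cl_QS cS).
have qW x : q (W x) <= q x.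
  have -> : q (W x) = q (Q x).
    by rewrite /q adjW WW (cl_adjQ cS) (cl_idQ cS).
  exact: (q_proj_le (cl_linQ cS) (cl_adjQ cS) (cl_idQ cS)).
move=> x; rewrite key; apply: le_trans (qW _) _.
by apply: le_trans (hk _) _; rewrite ler_wpM2l.
Qed.

End Twist.

Section SpinRepresentations.
Variables (R : realType) (m : nat).
Local Notation C := R[i].
Local Notation n := m.+1.
Local Notation dim := (2 ^ n * 2)%N.
Local Notation K := (Cn R dim).
Local Notation V := (V_odd R n).
Local Notation E := (subvs_of V).
Local Notation g := (fun j => op (gen R m j)).

Lemma clifford_gen : clifford n idfun g.
Proof.
split => //.
- by move=> j _; exact: op_lin.
- by move=> j _ x y; rewrite op_adj hermx_adjmx //; exact: gen_herm.
- by move=> j _ x; rewrite op_mul gen_sqr op1.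
- move=> j k jn kn jk x; rewrite !op_mul gen_anti //.
  by rewrite /op mulNmx.
Qed.

Let Z := zop n g.

(* None selects the whole space and Some b an eigenspace of the central
   symmetry Z. *)
Definition part (c : option bool) : K -> K :=
  if c is Some b then zpart b idfun Z else idfun.

Lemma clifford_part c : clifford n (part c) (fun j x => g j (part c x)).
Proof. by case: c => [b|]; [exact: clifford_zpart clifford_gen b|exact: clifford_gen]. Qed.

Lemma part_lin c : linear (part c).
Proof. exact: cl_linQ (clifford_part c). Qed.

Lemma part_adj c : is_adjoint (part c) (part c).
Proof. exact: cl_adjQ (clifford_part c). Qed.

Lemma part_id c x : part c (part c x) = part c x.
Proof. exact: cl_idQ (clifford_part c) x. Qed.

Lemma part_gen c j x : (j <= n.*2)%N -> part c (g j x) = g j (part c x).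
Proof. by move=> jn; case: c => [b|//]; exact: zpart_S clifford_gen b j jn x. Qed.

Lemma op_sum k (F : 'I_k -> 'M[C]_dim) x : op (\sum_j F j) x = \sum_j op (F j) x.
Proof.
rewrite /op -[RHS]/(\sum_j F j *m (x : 'cV[C]_dim) : 'cV[C]_dim).
by rewrite mulmx_suml.
Qed.

Lemma opZ a (A : 'M[C]_dim) x : op (a *: A) x = a *: op A x.
Proof. by rewrite /op -scalemxAl. Qed.

Lemma opD (A B : 'M[C]_dim) x : op (A + B) x = op A x + op B x.
Proof. by rewrite /op mulmxDl. Qed.

Lemma op_coords (al : nat -> C) x :
  op (al 0%N *: 1%:M + \sum_(j < n.*2.+1) al j.+1 *: gen R m j) x =
  clop n idfun g al x.
Proof.
rewrite opD opZ op1 op_sum /clop; congr (_ + _).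
by apply: eq_bigr => j _; rewrite opZ.
Qed.

Lemma part_op c (v : 'M[C]_dim) x : v \in V -> part c (op v x) = op v (part c x).
Proof.
move=> /V_odd_coords [al ->]; rewrite !op_coords /clop.
rewrite (linear_funD (part_lin c)) (linear_funZ (part_lin c)).
rewrite (linear_fun_sum (part_lin c)); congr (_ + _).
apply: eq_bigr => j _; rewrite (linear_funZ (part_lin c)) part_gen //.
by rewrite -ltnS.
Qed.

Definition rep (c : option bool) (v : E) (x : K) : K := op (vsval v) (part c x).

Lemma rep_is_linear c : linear (rep c).
Proof.
move=> a v w; apply/funext => x.
rewrite -[RHS]/(a *: rep c v x + rep c w x) /rep linearP.
by rewrite opD opZ.
Qed.
HB.instance Definition _ c :=
  GRing.isLinear.Build C E (K -> K) _ (rep c) (rep_is_linear c).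

Definition elt (j : nat) : E :=
  if j is j'.+1 then vsproj V (gen R m j') else vsproj V 1%:M.

Definition has_coords (v : E) (al : nat -> C) : Prop :=
  v = al 0%N *: elt 0 + \sum_(j < n.*2.+1) al j.+1 *: elt j.+1.

Lemma vsval_coords v al : has_coords v al ->
  vsval v = al 0%N *: 1%:M + \sum_(j < n.*2.+1) al j.+1 *: gen R m j.
Proof.
move=> ->; rewrite linearD linearZ linear_sum /= vsprojK ?one_V_odd //.
congr (_ + _); apply: eq_bigr => j _.
by rewrite vsprojK // gen_V_odd // -ltnS.
Qed.

Lemma coords_ex v : exists al, has_coords v al.
Proof.
have [al h] := V_odd_coords (subvsP v); exists al.
by apply: val_inj; rewrite [LHS]h; apply/esym; exact: vsval_coords.
Qed.

Lemma rep_clop c v al x : has_coords v al ->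
  rep c v x = clop n (part c) (fun j y => g j (part c y)) al x.
Proof. by move=> h; rewrite /rep (vsval_coords h) op_coords. Qed.

Lemma rep_bounded c v : bounded_op (rep c v).
Proof.
have linr : linear (rep c v).
  by move=> a x y; rewrite /rep part_lin op_lin.
by have [k k0 hk] := linear_Cn_bnd linr; exact: bnd_bounded_op linr hk.
Qed.

Definition repn (c : option bool) : matrix_norms E :=
  fun k A => amp_opnorm (fun i j => rep c (A i j)).

Lemma amp_coords k (A : 'M[E]_k) : exists al : 'I_k -> 'I_k -> nat -> C,
  forall i j, has_coords (A i j) (al i j).
Proof.
have /choice [f hf] : forall p : 'I_k * 'I_k, exists al, has_coords (A p.1 p.2) al.
  by move=> p; exact: coords_ex.
by exists (fun i j => f (i, j)) => i j; exact: hf (i, j).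
Qed.

Lemma amp_bnd_ext (H : hilbert R) k (T T' : 'I_k -> 'I_k -> H -> H) r :
  (forall i j x, T i j x = T' i j x) -> amp_bnd T r -> amp_bnd T' r.
Proof.
by move=> h hT x; have := hT x; under eq_bigr do under eq_bigr do rewrite h.
Qed.

Lemma rep_amp_bnd c k (A : 'M[E]_k) al r : (forall i j, has_coords (A i j) (al i j)) ->
  amp_bnd (fun i j => rep c (A i j)) r <->
  amp_bnd (fun i j => clop n (part c) (fun j x => g j (part c x)) (al i j)) r.
Proof. by move=> h; split; apply: amp_bnd_ext => i j x; rewrite (rep_clop _ _ (h i j)). Qed.

Lemma zop_part b x :
  zop n (fun j y => g j (part (Some b) y)) x = (-1) ^+ b *: part (Some b) x.
Proof. exact: zop_zpart clifford_gen b x. Qed.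

Lemma K_nonzero : exists v : K, v != 0.
Proof.
have d0 : (0 < dim)%N by rewrite muln_gt0 expn_gt0.
exists (basis_vec R (Ordinal d0)); apply/eqP => /colP /(_ (Ordinal d0)).
by rewrite !mxE eqxx => /eqP; rewrite oner_eq0.
Qed.

(** If an eigenprojection vanished, Z would be a scalar 1 or -1 and commute with [flip]; it
    anticommutes with it, and [flip] is invertible. *)
Lemma part_nonzero c : exists w, part c w != 0.
Proof.
have [v v0] := K_nonzero; case: c => [b|]; last by exists v.
apply: contrapT => h.
have P0 x : zpart b idfun Z x = 0.
  by apply/eqP; apply: contrapT => /negP hx; apply: h; exists x.
have Zx x : Z x = - (-1) ^+ b *: x.
  have := P0 x; rewrite /zpart => /eqP; rewrite scaler_eq0 invr_eq0 pnatr_eq0 /=.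
  rewrite addr_eq0 => /eqP h1; rewrite [in RHS]h1 scaleNr scalerN opprK scalerA.
  by rewrite -signr_addb addbb scale1r.
have Zflip x : op (flip R m) (Z x) = - Z (op (flip R m) x).
  rewrite -(zop_opp_last clifford_gen).
  apply: (zop_intertwine (@op_lin R dim _)) => j jn y.
  by rewrite op_mul flip_gen //; case: ifP => _; rewrite -op_mul // /op mulNmx.
have F0 x : op (flip R m) x = 0.
  have := Zflip x; rewrite !Zx (linear_funZ (@op_lin R dim _)) scaleNr opprK.
  set y := op _ x => /eqP; rewrite -subr_eq0 -opprD oppr_eq0 -scalerDr.
  rewrite scaler_eq0 signr_eq0 /= => /eqP h1.
  by rewrite -[y]half_twice h1 scaler0.
by move/eqP: v0; apply; rewrite -[v]op1 -(flip_sqr R m) -op_mul F0.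
Qed.

(** With all generators negated, the eigenspace [b] carries a system whose product has the other
    eigenvalue. By [clifford_amp_bnd] it has the same bounds as the eigenspace [~~ b]. *)
Lemma clop_part_twist b k (al : 'I_k -> 'I_k -> nat -> C) r : 0 <= r ->
  amp_bnd (fun i j => clop n (part (Some b)) (fun j x => g j (part (Some b) x)) (twist (al i j))) r <->
  amp_bnd (fun i j => clop n (part (Some (~~ b))) (fun j x => g j (part (Some (~~ b)) x)) (al i j)) r.
Proof.
move=> r0.
have z1 x : zop n (fun j y => - g j (part (Some b) y)) x = (-1) ^+ (~~ b) *: part (Some b) x.
  rewrite (zop_opp (clifford_part (Some b))) zop_part -scaleNr; congr (_ *: _).
  by case: b; rewrite ?expr0 ?expr1 ?opprK.
have h := clifford_amp_bnd al (clifford_opp (clifford_part (Some b)))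
  (clifford_part (Some (~~ b))) z1 (zop_part (~~ b)) (part_nonzero _) (part_nonzero _) r0.
split=> h1.
  refine (h.1 _); refine (amp_bnd_ext _ h1) => i j x; symmetry; exact: clop_opp.
refine (amp_bnd_ext _ (h.2 h1)) => i j x; exact: clop_opp.
Qed.

Lemma rep_bnd_parts k (A : 'M[E]_k) r : 0 <= r ->
  amp_bnd (fun i j => rep None (A i j)) r <->
  forall b, amp_bnd (fun i j => rep (Some b) (A i j)) r.
Proof.
move=> r0; have [al hal] := amp_coords A.
have h0 := rep_amp_bnd None r hal; have h1 b := rep_amp_bnd (Some b) r hal.
have hp := clifford_amp_bnd_parts al clifford_gen r0.
split=> [h b|h]; first exact: ((h1 b).2 (hp.1 (h0.1 h) b)).
exact: (h0.2 (hp.2 (fun b => (h1 b).1 (h b)))).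
Qed.

Lemma amp1_coords (v : E) al : has_coords v al ->
  forall i j : 'I_1, has_coords ((const_mx v : 'M[E]_1) i j) al.
Proof. by move=> h i j; rewrite mxE. Qed.

(** A bound on one eigenspace is a bound on the other: [clop_part_twist] exchanges the eigenspaces
    at the price of twisting the coordinates, and for a single element [clop_twist_bnd] undoes the
    twist. Bounds on both eigenspaces give one on the whole space. *)
Lemma opnorm_rep c v : opnorm (rep c v) = V_odd_norm v.
Proof.
have -> : V_odd_norm v = opnorm (rep None v) by rewrite /V_odd_norm mx_opnormE.
case: c => [b|//].
have [al hal] := coords_ex v.
pose T c' r := op_bnd (clop n (part c') (fun j x => g j (part c' x)) al) r.
have TE c' r : amp_bnd (fun i j => rep c' ((const_mx v : 'M[E]_1) i j)) r <-> T c' r.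
  rewrite (rep_amp_bnd c' r (amp1_coords hal)).
  by split=> [h|h]; apply/op_bnd_amp.
have repE c' r : amp_bnd (fun _ _ : 'I_1 => rep c' v) r <-> T c' r.
  rewrite -TE; split; apply: amp_bnd_ext => i j x; by rewrite mxE.
have swap b' r : 0 <= r -> T (Some b') r -> T (Some (~~ b')) r.
  move=> r0 h.
  suff : op_bnd (clop n (part (Some b')) (fun j x => g j (part (Some b') x)) (twist al)) r.
    move/op_bnd_amp => /(clop_part_twist b' (fun _ _ : 'I_1 => al) r0) h1.
    exact/op_bnd_amp.
  apply: (clop_twist_bnd (clifford_part (Some b'))) => //.
  move=> x; rewrite (_ : clop _ _ _ _ x = clop n (part (Some b')) (fun j x => g j (part (Some b') x)) al x) //.
  by rewrite /clop; congr (_ *: _ + _); apply: eq_bigr => j _; rewrite twistK.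
rewrite !opnorm_amp; apply: amp_opnorm_eq.
- by move=> i j; case: (rep_bounded (Some b) v).
- by move=> i j; case: (rep_bounded None v).
- by apply: amp_bnd_ex => i j; exact: bounded_op_bnd (rep_bounded _ _).
move=> r r0; rewrite !repE.
have hN := rep_bnd_parts (const_mx v : 'M[E]_1) r0.
split=> h; last exact: ((TE _ _).1 (hN.1 ((TE _ _).2 h) b)).
refine ((TE _ _).1 (hN.2 _)) => b'; refine ((TE _ _).2 _).
have [->//|bb] := eqVneq b' b.
have -> : b' = ~~ b by case: b' b bb {h} => [] [].
exact: swap.
Qed.

End SpinRepresentations.

(** * Closure under the triple product *)

Section JordanClosure.
Variables (R : realType) (m : nat).
Local Notation C := R[i].
Local Notation n := m.+1.
Local Notation dim := (2 ^ n * 2)%N.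
Local Notation K := (Cn R dim).
Local Notation V := (V_odd R n).
Local Notation E := (subvs_of V).

(* The spin factor is the complex span of unitaries e_p that satisfy
   e_p e_q^* + e_q e_p^* = 2 delta_pq = e_p^* e_q + e_q^* e_p. *)
Definition spin_unit (p : nat) : 'M[C]_dim :=
  if p is j.+1 then 'i%C *: gen R m j else 1%:M.
Definition spin_unit_adj (p : nat) : 'M[C]_dim :=
  if p is j.+1 then - 'i%C *: gen R m j else 1%:M.
Local Notation e := spin_unit.
Local Notation e' := spin_unit_adj.
Local Notation d p q := (if p == q :> nat then 2 else 0 : C).

Lemma adjmx_spin_unit p : adjmx (e p) = e' p.
Proof.
case: p => [|j] /=; first by apply: hermx_adjmx; exact: hermx1.
apply/matrixP => k l; rewrite !mxE rmorphM /= -gen_herm; congr (_ * _).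
by apply/eqP; rewrite eq_complex /= oppr0 !eqxx.
Qed.

Let gen_gen j k : (j <= n.*2)%N -> (k <= n.*2)%N ->
  gen R m j *m gen R m k + gen R m k *m gen R m j = d j k *: 1%:M.
Proof.
move=> jn kn; case: eqP => [->|/eqP jk].
  by rewrite gen_sqr scaler_nat mulr2n.
by rewrite gen_anti // addNr scale0r.
Qed.

Lemma spin_unit_rel p q : (p <= n.*2.+1)%N -> (q <= n.*2.+1)%N ->
  e p *m e' q + e q *m e' p = d p q *: 1%:M /\
  e' p *m e q + e' q *m e p = d p q *: 1%:M.
Proof.
case: p q => [|p] [|q] pn qn /=.
- by rewrite mulmx1 scaler_nat mulr2n.
- by rewrite !mul1mx !mulmx1 -!scalerDl addNr addrN !scale0r.
- by rewrite !mul1mx !mulmx1 -!scalerDl addNr addrN !scale0r.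
rewrite eqSS -(gen_gen pn qn) -!scalemxAl -!scalemxAr !scalerA.
by rewrite mulrN mulNr -expr2 sqr_i opprK !scale1r.
Qed.

(** Exchanging first p and q, then p and r, turns e_p e_q^* e_r into scalar multiples of units plus
    e_q e_r^* e_p; the latter combines with e_r e_q^* e_p by the relation between q and r. *)
Lemma spin_unit_triple p q r :
  (p <= n.*2.+1)%N -> (q <= n.*2.+1)%N -> (r <= n.*2.+1)%N ->
  e p *m e' q *m e r + e r *m e' q *m e p =
  d p q *: e r - d p r *: e q + d q r *: e p.
Proof.
move=> pn qn rn.
have [h1 _] := spin_unit_rel pn qn; have [_ h2] := spin_unit_rel pn rn.
have [h3 _] := spin_unit_rel qn rn.
have -> : e p *m e' q = d p q *: 1%:M - e q *m e' p by rewrite -h1 addrK.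
rewrite mulmxBl -scalemxAl mul1mx -[e q *m e' p *m e r]mulmxA.
have -> : e' p *m e r = d p r *: 1%:M - e' r *m e p by rewrite -h2 addrK.
rewrite mulmxBr -scalemxAr mulmx1 opprB addrA -!addrA; congr (_ + _).
rewrite addrCA; congr (_ + _).
by rewrite mulmxA -mulmxDl h3 -scalemxAl mul1mx.
Qed.

Lemma spin_unit_in p : (p <= n.*2.+1)%N -> e p \in V.
Proof.
case: p => [|j] jn /=; first exact: one_V_odd.
by rewrite rpredZ // gen_V_odd.
Qed.

Lemma spin_unit_coords v : v \in V -> exists a : nat -> C,
  v = \sum_(p < n.*2.+2) a p *: e p.
Proof.
move=> /V_odd_coords [al ->].
exists (fun p => if p is j.+1 then - 'i%C * al j.+1 else al 0%N).
rewrite [RHS]big_ord_recl; congr (_ + _); apply: eq_bigr => j _.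
by rewrite /= scalerA mulrAC mulNr -expr2 sqr_i opprK mul1r.
Qed.

Lemma jordan_closed A B D : A \in V -> B \in V -> D \in V ->
  A *m adjmx B *m D + D *m adjmx B *m A \in V.
Proof.
move=> /spin_unit_coords [a ->] /spin_unit_coords [b ->] /spin_unit_coords [c ->].
have adjB : adjmx (\sum_(p < n.*2.+2) b p *: e p) =
    \sum_(p < n.*2.+2) Num.conj (b p) *: e' p.
  apply/matrixP => i j; rewrite !mxE !summxE rmorph_sum; apply: eq_bigr => p _.
  by rewrite !mxE rmorphM -adjmx_spin_unit mxE.
rewrite adjB.
have expand (x y z : nat -> C) (f h k : nat -> 'M[C]_dim) :
    (\sum_(p < n.*2.+2) x p *: f p) *m (\sum_(p < n.*2.+2) y p *: h p) *m
    (\sum_(p < n.*2.+2) z p *: k p) =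
    \sum_(p < n.*2.+2) \sum_(q < n.*2.+2) \sum_(r < n.*2.+2)
      (x p * y q * z r) *: (f p *m h q *m k r).
  rewrite !mulmx_suml; apply: eq_bigr => p _.
  rewrite [X in X *m _]mulmx_sumr mulmx_suml; apply: eq_bigr => q _.
  rewrite mulmx_sumr; apply: eq_bigr => r _.
  by rewrite -!scalemxAl -!scalemxAr -scalemxAl !scalerA; congr (_ *: _); ring.
rewrite (expand a (fun q => Num.conj (b q)) c) (expand c (fun q => Num.conj (b q)) a).
have -> : \sum_(p < n.*2.+2) \sum_(q < n.*2.+2) \sum_(r < n.*2.+2)
      (c p * Num.conj (b q) * a r) *: (e p *m e' q *m e r) =
   \sum_(p < n.*2.+2) \sum_(q < n.*2.+2) \sum_(r < n.*2.+2)
      (a p * Num.conj (b q) * c r) *: (e r *m e' q *m e p).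
  rewrite exchange_big [RHS]exchange_big; apply: eq_bigr => q _ /=.
  rewrite exchange_big; apply: eq_bigr => p _; apply: eq_bigr => r _ /=.
  by congr (_ *: _); ring.
rewrite -big_split; apply: rpred_sum => p _ /=.
rewrite -big_split; apply: rpred_sum => q _ /=.
rewrite -big_split; apply: rpred_sum => r _ /=.
rewrite -scalerDr rpredZ // spin_unit_triple -1?ltnS //.
by rewrite rpredD ?rpredB // rpredZ // spin_unit_in // -ltnS.
Qed.

Lemma rep_triple c (a b d : E) : exists b',
  [/\ bounded_op b', is_adjoint (rep c b) b' &
      range (@rep R m c) (triple (rep c a) b' (rep c d))].
Proof.
pose b' x := part c (op (adjmx (vsval b)) x).
have linb : linear b' by move=> k x y; rewrite /b' op_lin part_lin.
exists b'; split.
- by have [k k0 hk] := linear_Cn_bnd linb; exact: bnd_bounded_op linb hk.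
- by move=> x y; rewrite /rep op_adj part_adj.
have [h1 h2 h3] := And3 (subvsP a) (subvsP b) (subvsP d).
pose W := vsval a *m adjmx (vsval b) *m vsval d + vsval d *m adjmx (vsval b) *m vsval a.
have WV : W \in V by exact: jordan_closed.
exists (vsproj V (2^-1 *: W)) => //.
apply/funext => x.
rewrite -[RHS]/(2^-1 *: (rep c a (b' (rep c d x)) + rep c d (b' (rep c a x)))).
have aE y z : rep c y (b' z) = part c (op (vsval y) (op (adjmx (vsval b)) z)).
  by rewrite /rep /b' part_id (part_op _ _ (subvsP y)).
rewrite !aE -(linear_funD (part_lin c)) {1}/rep vsprojK ?rpredZ // opZ.
by rewrite /rep !op_mul -opD (part_op _ _ WV) part_id.
Qed.

Lemma repn_JC c : JC_structure (@V_odd_norm R n) (@repn R m c).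
Proof.
exists K, (@rep R m c); split => //; last exact: opnorm_rep.
split.
- by move=> _ [v _ <-]; exact: rep_bounded.
- split; first by exists 0 => //; exact: linear0.
  move=> z _ _ [v _ <-] [w _ <-]; exists (z *: v + w) => //.
  exact: (rep_is_linear c z v w).
(* The range of [rep c] is the image of V under right multiplication by the matrix of the
   projection, a subspace of matrices, hence norm closed. *)
- pose P := \matrix_(i, j) (part c (basis_vec R j) : 'cV[C]_dim) i 0.
  have PE x : part c x = op P x by exact: linear_op (part_lin c) x.
  have -> : range (@rep R m c) =
      [set T : K -> K | exists2 A, A \in (linfun (mulmxr P) @: V)%VS & forall x, T x = op A x].
    apply/seteqP; split => T /=.
      move=> [v _ <-]; exists (vsval v *m P).
        have -> : vsval v *m P = linfun (mulmxr P) (vsval v) by rewrite lfunE.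
        by rewrite memv_img // subvsP.
      by move=> x; rewrite /rep PE op_mul.
    move=> [A /memv_imgP [B BV ->] TE]; exists (vsproj V B) => //.
    by apply/funext => x; rewrite TE /rep vsprojK // PE lfunE op_mul.
  exact: op_range_closed.
- by move=> _ _ _ [a _ <-] [b _ <-] [d _ <-]; exact: rep_triple.
Qed.

End JordanClosure.

(** * Separation of the two eigenspaces *)

Section Frobenius.
Variables (R : realType) (N : nat).
Local Notation C := R[i].
Local Notation K := (Cn R N).
Implicit Types X Y A B : 'M[C]_N.

(** The square of the Hilbert-Schmidt norm, summed by columns: the columns of a matrix form a vector
    of K^dim, and this is its squared norm there. *)
Definition fro X : R := \sum_a q (op X (basis_vec R a)).

Lemma fro_ge0 X : 0 <= fro X. Proof. exact: sumr_ge0. Qed.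

Lemma op_basis A i j : (op A (basis_vec R j) : 'cV[C]_N) i 0 = A i j.
Proof.
rewrite mxE (bigD1 j) //= mxE !eqxx mulr1 big1 ?addr0 // => k kj.
by rewrite mxE (negPf kj) mulr0.
Qed.

Lemma froE X : (fro X)%:C = \tr (adjmx X *m X).
Proof.
rewrite /fro rmorph_sum; apply: eq_bigr => a _.
rewrite /= -ipxx mxE; apply: eq_bigr => i _.
by rewrite op_basis [adjmx X a i]mxE mulrC.
Qed.

Lemma adjmx_mul A B : adjmx (A *m B) = adjmx B *m adjmx A.
Proof.
apply/matrixP => i j; rewrite !mxE rmorph_sum; apply: eq_bigr => k _.
by rewrite !mxE rmorphM mulrC.
Qed.

Lemma adjmxK A : adjmx (adjmx A) = A.
Proof. by apply/matrixP => i j; rewrite !mxE conjCK. Qed.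

Lemma adjmxZ a A : adjmx (a *: A) = Num.conj a *: adjmx A.
Proof. by apply/matrixP => i j; rewrite !mxE rmorphM. Qed.

Lemma adjmxD A B : adjmx (A + B) = adjmx A + adjmx B.
Proof. by apply/matrixP => i j; rewrite !mxE rmorphD. Qed.

Definition unitmx_el A : Prop := adjmx A *m A = 1%:M.

Lemma fro_unitl A X : unitmx_el A -> fro (A *m X) = fro X.
Proof.
move=> hA; apply: complexI; rewrite !froE adjmx_mul -mulmxA [adjmx A *m _]mulmxA.
by rewrite hA mul1mx.
Qed.

Lemma fro_adj X : fro (adjmx X) = fro X.
Proof. by apply: complexI; rewrite !froE adjmxK mxtrace_mulC. Qed.

Lemma fro_conj A X : unitmx_el A -> fro (A *m X *m adjmx A) = fro X.
Proof.
move=> hA; rewrite -mulmxA fro_unitl // -fro_adj adjmx_mul adjmxK fro_unitl //.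
exact: fro_adj.
Qed.

Lemma fro_sum_le (I : finType) (P : pred I) (X : I -> 'M[C]_N) :
  fro (\sum_(i | P i) X i) <= #|P|%:R * \sum_(i | P i) fro (X i).
Proof.
rewrite /fro [X in _ <= _ * X]exchange_big mulr_sumr; apply: ler_sum => a _ /=.
apply: le_trans (q_sum_le _ _).
rewrite le_eqVlt; apply/orP; left; apply/eqP; congr q.
by rewrite /op mulmx_suml.
Qed.

Lemma fro_parallelogram X Y : fro (X + Y) + fro (X - Y) = 2 * (fro X + fro Y).
Proof.
rewrite /fro -!big_split mulr_sumr; apply: eq_bigr => a _ /=.
have -> : op (X + Y) (basis_vec R a) = op X (basis_vec R a) + op Y (basis_vec R a).
  by rewrite /op mulmxDl.
have -> : op (X - Y) (basis_vec R a) = op X (basis_vec R a) - op Y (basis_vec R a).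
  by rewrite /op mulmxBl.
by rewrite qD qB; ring.
Qed.

Lemma froZ (k : R) X : fro (k%:C *: X) = k ^+ 2 * fro X.
Proof.
rewrite /fro mulr_sumr; apply: eq_bigr => a _.
have -> : op (k%:C *: X) (basis_vec R a) = k%:C *: op X (basis_vec R a).
  by rewrite /op -scalemxAl.
exact: qZr.
Qed.

(** The norm of the sum is at most three times the square root of r, whence the factor 9. *)
Lemma fro3 X Y W r : fro X <= r -> fro Y <= r -> fro W <= r ->
  fro (X + Y + W) <= 9 * r.
Proof.
move=> hX hY hW.
pose F (i : 'I_3) := if i == 0 then X else if i == 1 then Y else W.
have := fro_sum_le predT F.
rewrite cardT size_enum_ord !big_ord_recl !big_ord0 /F /= !addr0 addrA => h.
by apply: le_trans h _; lra.
Qed.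

Fixpoint zmx n (S : nat -> 'M[C]_N) : 'M[C]_N :=
  if n is n'.+1
  then zmx n' (fun j => 'i%C *: (S 0%N *m S 1%N *m S j.+2)) else S 0%N.

Lemma op_zmx n S x : op (zmx n S) x = zop n (fun j => op (S j)) x.
Proof.
elim: n S x => [//|n IH] S x /=; rewrite IH.
apply: (@zop_ext R K n _ (cl_step (fun j => op (S j)))) => j _ y.
by rewrite /cl_step !op_mul /op -scalemxAl.
Qed.

(** A generator of the reduced system is a product of three unitaries. What conjugation by it moves
    is a sum of three displacements, up to conjugations that preserve [fro]; so each of the n
    reductions costs a factor 9. *)
Lemma zmx_conj n S r Y :
  (forall j, (j <= n.*2)%N -> unitmx_el (S j)) ->
  (forall j, (j <= n.*2)%N -> fro (Y - S j *m Y *m adjmx (S j)) <= r) ->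
  fro (Y - zmx n S *m Y *m adjmx (zmx n S)) <= 9 ^+ n * r.
Proof.
elim: n S r => [|n IH] S r uS hS /=; first by rewrite expr0 mul1r hS.
rewrite exprSr -mulrA; apply: IH => j jn.
  rewrite /unitmx_el adjmxZ -scalemxAl -scalemxAr scalerA.
  have -> : Num.conj 'i%C * 'i%C = 1 :> C.
    by apply/eqP; rewrite eq_complex /=; apply/andP; split; apply/eqP; ring.
  rewrite scale1r !adjmx_mul -!mulmxA.
  rewrite [adjmx (S 0%N) *m _]mulmxA uS // mul1mx.
  by rewrite [adjmx (S 1%N) *m _]mulmxA uS // mul1mx uS.
pose L j X := S j *m X *m adjmx (S j).
have LB j' X X' : L j' (X - X') = L j' X - L j' X' by rewrite /L mulmxBr mulmxBl.
have froL j' X : (j' <= n.+1.*2)%N -> fro (L j' X) = fro X.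
  by move=> h; rewrite fro_conj //; exact: uS.
have -> : 'i%C *: (S 0%N *m S 1%N *m S j.+2) *m Y *m
    adjmx ('i%C *: (S 0%N *m S 1%N *m S j.+2)) = L 0%N (L 1%N (L j.+2 Y)).
  rewrite adjmxZ -!scalemxAl -scalemxAr scalerA.
  have -> : 'i%C * Num.conj 'i%C = 1 :> C.
    by apply/eqP; rewrite eq_complex /=; apply/andP; split; apply/eqP; ring.
  by rewrite scale1r !adjmx_mul /L !mulmxA.
have -> : Y - L 0%N (L 1%N (L j.+2 Y)) =
    (Y - L 0%N Y) + L 0%N (Y - L 1%N Y) + L 0%N (L 1%N (Y - L j.+2 Y)).
  by rewrite !LB !addrA !subrK.
by apply: fro3; rewrite ?froL ?hS ?ltnS.
Qed.

End Frobenius.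

Section Separation.
Variables (R : realType) (m : nat).
Local Notation C := R[i].
Local Notation n := m.+1.
Local Notation dim := (2 ^ n * 2)%N.
Local Notation K := (Cn R dim).
Local Notation V := (V_odd R n).
Local Notation E := (subvs_of V).

Lemma op_inj (A B : 'M[C]_dim) : (forall x, op A x = op B x) -> A = B.
Proof.
move=> h; apply/matrixP => i j; have /colP /(_ i) := h (basis_vec R j).
by rewrite !op_basis.
Qed.

Let G (p : nat) : 'M[C]_dim := if p is j.+1 then gen R m j else 1%:M.
Let Zm := zmx n (gen R m).

Definition part_mx (b : bool) : 'M[C]_dim := 2^-1 *: (1%:M + (-1) ^+ b *: Zm).
Local Notation P := part_mx.

Lemma op_part_mx b x : op (P b) x = part (Some b) x.
Proof.
rewrite /part_mx opZ opD op1 opZ /Zm op_zmx /part /zpart.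
by [].
Qed.

Let G_herm p : adjmx (G p) = G p.
Proof. by case: p => [|j]; apply: hermx_adjmx; [exact: hermx1|exact: gen_herm]. Qed.

Let G_sqr p : G p *m G p = 1%:M.
Proof. by case: p => [|j]; [exact: mulmx1|exact: gen_sqr]. Qed.

Let G_unit p : unitmx_el (G p).
Proof. by rewrite /unitmx_el G_herm G_sqr. Qed.

Let Z_herm : adjmx Zm = Zm.
Proof.
apply: op_inj => x; apply: ip_inj => y.
rewrite (is_adjointC (op_adj Zm)) !op_zmx.
by rewrite -(zop_adj (clifford_gen R m)).
Qed.

Let ZP b : Zm *m P b = (-1) ^+ b *: P b.
Proof.
apply: op_inj => x; rewrite -op_mul [RHS]opZ !op_part_mx op_zmx.
exact: (z_zpart (clifford_gen R m)).
Qed.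

Let P_herm b : adjmx (P b) = P b.
Proof.
rewrite /P adjmxZ adjmxD adjmxZ Z_herm (hermx_adjmx (@hermx1 R dim)) signC.
by rewrite fmorphV rmorph_nat.
Qed.

Let PP b : P b *m P b = P b.
Proof. by apply: op_inj => x; rewrite -op_mul !op_part_mx part_id. Qed.

Let PG b p : (p <= n.*2.+1)%N -> P b *m G p = G p *m P b.
Proof.
case: p => [|j] jn; first by rewrite mulmx1 mul1mx.
by apply: op_inj => x; rewrite -!op_mul !op_part_mx part_gen.
Qed.

Let PZ b : P b *m Zm = (-1) ^+ b *: P b.
Proof. by rewrite -[LHS]adjmxK adjmx_mul Z_herm P_herm ZP adjmxZ signC P_herm. Qed.

Let M : R := n.*2.+2%:R.

(* A = sum_p conj(G_p P_b) (x) G_p acts on X as sum_p G_p X (G_p P_b)^*, with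
   X = P_b as an eigenvector for 2n + 2. On the other eigenspace of Z every
   Y = P_(~~b) X P_b is mapped by conjugation by Z to -Y, so Y cannot be fixed by
   conjugation by all the G_p. *)
Definition test_mx (b : bool) : 'M[E]_dim :=
  \matrix_(a, a') \sum_(p < n.*2.+2) Num.conj ((G p *m P b) a a') *: elt R m p.

Lemma rep_elt c p x : (p <= n.*2.+1)%N -> rep c (elt R m p) x = op (G p) (part c x).
Proof.
by case: p => [|j] jn; rewrite /rep /elt vsprojK ?one_V_odd ?gen_V_odd.
Qed.

(** A vector of K^dim is read as the matrix [X] of its components; the amplified operator then
    becomes left and right multiplication of [X]. *)
Lemma test_mx_action b c (X : 'M[C]_dim) a :
  \sum_a' rep c (test_mx b a a') (op X (basis_vec R a')) =
  \sum_(p < n.*2.+2) op (G p) (part c (op (X *m adjmx (G p *m P b)) (basis_vec R a))).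
Proof.
transitivity (\sum_a' \sum_(p < n.*2.+2) Num.conj ((G p *m P b) a a') *:
    op (G p) (part c (op X (basis_vec R a')))).
  apply: eq_bigr => a' _; rewrite mxE linear_sum fct_sumE; apply: eq_bigr => p _.
  by rewrite linearZ /= -rep_elt // -ltnS.
rewrite exchange_big; apply: eq_bigr => p _ /=.
have -> : op (X *m adjmx (G p *m P b)) (basis_vec R a) =
    \sum_a' Num.conj ((G p *m P b) a a') *: op X (basis_vec R a').
  rewrite -op_mul {1}[op (adjmx _) _]basis_sum (linear_fun_sum (@op_lin R dim X)).
  apply: eq_bigr => a' _; rewrite (linear_funZ (@op_lin R dim X)); congr (_ *: _).
  by rewrite op_basis [LHS]mxE.
rewrite (linear_fun_sum (part_lin c)) (linear_fun_sum (@op_lin R dim _)).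
apply: eq_bigr => a' _.
by rewrite (linear_funZ (part_lin c)) (linear_funZ (@op_lin R dim _)).
Qed.

Lemma test_mx_fro b c (X : 'M[C]_dim) :
  \sum_a q (\sum_a' rep (Some c) (test_mx b a a') (op X (basis_vec R a'))) =
  fro (\sum_(p < n.*2.+2) G p *m (P c *m X *m P b) *m G p).
Proof.
apply: eq_bigr => a _; rewrite test_mx_action op_sum; congr q.
apply: eq_bigr => p _; rewrite -op_part_mx !op_mul adjmx_mul G_herm P_herm.
by rewrite !mulmxA.
Qed.

Lemma test_mx_lower b k : amp_bnd (fun i j => rep (Some b) (test_mx b i j)) k ->
  M ^+ 2 <= k.
Proof.
move=> h; have := h (fun a => op (P b) (basis_vec R a)).
rewrite test_mx_fro -/(fro (P b)) PP PP.
have -> : \sum_(p < n.*2.+2) G p *m P b *m G p = M%:C *: P b.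
  rewrite (eq_bigr (fun=> P b)) => [|p _].
    by rewrite sumr_const card_ord rmorph_nat scaler_nat.
  by rewrite -mulmxA PG -1?ltnS // mulmxA G_sqr mul1mx.
rewrite froZ ler_pM2r // lt_def fro_ge0 andbT.
apply/eqP => /psumr_eq0P h0.
have [w /eqP] := part_nonzero R m (Some b); apply.
rewrite -op_part_mx [w]basis_sum (linear_fun_sum (@op_lin R dim _)) big1 // => j _.
rewrite (linear_funZ (@op_lin R dim _)) (q_eq0 (h0 _ j isT)) ?scaler0 //.
Qed.

(** A quantitative form of the fact that Y is not fixed by all conjugations: some generator moves Y
    by a definite proportion d, the parallelogram law shortens the corresponding sum Y + G Y G, and
    the sum of all M terms falls short of M by a fixed amount. *)
Lemma test_mx_upper b : exists2 k, 0 <= k < M ^+ 2 &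
  amp_bnd (fun i j => rep (Some (~~ b)) (test_mx b i j)) k.
Proof.
have zero_of (t : R) : 4 * t <= 3 * t -> 0 <= t -> t = 0 by lra.
have par1 (t u : R) : u + 0 = 2 * (t + t) -> u = 4 * t by lra.
have par2 (e t u v : R) : u + v = 2 * (t + t) -> e * t <= v -> u <= (4 - e) * t.
  lra.
have count (e t u w : R) : u <= (4 - e) * t ->
  2^-1 ^+ 2 * u + (2^-1 ^+ 2 * u + w * t) <= (w + 2 - e / 2) * t by lra.
have n9 : 1 <= 9 ^+ n :> R by rewrite exprn_ege1 // ler1n.
(* The 3 is chosen below 4, where fro (Y + Y) = 4 fro Y, and 9^n is the loss in [zmx_conj]. *)
have [d [d0 d3 d9]] : exists d : R, [/\ 0 < d, d <= 3 & 9 ^+ n * d = 3].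
  have n9_gt0 : 0 < 9 ^+ n :> R by apply: lt_le_trans n9.
  exists (3 / 9 ^+ n); split; first by rewrite divr_gt0.
    by rewrite ler_pdivrMr // ler_peMr.
  by rewrite mulrCA mulfV ?mulr1 ?gt_eqF.
have M2 : 2 <= M by rewrite ler_nat.
have Md : 0 <= M - d / 2 by rewrite subr_ge0 (le_trans _ M2) // ler_pdivrMr //; lra.
exists (M * (M - d / 2)).
  rewrite mulr_ge0 ?ler0n //= expr2 ltr_pM2l ?ltr0n //.
  by rewrite ltrBlDr ltrDl divr_gt0.
move=> xi.
pose X : 'M[C]_dim := \matrix_(i, a) (xi a : 'cV[C]_dim) i 0.
have xiE a : xi a = op X (basis_vec R a).
  by apply/colP => i; rewrite op_basis mxE.
under eq_bigr do under eq_bigr do rewrite xiE.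
under [X in _ <= _ * X]eq_bigr do rewrite xiE.
rewrite -/(fro X) test_mx_fro.
set Y := P (~~ b) *m X *m P b.
have froPX A : fro (P (~~ b) *m A) <= fro A.
  apply: ler_sum => a _; rewrite -op_mul op_part_mx.
  exact: (q_proj_le (part_lin _) (part_adj _) (part_id _)).
have froXP A : fro (A *m P b) <= fro A.
  rewrite -fro_adj adjmx_mul P_herm -[X in _ <= X]fro_adj.
  apply: ler_sum => a _; rewrite -op_mul op_part_mx.
  exact: (q_proj_le (part_lin _) (part_adj _) (part_id _)).
have fY : fro Y <= fro X by apply: le_trans (froXP _) (froPX _).
pose L p := G p *m Y *m G p.
have froL p : fro (L p) = fro Y.
  by rewrite /L -{2}(G_herm p) fro_conj //; exact: G_unit.
have ZYZ : Zm *m Y *m adjmx Zm = - Y.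
  rewrite Z_herm /Y; move: (ZP (~~ b)) (PZ b); move: (P (~~ b)) (P b) => A B hA hB.
  rewrite !mulmxA hA -!mulmxA hB -!scalemxAl -!scalemxAr scalerA.
  by case: (b); rewrite ?expr0 ?expr1 ?mulr1 ?mul1r scaleN1r.
(* Otherwise [zmx_conj], with conjugation by Z sending Y to - Y, gives 4 fro Y <= 9^n d fro Y = 3
   fro Y. Then fro Y = 0, against the strict inequalities. *)
have [j jn hj] : exists2 j, (j <= n.*2)%N & d * fro Y <= fro (Y - L j.+1).
  apply: contrapT => hno.
  have hall j : (j <= n.*2)%N -> fro (Y - L j.+1) < d * fro Y.
    by move=> jn; rewrite ltNge; apply/negP => h; apply: hno; exists j.
  have := @zmx_conj R dim n (gen R m) (d * fro Y) Y.
  rewrite -/Zm ZYZ opprK => /(_ _ _) h.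
  have {}h : fro (Y + Y) <= 9 ^+ n * (d * fro Y).
    apply: h => j jn; first exact: (G_unit j.+1).
    by have := hall j jn; rewrite /L [adjmx _](G_herm j.+1) => /ltW.
  have h4 : fro (Y + Y) = 4 * fro Y.
    apply: par1; rewrite -fro_parallelogram subrr; congr (_ + _).
    by symmetry; rewrite /fro big1 // => a _; rewrite /op mul0mx; exact: q0.
  have Y0 : fro Y = 0.
    by apply: zero_of (fro_ge0 Y); rewrite -h4 -d9 -mulrA.
  by have := hall 0%N isT; rewrite Y0 mulr0 ltNge fro_ge0.
pose u := Y + L j.+1.
have hu : fro u <= (4 - d) * fro Y.
  by apply: par2 hj; have := fro_parallelogram Y (L j.+1); rewrite froL.
have jn2 : (j.+1 < n.*2.+2)%N by rewrite ltnS.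
(* Terms 0 and j + 1 are replaced by their average u / 2, which keeps the sum. Each then has [fro]
   at most (1 - d/4) fro Y, so the total of [fro] is at most (M - d/2) fro Y. *)
pose F (p : 'I_n.*2.+2) := if (p == 0%N :> nat) || (p == j.+1 :> nat) then (2^-1)%:C *: u else L p.
have FE : \sum_(p < n.*2.+2) G p *m Y *m G p = \sum_p F p.
  have split2 (f : 'I_n.*2.+2 -> 'M[C]_dim) : \sum_p f p = f ord0 + f (Ordinal jn2) +
      \sum_(p | (p != ord0) && (p != Ordinal jn2)) f p.
    by rewrite (bigD1 ord0) //= (bigD1 (Ordinal jn2)) //= addrA.
  rewrite !split2; congr (_ + _).
    rewrite /F /= eqxx /=; rewrite /u mul1mx mulmx1 -scalerDr.
    have hc : (2^-1)%:C = 2^-1 :> C by rewrite fmorphV rmorph_nat.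
    by rewrite hc scalerDr -scalerDl -mulr2n -[_ *+ 2]mulr_natl mulfV ?pnatr_eq0 // scale1r.
  apply: eq_bigr => p /andP [p0 pj]; rewrite /F.
  have -> : (p == 0%N :> nat) = false by apply/negbTE.
  by have -> : (p == j.+1 :> nat) = false by apply/negbTE; apply: contra pj => /eqP h; apply/eqP/val_inj.
rewrite FE; apply: le_trans (fro_sum_le _ _) _.
rewrite card_ord -mulrA; apply: ler_wpM2l; first exact: ler0n.
apply: (@le_trans _ _ ((M - d / 2) * fro Y)); last exact: ler_wpM2l Md _ _ fY.
rewrite (bigD1 ord0) //= (bigD1 (Ordinal jn2)) //=.
have -> : F ord0 = (2^-1)%:C *: u by [].
have -> : F (Ordinal jn2) = (2^-1)%:C *: u by rewrite /F /= eqxx.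
rewrite (eq_bigr (fun=> fro Y)) => [|p /andP [p0 pj]]; last first.
  rewrite /F; have -> : (p == 0%N :> nat) = false by apply/negbTE.
  have -> : (p == j.+1 :> nat) = false by apply/negbTE; apply: contra pj => /eqP h; apply/eqP/val_inj.
  exact: froL.
rewrite sumr_const.
have -> : #|[pred p | (p != ord0) && (p != Ordinal jn2)]| = n.*2.
  have := cardC (pred2 ord0 (Ordinal jn2)); rewrite card2 card_ord /= add2n => -[e].
  by rewrite -[RHS]e; apply: eq_card => p; rewrite !inE negb_or.
rewrite froZ.
have -> : M = n.*2%:R + 2 by rewrite /M -addn2 natrD.
by rewrite -[_ *+ n.*2]mulr_natl; apply: count.
Qed.

End Separation.

(** * Classification *)

Lemma same_structureP (R : realType) (E : lmodType R[i]) (N1 N2 : matrix_norms E) :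
  same_structure N1 N2 <-> forall k (A : 'M[E]_k), N2 k A = N1 k A.
Proof.
have id_mx k (A : 'M[E]_k) : map_mx idfun A = A by exact: map_mx_id.
by split=> h k A; have := h k A; rewrite id_mx.
Qed.

Section Classification.
Variables (R : realType) (m : nat).
Local Notation C := R[i].
Local Notation n := m.+1.
Local Notation dim := (2 ^ n * 2)%N.
Local Notation K := (Cn R dim).
Local Notation V := (V_odd R n).
Local Notation E := (subvs_of V).
Local Notation nrm := (@V_odd_norm R n).
Local Notation N c := (@repn R m c).

Lemma rep_ampl c k (A : 'M[E]_k) : amp_linear (fun i j => rep c (A i j)).
Proof. by move=> i j; case: (rep_bounded c (A i j)). Qed.

Lemma rep_bnd_ex c k (A : 'M[E]_k) :
  exists2 r, 0 <= r & amp_bnd (fun i j => rep c (A i j)) r.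
Proof. by apply: amp_bnd_ex => i j; exact: bounded_op_bnd (rep_bounded _ _). Qed.

Lemma repn_sep b : exists A : 'M[E]_dim, N (Some (~~ b)) A < N (Some b) A.
Proof.
exists (test_mx R m b).
have [k /andP [k0 kM] hk] := @test_mx_upper R m b.
have [r r0 hr] := rep_bnd_ex (Some b) (test_mx R m b).
apply: le_lt_trans (amp_opnorm_le k0 hk) _.
rewrite ltNge; apply/negP => h.
have := test_mx_lower (amp_bnd_opnorm (rep_ampl _ _) r0 hr k0 h).
by rewrite leNgt kM.
Qed.

Lemma repn_le b k (A : 'M[E]_k) : N (Some b) A <= N None A.
Proof.
apply: amp_opnorm_mono; [exact: rep_ampl|exact: rep_bnd_ex|].
by move=> r r0 h; exact: ((rep_bnd_parts A r0).1 h b).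
Qed.

Lemma repn_neq b : ~ same_structure (N (Some b)) (N (Some (~~ b))).
Proof.
move=> /same_structureP h; have [A] := repn_sep b.
by rewrite h ltxx.
Qed.

Lemma repn_neq3 b : ~ same_structure (N (Some b)) (N None).
Proof.
move=> /same_structureP h; have [A] := repn_sep (~~ b); rewrite negbK -h.
by rewrite ltNge repn_le.
Qed.

(* The s_j have trace 0, so the trace extracts the coordinate of 1. *)
Definition flip_spin (v : E) : E :=
  (2 / dim%:R * \tr (vsval v)) *: elt R m 0 - v.

Lemma flip_spin_linear : linear flip_spin.
Proof.
move=> a v w; rewrite /flip_spin !linearP /= mulrDr scalerDl addrACA scalerA.
by rewrite -[_ * a]mulrA [_ * a]mulrC.
Qed.
HB.instance Definition _ :=
  GRing.isLinear.Build C E E _ flip_spin flip_spin_linear.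

(** Conjugation by another generator changes the sign of this one and keeps its trace. *)
Lemma gen_trace j : (j <= n.*2)%N -> \tr (gen R m j) = 0.
Proof.
move=> jn.
have [k kn kj] : exists2 k, (k <= n.*2)%N & k != j.
  by case: j jn => [|j] _; [exists 1%N|exists 0%N].
have h : gen R m j = - (gen R m k *m gen R m j *m gen R m k).
  by rewrite (gen_anti R kn jn kj) mulNmx opprK -mulmxA gen_sqr mulmx1.
have : \tr (gen R m j) = - \tr (gen R m j).
  by rewrite {1}h raddfN /= mxtrace_mulC mulmxA gen_sqr mul1mx.
move=> /eqP; rewrite -subr_eq0 opprK -mulr2n mulrn_eq0 => /eqP.
exact.
Qed.

Lemma flip_spin_coords v al : has_coords v al -> has_coords (flip_spin v) (twist al).
Proof.
move=> h; have hv := vsval_coords h.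
have dim0 : (dim%:R : C) != 0 by rewrite pnatr_eq0 muln_eq0 expn_eq0.
have trv : \tr (vsval v) = al 0%N * dim%:R.
  rewrite hv mxtraceD mxtraceZ mxtrace1 raddf_sum /= big1 ?addr0 // => j _.
  by rewrite mxtraceZ gen_trace ?mulr0 // -ltnS.
rewrite /has_coords /flip_spin trv mulrCA divfK // [in - v]h.
rewrite opprD addrA -scalerBl [al 0%N * 2]mulrC mulr_natl mulr2n addrK; congr (_ + _).
by rewrite -sumrN; apply: eq_bigr => j _; rewrite scaleNr.
Qed.

Lemma flip_spin_inv : involutive flip_spin.
Proof.
move=> v; have [al h] := coords_ex v.
have h2 := flip_spin_coords (flip_spin_coords h).
rewrite [LHS]h2 [RHS]h twistK; congr (_ + _).
by apply: eq_bigr => j _; rewrite twistK.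
Qed.

Lemma repn_flip b k (A : 'M[E]_k) :
  N (Some b) (map_mx flip_spin A) = N (Some (~~ b)) A.
Proof.
have [al hal] := amp_coords A.
have hal' i j : has_coords (map_mx flip_spin A i j) (twist (al i j)).
  by rewrite mxE; exact: flip_spin_coords.
apply: amp_opnorm_eq; [exact: rep_ampl|exact: rep_ampl|exact: rep_bnd_ex|].
move=> r r0.
have h1 := rep_amp_bnd (Some b) r hal'.
have h2 := rep_amp_bnd (Some (~~ b)) r hal.
have h3 := clop_part_twist m b al r0.
by split=> h; [exact: (h2.2 (h3.1 (h1.1 h)))|exact: (h1.2 (h3.2 (h2.1 h)))].
Qed.

Lemma repn_flip_isometric b :
  completely_isometric (N (Some b)) (N (Some (~~ b))).
Proof.
exists flip_spin; split; last by move=> k A; rewrite repn_flip negbK.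
by move=> v _; exists (flip_spin v) => //; exact: flip_spin_inv.
Qed.

(** [None] corresponds to both eigenspaces of z in [H] being nonzero, and [Some b] to only one. They
    cannot both vanish, as their projections add up to [Q]. *)
Lemma JC_classification M : JC_structure nrm M -> exists c, same_structure M (N c).
Proof.
move=> [H [phi [JC iso ME]]].
have bpsi x : bounded_op (@rep R m None x) by exact: rep_bounded.
have iso' x : opnorm (phi x) = opnorm (@rep R m None x) by rewrite iso opnorm_rep.
have e0 v : @rep R m None (elt R m 0) v = v.
  by rewrite rep_elt // op1.
have cK : clifford n idfun (fun j => @rep R m None (elt R m j.+1)).
  have E j : (j <= n.*2)%N -> @rep R m None (elt R m j.+1) = op (gen R m j).
    by move=> jn; apply/funext => x; rewrite rep_elt.
  have cG := clifford_gen R m.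
  split=> //.
  - by move=> j jn; rewrite E //; exact: cl_lin cG j jn.
  - by move=> j jn; rewrite E //; exact: cl_adj cG j jn.
  - by move=> j jn x; rewrite E //; exact: cl_sqr cG j jn x.
  - by move=> j k jn kn jk x; rewrite !E //; exact: cl_anti cG j k jn kn jk x.
have [Q [S [cS Qn hphi]]] := iso_clifford bpsi JC iso' e0 cK.
have {}Qn := Qn (K_nonzero R m).
pose P b := zpart b Q (zop n S).
have part_bnd b k (al : 'I_k -> 'I_k -> nat -> C) r : 0 <= r ->
    (exists w, P b w != 0) ->
    amp_bnd (fun p s => clop n (P b) (fun j x => S j (P b x)) (al p s)) r <->
    amp_bnd (fun p s => clop n (part (Some b)) (fun j x => op (gen R m j) (part (Some b) x)) (al p s)) r.
  move=> r0 Pn.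
  exact: (clifford_amp_bnd al (clifford_zpart cS b) (@clifford_part R m (Some b))
    (zop_zpart cS b) (@zop_part R m b) Pn (@part_nonzero R m (Some b)) r0).
(* A zero eigenspace imposes no condition on the bound. *)
have part0 b k (al : 'I_k -> 'I_k -> nat -> C) r : 0 <= r ->
    ~ (exists w, P b w != 0) ->
    amp_bnd (fun p s => clop n (P b) (fun j x => S j (P b x)) (al p s)) r.
  move=> r0 Pn xi.
  have P0 w : P b w = 0 by apply/eqP; apply: contrapT => /negP h; apply: Pn; exists w.
  rewrite big1 ?mulr_ge0 ?sumr_ge0 // => i _.
  rewrite big1 ?q0 // => j _; rewrite /clop P0 scaler0 add0r big1 // => l _.
  by rewrite (linear_fun0 (cl_lin cS _)) ?scaler0 // -ltnS.
have final c : (forall k (A : 'M[E]_k) al r, (forall i j, has_coords (A i j) (al i j)) ->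
    0 <= r -> amp_bnd (fun p s => clop n Q S (al p s)) r <->
      amp_bnd (fun i j => rep c (A i j)) r) -> same_structure M (N c).
  move=> hc; apply/same_structureP => k A; rewrite ME.
  have [al hal] := amp_coords A.
  have linphi : amp_linear (fun i j => phi (A i j)).
    by move=> i j; case: (phi_bounded JC (A i j)).
  symmetry; apply: amp_opnorm_eq => //; first exact: rep_ampl.
    by apply: amp_bnd_ex => i j; exact: bounded_op_bnd (phi_bounded JC _).
  move=> r r0; have h1 := hphi _ A al hal r r0; have h2 := hc _ A al r hal r0.
  by split=> h; [exact: (h2.1 (h1.1 h))|exact: (h1.2 (h2.2 h))].
have [P1|P1] := pselect (exists w, P false w != 0);
  have [P2|P2] := pselect (exists w, P true w != 0).
- exists None; apply: final => k A al r hal r0.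
  have h1 := clifford_amp_bnd_parts al cS r0; have h2 := rep_bnd_parts A r0.
  split=> h.
    refine (h2.2 _) => b; refine ((rep_amp_bnd (Some b) r hal).2 _).
    by refine ((part_bnd b k al r r0 _).1 (h1.1 h b)); case: b.
  refine (h1.2 _) => b; refine ((part_bnd b k al r r0 _).2 _); first by case: b.
  exact: ((rep_amp_bnd (Some b) r hal).1 (h2.1 h b)).
- exists (Some false); apply: final => k A al r hal r0.
  have h1 := clifford_amp_bnd_parts al cS r0; have h2 := rep_amp_bnd (Some false) r hal.
  split=> h; first exact: (h2.2 ((part_bnd false k al r r0 P1).1 (h1.1 h false))).
  refine (h1.2 _) => -[]; first exact: part0.
  exact: ((part_bnd false k al r r0 P1).2 (h2.1 h)).
- exists (Some true); apply: final => k A al r hal r0.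
  have h1 := clifford_amp_bnd_parts al cS r0; have h2 := rep_amp_bnd (Some true) r hal.
  split=> h; first exact: (h2.2 ((part_bnd true k al r r0 P2).1 (h1.1 h true))).
  refine (h1.2 _) => -[]; last exact: part0.
  exact: ((part_bnd true k al r r0 P2).2 (h2.1 h)).
exfalso; have [w /eqP] := Qn; apply; rewrite -(zpart_sum n Q S).
have P0 b : zpart b Q (zop n S) w = 0.
  apply/eqP; apply: contrapT => /negP h.
  by case: b h => h; [apply: P2|apply: P1]; exists w.
by rewrite !P0 addr0.
Qed.

Lemma amp1_opnorm (H : hilbert R) (phi : {linear E -> (H -> H)}) (v : E) :
  amp_opnorm (fun i j : 'I_1 => phi ((const_mx v : 'M[E]_1) i j)) = opnorm (phi v).
Proof.
rewrite opnorm_amp; congr amp_opnorm; apply/funext => i; apply/funext => j.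
by rewrite mxE.
Qed.

Lemma JC_nrm M v : JC_structure nrm M -> M 1%N (const_mx v) = nrm v.
Proof. by move=> [H [phi [_ iso ->]]]; rewrite amp1_opnorm iso. Qed.

(** At level 1 every structure gives the norm of [E], so [f] is isometric for it; surjectivity keeps
    the range of the representation, and with it the subtriple. *)
Lemma JC_pullback M M' (f : {linear E -> E}) :
  JC_structure nrm M -> JC_structure nrm M' -> set_surj setT setT f ->
  complete_isometry M' M f ->
  forall M'', JC_structure nrm M'' -> JC_structure nrm (fun k A => M'' k (map_mx f A)).
Proof.
move=> JM JM' fs fi M'' [H [phi [JC iso ME]]].
pose psi v := phi (f v).
have linpsi : linear psi by move=> a v w; rewrite /psi !linearP.
pose Psi : {linear E -> (H -> H)} :=
  HB.pack psi (GRing.isLinear.Build C E (H -> H) _ psi linpsi).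
exists H, Psi; split.
- suff -> : range Psi = range phi by [].
  apply/seteqP; split => T [v _ <-]; first by exists (f v).
  by have [w _ <-] := fs v I; exists w.
- move=> v; rewrite -[Psi v]/(phi (f v)) iso -(JC_nrm v JM') -fi map_const_mx.
  by rewrite (JC_nrm _ JM).
move=> k A; rewrite ME; congr amp_opnorm.
by apply/funext => i; apply/funext => j; rewrite mxE.
Qed.

Lemma repn_not_isometric3 b : ~ completely_isometric (N (Some b)) (N None).
Proof.
move=> [f [fs fi]].
have pull c : exists c', forall k (A : 'M[E]_k), N c (map_mx f A) = N c' A.
  have /JC_classification [c' /same_structureP hc'] := JC_pullback (repn_JC R m None)
    (repn_JC R m (Some b)) fs fi (repn_JC R m c).
  by exists c' => k A; rewrite hc'.
have eqb d : forall k (A : 'M[E]_k), N (Some d) (map_mx f A) = N (Some b) A.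
  have [c' hc'] := pull (Some d).
  have le k (A : 'M[E]_k) : N c' A <= N (Some b) A.
    by rewrite -hc' -fi repn_le.
  (* Among the three structures only that of [Some b] lies below it: [None] dominates the other
     eigenspace, and the other eigenspace exceeds it on the separating matrix. *)
  suff -> : Some b = c' by [].
  have [A hA] := repn_sep (~~ b); rewrite negbK in hA.
  case: c' hc' le => [b'|] hc' le; last first.
    by have := le_trans (repn_le (~~ b) A) (le _ A); rewrite leNgt hA.
  congr Some; have [//|bb] := eqVneq b b'.
  have e : b' = ~~ b by case: b b' bb {hA hc' le fi} => [] [].
  by have := le _ A; rewrite e leNgt hA.
have [A hA] := repn_sep b.
pose B := map_mx (fun v => projT1 (cid2 (fs v I))) A.
have BA : map_mx f B = A.
  apply/matrixP => i j; rewrite !mxE.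
  by case: (cid2 _).
by move: hA; rewrite -BA !eqb ltxx.
Qed.

End Classification.

Theorem proposition6p7 (R : realType) (n : nat) (hn : (1 <= n)%N) :
  exists N1 N2 N3 : matrix_norms (subvs_of (V_odd R n)),
    [/\ [/\ JC_structure (@V_odd_norm R n) N1,
            JC_structure (@V_odd_norm R n) N2 &
            JC_structure (@V_odd_norm R n) N3],
        [/\ ~ same_structure N1 N2,
            ~ same_structure N1 N3 &
            ~ same_structure N2 N3],
        (forall N : matrix_norms (subvs_of (V_odd R n)),
            JC_structure (@V_odd_norm R n) N ->
            [\/ same_structure N N1, same_structure N N2
              | same_structure N N3]) &
        [/\ completely_isometric N1 N2,
            ~ completely_isometric N1 N3 &
            ~ completely_isometric N2 N3]].
Proof.
case: n hn => [//|m] _.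
exists (@repn R m (Some false)), (@repn R m (Some true)), (@repn R m None).
split.
- by split; exact: repn_JC.
- by split; [exact: (@repn_neq R m false)|exact: repn_neq3|exact: repn_neq3].
- move=> N /JC_classification [[[]|] h]; [exact: Or32|exact: Or31|exact: Or33].
- by split; [exact: (@repn_flip_isometric R m false)|
    exact: repn_not_isometric3|exact: repn_not_isometric3].
Qed.
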